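(* Let $\mathrm{Spec}(\mathcal{A}(D_n))$ be the set of continuous unital homomorphisms $\mathcal{A}(D_n)\to\mathbb{C}$ (for the pointwise product) with the weak-$*$ topology. Then $\delta:\hat D_n\to\mathrm{Spec}(\mathcal{A}(D_n))$, $[p,q]\mapsto\delta_{[p,q]}$, where $\delta_{[p,q]}(a)=\hat a([p,q])$, is a well-defined homeomorphism. Moreover, if $\mathrm{Spec}^*(\mathcal{A}(D_n))\subseteq\mathrm{Spec}(\mathcal{A}(D_n))$ denotes the subset of characters (continuous unital $*$-homomorphisms to $\mathbb{C}$) with the weak-$*$ topology, then $\delta$ restricts to a homeomorphism from $D_{n,\mathrm{ext}}$ onto $\mathrm{Spec}^*(\mathcal{A}(D_n))$.
   Context: Fix $n\ge1$. $D_n=Z/U(1)$ with $Z=\{r\in\mathbb{C}^{1+n}:-|r^0|^2+\sum_{i\ge1}|r^i|^2=-1\}$ and $U(1)$ acting by scalars. $\hat Z=\{(p,q)\in\mathbb{C}^{1+n}\times\mathbb{C}^{1+n}:-p^0q^0+\sum_{i\ge1}p^iq^i=-1\}$ with the free proper action $z\cdot(p,q)=(zp,q/z)$ of $\mathbb{C}^*$, and $\hat D_n=\hat Z/\mathbb{C}^*$, a complex manifold. $\Delta_D:D_n\to\hat D_n$, $[r]\mapsto[r,\bar r]$. $\tau:\hat D_n\to\hat D_n$, $\tau([p,q])=[\bar q,\bar p]$ (anti-holomorphic involution), and $D_{n,\mathrm{ext}}=\{x\in\hat D_n:\tau(x)=x\}$. $\mathcal{A}(D_n)=\{\hat a\circ\Delta_D:\hat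 a\in\mathcal{O}(\hat D_n)\}$, where for each $a$ the function $\hat a$ is unique; it is a commutative unital $*$-algebra under pointwise operations and pointwise complex conjugation $a^*=\bar a$ (so $\widehat{a^*}=\overline{\hat a\circ\tau}$), and a Fréchet space with seminorms $\|a\|_{D_n,K}=\sup_{x\in K}|\hat a(x)|$, $K\subseteq\hat D_n$ compact. *)

(* Defs.v *)
(* mathcomp-analysis (topology, normed spaces, Frechet
   differentiability) + mathcomp-real-closed (complex numbers R[i]). *)
From HB Require Import structures.
From mathcomp Require Import all_boot all_order all_algebra.
From mathcomp Require Import all_classical all_reals all_analysis.
From mathcomp Require Import complex.
Import Order.TTheory GRing.Theory Num.Theory.
Import numFieldNormedType.Exports.

Set Implicit Arguments.
Unset Strict Implicit.
Unset Printing Implicit Defensive.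

Local Open Scope classical_set_scope.
Local Open Scope ring_scope.
Local Open Scope quotient_scope.

(* The standard (normed) topology on the complex numbers R[i]; this mirrors
   what numFieldNormedType.Exports does for abstract numClosedFieldTypes. *)
Section ComplexInstances.
Variable R : rcfType.
HB.instance Definition _ := GRing.ComAlgebra.copy R[i] R[i]^o.
HB.instance Definition _ := Vector.copy R[i] R[i]^o.
HB.instance Definition _ := NormedModule.copy R[i] R[i]^o.
End ComplexInstances.

(* Generic topological notions.                                             *)

(* f is a homeomorphism X -> Y *)
Definition is_homeo {X Y : topologicalType} (f : X -> Y) : Prop :=
  continuous f /\ exists g : Y -> X, [/\ continuous g, cancel f g & cancel g f].

(* f is well defined as a map X -> B (B with the subspace topology) and is a
   homeomorphism X -> B *)
Definition homeo_onto {X Y : topologicalType} (B : set Y) (f : X -> Y) : Prop :=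
  exists H : (forall x, B (f x)),
    is_homeo (fun x : X => (SigSub (mem_set (H x)) : set_type B)).

(* f restricts to a well defined map A -> B which is a homeomorphism, where A
   and B carry the subspace topologies *)
Definition homeo_between {X Y : topologicalType} (A : set X) (B : set Y)
    (f : X -> Y) : Prop :=
  exists H : (forall x : set_type A, B (f (val x))),
    is_homeo (fun x : set_type A => (SigSub (mem_set (H x)) : set_type B)).

(* The spaces.                                                              *)
Section Spaces.
Variable R : realType.
Local Notation C := R[i].
Variable n : nat.

(* C^{1+n}, coordinates indexed 0..n; r^0 is  r 0 0 *)
Local Notation V := 'rV[C]_(n.+1).

(* -p^0 q^0 + sum_{i>=1} p^i q^i *)
Definition bil (p q : V) : C :=
  - (p 0 0 * q 0 0) + \sum_(i < n.+1 | i != ord0) p 0 i * q 0 i.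

(* Z = { r : -|r^0|^2 + sum_{i>=1} |r^i|^2 = -1 } *)
Definition Zset : set V :=
  [set r | - (`|r 0 0| ^+ 2) + \sum_(i < n.+1 | i != ord0) `|r 0 i| ^+ 2 = -1].

(* hat Z *)
Definition Zhat : set (V * V) := [set pq | bil pq.1 pq.2 = -1].

Local Notation Zt := (set_type Zset).
Local Notation Zh := (set_type Zhat).

(* U(1) action on Z: r ~ s iff s = u r with |u| = 1 *)
Definition relD (r s : Zt) : bool :=
  `[< exists u : C, `|u| = 1 /\ val s = u *: val r >].

(* C^* action on hat Z: (p,q) ~ (z p, q / z) *)
Definition relDhat (x y : Zh) : bool :=
  `[< exists z : C, z != 0 /\ (val y).1 = z *: (val x).1 /\
                              (val y).2 = z^-1 *: (val x).2 >].

Lemma relD_refl : reflexive relD.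
Proof. by move=> r; apply/asboolP; exists 1; rewrite normr1 scale1r. Qed.

Lemma relD_sym : symmetric relD.
Proof.
move=> r s; apply/asboolP/asboolP => -[u [u1 e]]; exists u^-1;
  (split; first by rewrite normfV u1 invr1);
  have u0 : u != 0 by apply/eqP => u0; move: u1; rewrite u0 normr0 => /esym/eqP; rewrite oner_eq0.
  by rewrite e scalerA mulVf // scale1r.
by rewrite e scalerA mulVf // scale1r.
Qed.

Lemma relD_trans : transitive relD.
Proof.
move=> s r t /asboolP[u [u1 e1]] /asboolP[v [v1 e2]]; apply/asboolP.
by exists (v * u); rewrite normrM u1 v1 mulr1 e2 e1 scalerA.
Qed.

Definition relD_equiv := EquivRel relD relD_refl relD_sym relD_trans.

Lemma relDhat_refl : reflexive relDhat.
Proof. by move=> r; apply/asboolP; exists 1; rewrite oner_eq0 invr1 !scale1r. Qed.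

Lemma relDhat_sym : symmetric relDhat.
Proof.
move=> r s; apply/asboolP/asboolP => -[u [u0 [e1 e2]]]; exists u^-1;
  rewrite invr_eq0 u0 invrK ?e1 ?e2 !scalerA mulVf // mulfV // !scale1r //.
Qed.

Lemma relDhat_trans : transitive relDhat.
Proof.
move=> s r t /asboolP[u [u0 [e1 e2]]] /asboolP[v [v0 [e3 e4]]]; apply/asboolP.
exists (v * u); rewrite mulf_neq0 // e3 e4 e1 e2 !scalerA invfM.
by split => //; split => //; rewrite mulrC.
Qed.

Definition relDhat_equiv :=
  EquivRel relDhat relDhat_refl relDhat_sym relDhat_trans.

(* D_n = Z / U(1) *)
Definition Dn := {eq_quot relD_equiv}.
(* hat D_n = hat Z / C^*, with the quotient topology *)
Definition Dhat := quotient_topology {eq_quot relDhat_equiv}.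
HB.instance Definition _ := Topological.copy Dhat (quotient_topology {eq_quot relDhat_equiv}).

Definition piDhat (x : Zh) : Dhat := \pi_Dhat x.

(* The embedding Delta_D and the involution tau.                            *)

Definition conjV (r : V) : V := map_mx Num.conj r.

Lemma Zset_Zhat (r : V) : Zset r -> Zhat (r, conjV r).
Proof.
rewrite /Zset /Zhat /bil /= /conjV => <-.
by congr (- _ + _); [|apply: eq_bigr => i _]; rewrite mxE normCK.
Qed.

Definition DeltaZ (r : Zt) : Dhat :=
  piDhat (SigSub (mem_set (Zset_Zhat (set_valP r)))).

(* Delta_D : D_n -> hat D_n, [r] |-> [r, conj r] *)
Definition DeltaD (x : Dn) : Dhat := DeltaZ (repr x).

Lemma tau_Zhat (pq : V * V) : Zhat pq -> Zhat (conjV pq.2, conjV pq.1).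
Proof.
rewrite /Zhat /bil /= /conjV => e.
have -> : -1 = (-1 : C)^* by rewrite rmorphN rmorph1.
rewrite -e rmorphD rmorphN rmorph_sum rmorphM /= !mxE mulrC.
by congr (- _ + _); apply: eq_bigr => i _; rewrite rmorphM !mxE mulrC.
Qed.

(* tau([p,q]) = [conj q, conj p] *)
Definition tau (x : Dhat) : Dhat :=
  piDhat (SigSub (mem_set (tau_Zhat (set_valP (repr x))))).

Definition Dext : set Dhat := [set x | tau x = x].

(* Holomorphic functions on hat D_n.                                         *)
(* W = C^{1+n} x C^{1+n} as a normed C-vector space; holomorphic = complex  *)
(* (C-linear) Frechet differentiable at every point of an open set.         *)
(* f : hat D_n -> C is holomorphic iff f o pi is holomorphic on the complex *)
(* submanifold hat Z, i.e. locally the restriction of a holomorphic function *)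
(* on an open subset of C^{1+n} x C^{1+n}.                                    *)

Local Notation W := (V * V)%type.

Definition holomorphic_Dhat (f : Dhat -> C) : Prop :=
  forall z : Zh, exists U : set W, [/\ open U, U (val z) &
    exists g : W -> C, (forall w, U w -> differentiable g w) /\
      (forall z' : Zh, U (val z') -> g (val z') = f (piDhat z'))].

(* The algebra A(D_n).                                                      *)

Definition Aset : set (Dn -> C) :=
  [set a | exists ahat : Dhat -> C, holomorphic_Dhat ahat /\ a = ahat \o DeltaD].

Definition AD := set_type Aset.

(* the (unique) hat a *)
Definition hatA (a : AD) : Dhat -> C := projT1 (cid (set_valP a)).

Definition absC (z : C) : R := complex.Re `|z|.

(* seminorm || a ||_{D_n, K} = sup_{x in K} |hat a (x)| *)
Definition seminorm (K : set Dhat) (a : AD) : R :=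
  sup [set absC (hatA a x) | x in K].

(* continuous unital (C-algebra) homomorphisms A(D_n) -> C, with continuity
   w.r.t. the Frechet topology generated by the seminorms || . ||_{D_n,K} *)
Definition SpecSet : set {ptws AD -> C} := [set phi |
  [/\ (forall a b c : AD, val c = (fun x => val a x + val b x) ->
          phi c = phi a + phi b),
      (forall (l : C) (a b : AD), val b = (fun x => l * val a x) ->
          phi b = l * phi a),
      (forall a b c : AD, val c = (fun x => val a x * val b x) ->
          phi c = phi a * phi b),
      (forall a : AD, val a = (fun=> 1) -> phi a = 1) &
      (forall (a : AD) (e : R), 0 < e ->
         exists (k : nat) (Ks : 'I_k -> set Dhat),
           (forall i, compact (Ks i)) /\
           exists d : R, 0 < d /\
             forall b c : AD, val c = (fun x => val b x - val a x) ->
               (forall i, seminorm (Ks i) c < d) ->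
               absC (phi b - phi a) < e)]].

(* characters: continuous unital *-homomorphisms *)
Definition SpecStarSet : set {ptws AD -> C} := [set phi | SpecSet phi /\
  (forall a b : AD, val b = (fun x => (val a x)^*) -> phi b = (phi a)^*)].

(* The weak-* topology on Spec is the subspace topology inherited from the
   topology of pointwise convergence {ptws AD -> C}.
   delta_x (a) = hat a (x) *)
Definition delta (x : Dhat) : {ptws AD -> C} := fun a => hatA a x.

End Spaces.

(* Main.v *)
Require Import Defs.
From HB Require Import structures.
From mathcomp Require Import all_boot all_order all_algebra.
From mathcomp Require Import all_classical all_reals all_analysis.
From mathcomp Require Import complex.
From mathcomp Require Import ring lra zify.
Import Order.TTheory GRing.Theory Num.Theory.
Import numFieldNormedType.Exports.
Import complex.ComplexField.Normc.

(* Write P_ij = p^i q^j. A character phi sends (P_ij) to a matrix with vanishing 2x2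
   minors satisfying the trace condition of the quadric, so phi(P_ij) = P_ij(x) for a
   unique point x. By continuity phi = delta_x follows once the polynomials in the P_ij
   are dense in O(hat D_n). Density reduces to one complex variable: on the hyperbola
   p^0 q^0 = s a holomorphic function is approximated by Laurent interpolation at the
   points (z, s/z), (s/z, z) with |z| = r. The values there are entire functions of the
   remaining coordinates, which are approximated by Taylor interpolation, and averaging
   over roots of unity restores C^*-invariance.
   The function hat a is determined by a since a holomorphic function vanishing on the
   real points (r, conj r) vanishes on the whole torus orbits of these points, hence for
   all values of the products p^i q^i, hence on a dense set. *)

Set Implicit Arguments.
Unset Strict Implicit.
Unset Printing Implicit Defensive.

Local Open Scope classical_set_scope.
Local Open Scope ring_scope.

(** All complex analysis stays in one variable: holomorphic functions on hat D_n enter only through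
    differentiability of their lifts along holomorphic curves in the quadric and boundedness on
    bounded parts of it. Contours are handled by the exponential: w |-> g(e^w) is entire and
    periodic, so Goursat on rectangles already makes Laurent coefficients independent of the radius.
    In several variables coefficients are avoided: they are integrals, whose dependence on the
    remaining coordinates would have to be studied. Interpolation at finitely many nodes leaves a
    finite sum of values of f, which inherits holomorphy in the remaining coordinates. The obstacle
    is that p^0 q^0 = s degenerates to two lines at s = 0, while s varies with the remaining
    coordinates. The symmetric nodes make sense for every s and give an error bound that does not
    depend on s. Suprema over compact sets of hat D_n are reduced to bounded parts of the quadric by
    choosing in each orbit a representative whose largest |p^i| is 1. *)

(** * Absolute value and topology of the complex numbers in real terms *)

Section AbsC.
Variable R : realType.
Local Notation C := R[i].
Implicit Types z w : C.

Lemma absC_normc z : absC z = normc z.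
Proof. by rewrite /absC normc_def; case: z. Qed.

Lemma normr_absC z : `|z| = (absC z)%:C%C.
Proof. by rewrite /absC normc_def. Qed.

Lemma absC_ge0 z : 0 <= absC z.
Proof. by have := normr_ge0 z; rewrite normr_absC ler0c. Qed.

Lemma absCM z w : absC (z * w) = absC z * absC w.
Proof. by rewrite !absC_normc normcM. Qed.

Lemma absC1 : absC (1 : C) = 1.
Proof. by rewrite absC_normc normc1. Qed.

Lemma absC0 : absC (0 : C) = 0.
Proof. by rewrite absC_normc normc0. Qed.

Lemma absCN z : absC (- z) = absC z.
Proof. by rewrite !absC_normc normcN. Qed.

Lemma absCB z w : absC (z - w) = absC (w - z).
Proof. by rewrite -absCN opprB. Qed.

Lemma absCD z w : absC (z + w) <= absC z + absC w.
Proof. by rewrite !absC_normc le_normcD. Qed.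

Lemma absCBD z w : absC (z - w) <= absC z + absC w.
Proof. by rewrite (le_trans (absCD _ _)) // absCN. Qed.

Lemma absC_sub z w : absC z - absC w <= absC (z - w).
Proof. by have := absCD (z - w) w; rewrite subrK; lra. Qed.

Lemma absCX z k : absC (z ^+ k) = absC z ^+ k.
Proof. by elim: k => [|k IH]; rewrite ?expr0 ?absC1 // !exprS absCM IH. Qed.

Lemma absCV z : absC z^-1 = (absC z)^-1.
Proof. by rewrite !absC_normc normcV. Qed.

Lemma absC_real (x : R) : absC (x%:C)%C = `|x|.
Proof. by rewrite absC_normc /= expr0n addr0 sqrtr_sqr. Qed.

Lemma absC_i : absC ('i%C : C) = 1.
Proof. by rewrite absC_normc /= expr0n expr1n add0r sqrtr1. Qed.

Lemma absC_eq0 z : (absC z == 0) = (z == 0).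
Proof.
apply/eqP/eqP => [|->]; last exact: absC0.
by rewrite absC_normc => /eq0_normc.
Qed.

Lemma absC_gt0 z : (0 < absC z) = (z != 0).
Proof. by rewrite lt_def absC_eq0 absC_ge0 andbT. Qed.

Lemma absC_sum (I : Type) (r : seq I) (P : pred I) (F : I -> C) :
  absC (\sum_(i <- r | P i) F i) <= \sum_(i <- r | P i) absC (F i).
Proof.
elim/big_ind2: _ => [|x1 x2 y1 y2 h1 h2|i _//]; first by rewrite absC0.
by rewrite (le_trans (absCD _ _)) // lerD.
Qed.

Lemma absC_Re z : `|complex.Re z| <= absC z.
Proof.
rewrite absC_normc; case: z => a b /=; rewrite -(sqrtr_sqr a) ler_wsqrtr //.
by rewrite lerDl sqr_ge0.
Qed.

Lemma absC_Im z : `|complex.Im z| <= absC z.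
Proof.
rewrite absC_normc; case: z => a b /=; rewrite -(sqrtr_sqr b) ler_wsqrtr //.
by rewrite lerDr sqr_ge0.
Qed.

Lemma absC_ReIm z : absC z <= `|complex.Re z| + `|complex.Im z|.
Proof.
rewrite {1}[z]complexE.
by rewrite (le_trans (absCD _ _)) // absCM absC_i mul1r !absC_real.
Qed.

Lemma absC_conj z : absC (z^*) = absC z.
Proof. by rewrite /absC norm_conjC. Qed.

(** Balls in [R[i]] have radii in [R[i]]; a positive radius is real, so all later epsilon arguments
    can run in [R]. *)
Lemma nbhsCP z (A : set C) :
  nbhs z A <-> exists2 d : R, 0 < d & forall w, absC (w - z) < d -> A w.
Proof.
split.
  move/nbhs_ballP => -[e /= e0 h].
  have eR : e = (complex.Re e)%:C%C by rewrite RRe_real // gtr0_real.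
  exists (complex.Re e) => [|w hw].
    by move: e0; rewrite eR ltcR.
  apply: h; rewrite -ball_normE /= eR normr_absC ltcR.
  by rewrite absCB.
case=> d d0 h; apply/nbhs_ballP; exists (d%:C)%C => /=; first by rewrite ltcR.
move=> w; rewrite -ball_normE /= normr_absC ltcR absCB; exact: h.
Qed.

Lemma continuousCP (f : C -> C) z :
  {for z, continuous f} <-> forall e : R, 0 < e ->
    exists2 d : R, 0 < d & forall w, absC (w - z) < d -> absC (f w - f z) < e.
Proof.
split=> [cf e e0|h A /nbhsCP[e e0 hA]].
  have /cf /nbhsCP[d d0 h] : nbhs (f z) [set w | absC (w - f z) < e].
    by apply/nbhsCP; exists e.
  by exists d.
have [d d0 hd] := h _ e0.
by apply/nbhsCP; exists d => // w /hd; apply: hA.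
Qed.

(** Carathéodory's form of differentiability. The continuous slope [q] is what the Goursat estimate
    and the telescoping of Laurent sums work with. *)
Lemma differentiable_slope (h : C -> C) z : differentiable h z <->
  exists2 q : C -> C, {for z, continuous q} &
    forall w, h w - h z = (w - z) * q w.
Proof.
rewrite -derivable1_diffP; split.
  move=> /derivable1P dh.
  pose q w := if w == z then h^`()%classic z else (h w - h z) / (w - z).
  exists q; last first.
    move=> w; rewrite /q; case: eqVneq => [->|wz]; first by rewrite !subrr mul0r.
    by field; rewrite subr_eq0.
  apply/continuousCP => e e0.
  rewrite /q eqxx.
  have dz : derivable h z 1 by apply/derivable1P.
  have {}dz : h^`()%classic z = lim (l^-1 *: (h (l + z) - h z) @[l --> 0^']) by [].
  have /cvg_ex[/= l hl] : cvg (l^-1 *: (h (l + z) - h z) @[l --> 0^']).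
    have : derivable h z 1 by apply/derivable1P.
    rewrite /derivable; under eq_fun do rewrite [_ *: 1]mulr1; exact.
  have {}dz : h^`()%classic z = l by rewrite dz; exact: cvg_lim.
  have hA : nbhs l [set w | absC (w - l) < e] by apply/nbhsCP; exists e.
  have /nbhsCP[d d0 hd] : nbhs (0 : C)
      (fun x => x != 0 -> absC (x^-1 *: (h (x + z) - h z) - l) < e) := hl _ hA.
  exists d => // w wd; case: eqVneq => [_|wz]; first by rewrite dz subrr absC0.
  have := hd (w - z); rewrite subr0 subr_eq0 => /(_ wd wz).
  by rewrite subrK dz [_ *: _]mulrC.
case=> q /continuousCP cq hq; apply/cvg_ex; exists (q z).
move=> A /nbhsCP[e e0 hA].
suff : nbhs (0 : C) (fun x => x != 0 ->
    A (x^-1 *: ((h \o shift z) (x *: 1) - h z))) by [].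
have [d d0 hd] := cq _ e0; apply/nbhsCP; exists d => // w.
rewrite subr0 => wd w0; apply: hA.
rewrite /= [w *: 1]mulr1 hq addrK [_ *: _]mulrA mulVf // mul1r.
by apply: hd; rewrite addrK.
Qed.

End AbsC.

(** * Primitives of complex-valued functions of a real variable *)

Section Primitives.
Variable R : realType.
Local Notation C := R[i].

Lemma Re_continuous : continuous (@complex.Re R).
Proof.
move=> z A /nbhs_ballP[e /= e0 hA]; apply/nbhsCP; exists e => // w wz.
apply: hA; rewrite -ball_normE /= distrC.
have -> : complex.Re w - complex.Re z = complex.Re (w - z) by case: w {wz} => ? ?; case: z.
exact: le_lt_trans (absC_Re _) wz.
Qed.

Lemma Im_continuous : continuous (@complex.Im R).
Proof.
move=> z A /nbhs_ballP[e /= e0 hA]; apply/nbhsCP; exists e => // w wz.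
apply: hA; rewrite -ball_normE /= distrC.
have -> : complex.Im w - complex.Im z = complex.Im (w - z) by case: w {wz} => ? ?; case: z.
exact: le_lt_trans (absC_Im _) wz.
Qed.

Lemma continuous_ReIm (T : topologicalType) (f : T -> C) :
  continuous (fun t => complex.Re (f t)) -> continuous (fun t => complex.Im (f t)) ->
  continuous f.
Proof.
move=> cr ci t A /nbhsCP[e e0 hA].
have e20 : 0 < e / 2 by rewrite divr_gt0.
have hB (x : R) : nbhs x [set y | `|y - x| < e / 2].
  by apply/nbhs_ballP; exists (e / 2) => //= y; rewrite -ball_normE /= distrC.
have hr : nbhs t [set s | `|complex.Re (f s) - complex.Re (f t)| < e / 2] := cr t _ (hB _).
have hi : nbhs t [set s | `|complex.Im (f s) - complex.Im (f t)| < e / 2] := ci t _ (hB _).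
apply: filterS (filterI hr hi) => s [/= h1 h2]; apply: hA.
apply: le_lt_trans (absC_ReIm _) _; move: h1 h2.
by case: (f s) => a b; case: (f t) => c d /=; lra.
Qed.

Lemma real_complex_continuous : continuous (fun t : R => (t%:C)%C : C).
Proof.
by apply: continuous_ReIm => t /=; [exact: cvg_id|exact: cvg_cst].
Qed.

Lemma derive_bound (F f : R -> R) (a b M : R) : a <= b ->
  (forall t : R, is_derive t 1 F (f t)) ->
  (forall t, a <= t <= b -> `|f t| <= M) -> `|F b - F a| <= M * (b - a).
Proof.
move=> ab dF fM.
have cF : {within `[a, b], continuous F}.
  by apply: derivable_within_continuous => t _; apply: ex_derive.
have [c] := MVT_segment ab (fun x _ => dF x) cF.
rewrite in_itv /= => cab ->; rewrite normrM (ger0_norm (_ : 0 <= b - a)) ?subr_ge0 //.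
by rewrite ler_wpM2r ?subr_ge0 // fM.
Qed.

Lemma ex_primitive_pos (f : R -> R) : continuous f ->
  exists F : R -> R, forall x : R, -1 < x -> is_derive x 1 F (f x).
Proof.
move=> cf.
exists (fun x => \int[lebesgue_measure]_(t in [set` Interval (BLeft (-1)) (BRight x)]) f t)%R.
move=> x x1.
have xu : x < x + 1 by lra.
have := @continuous_FTC1 R f (BLeft (-1)) x (x + 1) xu.
case.
- apply: continuous_compact_integrable; first exact: segment_compact.
  exact: continuous_subspaceT.
- by [].
- exact: cf.
move=> d e; split => //.
by rewrite -derive1E e.
Qed.

(** The integral from -1 gives a primitive to the right of -1, its reflection one to the left of 1.
    On the overlap their difference has zero derivative, so after normalising both at 0 they
    glue. *)
Lemma ex_real_primitive (f : R -> R) : continuous f ->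
  exists F : R -> R, forall x : R, is_derive x 1 F (f x).
Proof.
move=> cf; have [G hG] := ex_primitive_pos cf.
have [H0 hH0] : exists F : R -> R, forall x : R, -1 < x -> is_derive x 1 F (f (- x)).
  apply: ex_primitive_pos => x; apply: continuous_comp; last exact: cf.
  exact: opp_continuous.
pose H x := - H0 (- x).
have hH (x : R) : x < 1 -> is_derive x 1 H (f x).
  move=> x1; have nx : -1 < - x by lra.
  have d1 := is_deriveN (is_derive1_comp (hH0 _ nx) (is_deriveN (is_derive_id x 1))).
  by apply: is_derive_eq d1 _; rewrite opprK; lra.
pose F x := if x < 0 then H x - H 0 else G x - G 0.
have FG y : -1 < y -> F y = G y - G 0.
  move=> y1; rewrite /F; case: ltP => // y0.
  have dD t : t \in `]y, (0 : R)[ -> is_derive t 1 (H - G) 0.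
    rewrite in_itv /= => /andP[t1 t2].
    have t3 : -1 < t by lra.
    have t4 : t < 1 by lra.
    by apply: is_derive_eq (is_deriveB (hH _ t4) (hG _ t3)) _; rewrite subrr.
  have cD : {within `[y, 0], continuous (H - G)}.
    apply: derivable_within_continuous => t; rewrite in_itv /= => /andP[t1 t2].
    have t3 : -1 < t by lra.
    have t4 : t < 1 by lra.
    by have d1 := hH _ t4; have d2 := hG _ t3; apply: derivableB; apply: ex_derive.
  have [c _] := MVT_segment (ltW y0) dD cD.
  rewrite mul0r => e; have {}e : H 0 - G 0 - (H y - G y) = 0 by exact: e.
  lra.
exists F => x; case: (ltP x 0) => x0.
  apply: (@near_eq_is_derive _ _ _ (H - cst (H 0))).
    near=> y; have y0 : y < 0 by near: y; exact: lt_nbhsl.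
    by rewrite /F y0.
  have x1 : x < 1 by lra.
  by apply: is_derive_eq (is_deriveB (hH _ x1) (is_derive_cst (H 0) x 1)) _; rewrite subr0.
have x1 : -1 < x by lra.
apply: (@near_eq_is_derive _ _ _ (G - cst (G 0))).
  near=> y; have y0 : -1 < y by near: y; exact: lt_nbhsr.
  by rewrite FG.
by apply: is_derive_eq (is_deriveB (hG _ x1) (is_derive_cst (G 0) x 1)) _; rewrite subr0.
Unshelve. all: by end_near. Qed.

(** Stated componentwise, so that the real mean value theorem and the real fundamental theorem of
    calculus apply. *)
Definition is_primitive (F f : R -> C) := forall t : R,
  is_derive t 1 (fun s => complex.Re (F s)) (complex.Re (f t)) /\
  is_derive t 1 (fun s => complex.Im (F s)) (complex.Im (f t)).

Lemma ex_complex_primitive (f : R -> C) : continuous f ->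
  exists F, is_primitive F f.
Proof.
move=> cf.
have [F1 h1] : exists F : R -> R, forall x : R, is_derive x 1 F (complex.Re (f x)).
  by apply: ex_real_primitive => t; apply: continuous_comp; [exact: cf|exact: Re_continuous].
have [F2 h2] : exists F : R -> R, forall x : R, is_derive x 1 F (complex.Im (f x)).
  by apply: ex_real_primitive => t; apply: continuous_comp; [exact: cf|exact: Im_continuous].
by exists (fun t => F1 t +i* F2 t)%C => t; split; [exact: h1|exact: h2].
Qed.

Lemma is_primitiveD (F G f g : R -> C) : is_primitive F f -> is_primitive G g ->
  is_primitive (fun t => F t + G t) (fun t => f t + g t).
Proof.
move=> hF hG t; have [h1 h2] := hF t; have [h3 h4] := hG t; split.
  have -> : (fun s => complex.Re (F s + G s)) =
      (fun s => complex.Re (F s)) + (fun s => complex.Re (G s)).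
    by apply/funext => s; rewrite raddfD.
  by apply: is_derive_eq (is_deriveD h1 h3) _; rewrite raddfD.
have -> : (fun s => complex.Im (F s + G s)) =
    (fun s => complex.Im (F s)) + (fun s => complex.Im (G s)).
  by apply/funext => s; rewrite raddfD.
by apply: is_derive_eq (is_deriveD h2 h4) _; rewrite raddfD.
Qed.

Lemma ReM (z w : C) :
  complex.Re (z * w) = complex.Re z * complex.Re w - complex.Im z * complex.Im w.
Proof. by case: z => a b; case: w. Qed.

Lemma ImM (z w : C) :
  complex.Im (z * w) = complex.Re z * complex.Im w + complex.Im z * complex.Re w.
Proof. by case: z => a b; case: w. Qed.

Lemma is_primitiveZ (c : C) (F f : R -> C) : is_primitive F f ->
  is_primitive (fun t => c * F t) (fun t => c * f t).
Proof.
move=> hF t; have [h1 h2] := hF t; split.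
  have -> : (fun s => complex.Re (c * F s)) =
      (complex.Re c *: (fun s => complex.Re (F s))) -
      (complex.Im c *: (fun s => complex.Im (F s))).
    by apply/funext => s; rewrite ReM.
  by apply: is_derive_eq (is_deriveB (is_deriveZ _ h1) (is_deriveZ _ h2)) _; rewrite ReM.
have -> : (fun s => complex.Im (c * F s)) =
    (complex.Re c *: (fun s => complex.Im (F s))) +
    (complex.Im c *: (fun s => complex.Re (F s))).
  by apply/funext => s; rewrite ImM.
by apply: is_derive_eq (is_deriveD (is_deriveZ _ h2) (is_deriveZ _ h1)) _; rewrite ImM.
Qed.

Lemma is_primitive_real (F f : R -> R) : (forall t : R, is_derive t 1 F (f t)) ->
  is_primitive (fun t => (F t)%:C%C) (fun t => (f t)%:C%C).
Proof. by move=> h t; split => //=; exact: is_derive_cst. Qed.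

(** The factor 2 comes from estimating real and imaginary parts separately; it is carried along in
    all later bounds. *)
Lemma primitive_bound (F f : R -> C) (a b M : R) : a <= b -> is_primitive F f ->
  (forall t, a <= t <= b -> absC (f t) <= M) ->
  absC (F b - F a) <= 2 * M * (b - a).
Proof.
move=> ab pF fM; apply: le_trans (absC_ReIm _) _.
have h1 : `|complex.Re (F b) - complex.Re (F a)| <= M * (b - a).
  apply: (@derive_bound (fun t => complex.Re (F t)) (fun t => complex.Re (f t)) _ _ _ ab).
    by move=> t; have [] := pF t.
  by move=> t /fM; apply: le_trans; exact: absC_Re.
have h2 : `|complex.Im (F b) - complex.Im (F a)| <= M * (b - a).
  apply: (@derive_bound (fun t => complex.Im (F t)) (fun t => complex.Im (f t)) _ _ _ ab).
    by move=> t; have [] := pF t.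
  by move=> t /fM; apply: le_trans; exact: absC_Im.
by rewrite !raddfB /=; lra.
Qed.

(** The increment of a chosen primitive, with the zero function as default if there is none. The
    choice depends on [f] alone, so additivity in the interval is an algebraic identity. *)
Definition cint (f : R -> C) (a b : R) : C :=
  let F := xget (fun=> 0) [set F | is_primitive F f] in F b - F a.

Lemma primitive_unique (F G f : R -> C) a b :
  is_primitive F f -> is_primitive G f -> F b - F a = G b - G a.
Proof.
move=> hF hG.
have pD := is_primitiveD hF (is_primitiveZ (-1) hG).
wlog ab : a b / a <= b.
  move=> h; case: (leP a b) => [|/ltW] ab; first exact: h.
  by rewrite -opprB -[RHS]opprB (h b a ab).
apply/eqP; rewrite -subr_eq0 -absC_eq0 eq_le absC_ge0 andbT.
have := @primitive_bound _ _ a b 0 ab pD.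
rewrite mulr0 mul0r => h.
have -> : F b - F a - (G b - G a) = F b + -1 * G b - (F a + -1 * G a) by ring.
by apply: h => t _; rewrite mulN1r subrr absC0.
Qed.

Lemma cintE (F f : R -> C) a b : is_primitive F f -> cint f a b = F b - F a.
Proof.
move=> pF; rewrite /cint; apply: primitive_unique (pF).
by case: xgetP => [G _ //|/(_ F)].
Qed.

Lemma cint_primitive (f : R -> C) : continuous f -> exists2 F, is_primitive F f &
  forall a b, cint f a b = F b - F a.
Proof. by move=> /ex_complex_primitive[F pF]; exists F => // a b; exact: cintE. Qed.

Lemma cintD (f g : R -> C) a b : continuous f -> continuous g ->
  cint (fun t => f t + g t) a b = cint f a b + cint g a b.
Proof.
move=> /cint_primitive[F pF ->] /cint_primitive[G pG ->].
by rewrite (cintE _ _ (is_primitiveD pF pG)); ring.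
Qed.

Lemma cintZ (c : C) (f : R -> C) a b : continuous f ->
  cint (fun t => c * f t) a b = c * cint f a b.
Proof.
move=> /cint_primitive[F pF ->].
by rewrite (cintE _ _ (is_primitiveZ c pF)); ring.
Qed.

Lemma cint_bound (f : R -> C) a b M : continuous f -> a <= b ->
  (forall t, a <= t <= b -> absC (f t) <= M) -> absC (cint f a b) <= 2 * M * (b - a).
Proof. by move=> /cint_primitive[F pF ->] ab; exact: primitive_bound. Qed.

Lemma cint_chasles (f : R -> C) a b c : cint f a b + cint f b c = cint f a c.
Proof. by rewrite /cint; ring. Qed.

Lemma cint_affine (A B : C) a b : cint (fun t => A + B * (t%:C)%C) a b =
  A * (b - a)%:C%C + B * ((b ^+ 2 - a ^+ 2) / 2)%:C%C.
Proof.
have h1 : is_primitive (fun t : R => (t%:C)%C) (fun t => (1%:C)%C).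
  by apply: is_primitive_real => t; exact: is_derive_id.
have h2 : is_primitive (fun t : R => ((t ^+ 2 / 2)%:C)%C) (fun t => (t%:C)%C).
  apply: is_primitive_real => t.
  have -> : (fun s : R => s ^+ 2 / 2) = 2^-1 *: (id ^+ 2).
    by apply/funext => s; rewrite [RHS]mulrC.
  apply: is_derive_eq.
  by rewrite /GRing.scale /=; lra.
have := is_primitiveD (is_primitiveZ A h1) (is_primitiveZ B h2).
have -> : (fun t => A * (1%:C)%C + B * (t%:C)%C) = (fun t => A + B * (t%:C)%C).
  by apply/funext => t; rewrite mulr1.
by move/cintE ->; rewrite !mulrBl !rmorphB /=; ring.
Qed.

End Primitives.

(** * Goursat's theorem on rectangles *)

Section Goursat.
Variable R : realType.
Local Notation C := R[i].
Implicit Types h : C -> C.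

Definition cpt (x y : R) : C := ((x%:C)%C + 'i%C * (y%:C)%C).

Lemma cptE (z : C) : z = cpt (complex.Re z) (complex.Im z).
Proof. exact: complexE. Qed.

Lemma continuous_cptx (y : R) : continuous (fun t : R => cpt t y).
Proof.
move=> t; apply: cvgD; last exact: cvg_cst.
exact: real_complex_continuous.
Qed.

Lemma continuous_cpty (x : R) : continuous (fun t : R => cpt x t).
Proof.
move=> t; apply: cvgD; first exact: cvg_cst.
by apply: cvgM; [exact: cvg_cst|exact: real_complex_continuous].
Qed.

Lemma continuous_row h (y : R) : continuous h -> continuous (fun t => h (cpt t y)).
Proof.
move=> ch t; apply: (@continuous_comp _ _ _ (fun t => cpt t y) h); last exact: ch.
exact: continuous_cptx.
Qed.

Lemma continuous_col h (x : R) : continuous h -> continuous (fun t => h (cpt x t)).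
Proof.
move=> ch t; apply: (@continuous_comp _ _ _ (fun t => cpt x t) h); last exact: ch.
exact: continuous_cpty.
Qed.

Definition rect_int h (x0 x1 y0 y1 : R) : C :=
  cint (fun t => h (cpt t y0)) x0 x1 + 'i%C * cint (fun t => h (cpt x1 t)) y0 y1
  - cint (fun t => h (cpt t y1)) x0 x1 - 'i%C * cint (fun t => h (cpt x0 t)) y0 y1.

Lemma rect_int_split h x0 x1 x2 y0 y1 y2 : rect_int h x0 x2 y0 y2 =
  rect_int h x0 x1 y0 y1 + rect_int h x1 x2 y0 y1 +
  rect_int h x0 x1 y1 y2 + rect_int h x1 x2 y1 y2.
Proof.
rewrite /rect_int -!(@cint_chasles _ _ x0 x1 x2) -!(@cint_chasles _ _ y0 y1 y2).
by ring.
Qed.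

Lemma rect_intD h1 h2 x0 x1 y0 y1 : continuous h1 -> continuous h2 ->
  rect_int (fun z => h1 z + h2 z) x0 x1 y0 y1 =
  rect_int h1 x0 x1 y0 y1 + rect_int h2 x0 x1 y0 y1.
Proof.
move=> c1 c2; rewrite /rect_int !cintD; first by ring.
all: by (apply: continuous_row || apply: continuous_col).
Qed.

Lemma rect_int_affine (A B : C) x0 x1 y0 y1 :
  rect_int (fun z => A + B * z) x0 x1 y0 y1 = 0.
Proof.
have hx y : (fun t => A + B * cpt t y) =
    (fun t => (A + B * ('i%C * (y%:C)%C)) + B * (t%:C)%C).
  by apply/funext => t; rewrite /cpt; ring.
have hy x : (fun t => A + B * cpt x t) =
    (fun t => (A + B * (x%:C)%C) + (B * 'i%C) * (t%:C)%C).
  by apply/funext => t; rewrite /cpt; ring.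
rewrite /rect_int !hx !hy !cint_affine.
have -> : forall a b : R, (((b ^+ 2 - a ^+ 2) / 2)%:C)%C =
    ((b%:C ^+ 2 - a%:C ^+ 2) / 2)%C :> C.
  by move=> a b; rewrite rmorphM rmorphB !rmorphXn fmorphV rmorph_nat.
rewrite !rmorphB /=.
have := @sqr_i R; set j : C := 'i%C; move: j => j j2.
move: (x0%:C)%C (x1%:C)%C (y0%:C)%C (y1%:C)%C => a b c d.
have j3 : j ^+ 2 = -1 by [].
rewrite -[LHS]/(_ : C).
transitivity (B * (j ^+ 2 + 1) * (d ^+ 2 - c ^+ 2) / 2 - B * (j ^+ 2 + 1) * (d ^+ 2 - c ^+ 2) / 2 :> C).
  by field.
by rewrite subrr.
Qed.

Lemma rect_int_bound h x0 x1 y0 y1 M : continuous h -> x0 <= x1 -> y0 <= y1 ->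
  (forall x y, x0 <= x <= x1 -> y0 <= y <= y1 -> absC (h (cpt x y)) <= M) ->
  absC (rect_int h x0 x1 y0 y1) <= 4 * M * ((x1 - x0) + (y1 - y0)).
Proof.
move=> ch x01 y01 hM.
have b1 : absC (cint (fun t => h (cpt t y0)) x0 x1) <= 2 * M * (x1 - x0).
  apply: cint_bound => //; first exact: continuous_row.
  by move=> t tx; apply: hM => //; rewrite lexx y01.
have b2 : absC (cint (fun t => h (cpt t y1)) x0 x1) <= 2 * M * (x1 - x0).
  apply: cint_bound => //; first exact: continuous_row.
  by move=> t tx; apply: hM => //; rewrite lexx y01.
have b3 : absC (cint (fun t => h (cpt x0 t)) y0 y1) <= 2 * M * (y1 - y0).
  apply: cint_bound => //; first exact: continuous_col.
  by move=> t tx; apply: hM => //; rewrite lexx x01.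
have b4 : absC (cint (fun t => h (cpt x1 t)) y0 y1) <= 2 * M * (y1 - y0).
  apply: cint_bound => //; first exact: continuous_col.
  by move=> t tx; apply: hM => //; rewrite lexx x01.
rewrite /rect_int; set A := cint _ _ _ in b1 *; set B := cint _ _ _ in b4 *.
set D := cint _ _ _ in b2 *; set E := cint _ _ _ in b3 *.
have := absCBD (A + 'i%C * B - D) ('i%C * E).
have := absCBD (A + 'i%C * B) D.
have := absCD A ('i%C * B).
rewrite !absCM !absC_i !mul1r; lra.
Qed.

Lemma nested_point (u l : nat -> R) :
  (forall k, u k <= u k.+1) -> (forall k, u k.+1 + l k.+1 <= u k + l k) ->
  (forall k, 0 <= l k) -> exists x, forall k, u k <= x <= u k + l k.
Proof.
move=> u1 u2 l0.
have um i j : (i <= j)%N -> u i <= u j.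
  by move=> ij; apply: (homo_leq (@lexx _ _) (fun _ _ _ => @le_trans _ _ _ _ _)).
have lm i j : (i <= j)%N -> u j + l j <= u i + l i.
  move=> ij; have := @homo_leq _ (fun k => - (u k + l k)) <=%R (@lexx _ _) (fun y x z => @le_trans _ _ y x z).
  move=> h; have := h (fun k => _) _ _ ij; rewrite lerN2; apply => {}k.
  by rewrite lerN2.
have ul i j : u i <= u j + l j.
  case/orP: (leq_total i j) => ij; first by rewrite (le_trans (um _ _ ij)) // lerDl.
  by apply: le_trans (lm _ _ ij); rewrite lerDl.
exists (sup (range u)) => k.
have hs : has_sup (range u).
  split; first by exists (u 0%N); exists 0%N.
  by exists (u 0%N + l 0%N) => _ [i _ <-].
apply/andP; split; first by apply: ub_le_sup => //; case: hs.
by apply: sup_le_ub => [|_ [i _ <-]]; [exists (u 0%N); exists 0%N|exact: ul].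
Qed.

Lemma half_pow_small (a e : R) : 0 < e -> exists k : nat, a / 2 ^+ k < e.
Proof.
move=> e0; have [k _ hk] : exists2 k : nat, True & a / e < k%:R.
  exists (Num.truncn `|a / e|).+1 => //.
  by apply: le_lt_trans (ler_norm _) _; exact: truncnS_gt.
exists k; rewrite ltr_pdivrMr ?exprn_gt0 // mulrC -ltr_pdivrMr //.
apply: lt_trans hk _; rewrite -natrX ltr_nat; exact: ltn_expl.
Qed.

Lemma continuous_affineC (a b : C) : continuous (fun w : C => a + b * w).
Proof.
move=> z; apply/continuousCP => e e0; have b0 := absC_ge0 b.
have b1 : 0 < absC b + 1 by lra.
exists (e / (absC b + 1)) => [|w]; first by rewrite divr_gt0.
rewrite ltr_pdivlMr // => h.
have -> : a + b * w - (a + b * z) = (w - z) * b by ring.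
rewrite absCM; apply: le_lt_trans h; rewrite ler_wpM2l ?absC_ge0 //; lra.
Qed.

(** After k quadrisections the rectangle has width plus height r = (a + b) / 2^k. Near the limit
    point [h] differs from an affine function by at most e r, so the integral there is at most 4 (e
    r) r, and r^2 cancels the factor 4^k lost in the subdivision. *)
Lemma goursat h x0 x1 y0 y1 : (forall z, differentiable h z) ->
  x0 <= x1 -> y0 <= y1 -> rect_int h x0 x1 y0 y1 = 0.
Proof.
move=> dh x01 y01.
have ch : continuous h by move=> z; exact: differentiable_continuous.
pose a := x1 - x0; pose b := y1 - y0.
have a0 : 0 <= a by rewrite subr_ge0.
have b0 : 0 <= b by rewrite subr_ge0.
pose Psi (c : R * R) k := absC (rect_int h c.1 (c.1 + a / 2 ^+ k) c.2 (c.2 + b / 2 ^+ k)).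
have half (t : R) k : t / 2 ^+ k = t / 2 ^+ k.+1 + t / 2 ^+ k.+1.
  rewrite exprS; field; exact: expf_neq0.
(* Quadrisection: some quarter carries at least a quarter of the integral. *)
have step (ck : (R * R) * nat) : exists c' : R * R,
    [/\ ck.1.1 <= c'.1, c'.1 + a / 2 ^+ ck.2.+1 <= ck.1.1 + a / 2 ^+ ck.2,
        ck.1.2 <= c'.2, c'.2 + b / 2 ^+ ck.2.+1 <= ck.1.2 + b / 2 ^+ ck.2 &
        Psi ck.1 ck.2 <= 4 * Psi c' ck.2.+1].
  case: ck => -[x y] k /=.
  set ak := a / 2 ^+ k.+1; set bk := b / 2 ^+ k.+1.
  have ak0 : 0 <= ak by rewrite divr_ge0 // exprn_ge0.
  have bk0 : 0 <= bk by rewrite divr_ge0 // exprn_ge0.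
  have /= sp : Psi (x, y) k <= Psi (x, y) k.+1 + Psi (x + ak, y) k.+1 +
      Psi (x, y + bk) k.+1 + Psi (x + ak, y + bk) k.+1.
    rewrite /Psi /= (half a) (half b) -/ak -/bk !addrA.
    rewrite (rect_int_split h x (x + ak) (x + ak + ak) y (y + bk) (y + bk + bk)).
    set A := rect_int _ _ _ _ _; set B := rect_int _ _ _ _ _.
    set D := rect_int _ _ _ _ _; set E := rect_int _ _ _ _ _.
    have := absCD (A + B + D) E; have := absCD (A + B) D; have := absCD A B; lra.
  rewrite !(half _ k) -/ak -/bk.
  case: (lerP (Psi (x, y) k) (4 * Psi (x, y) k.+1)) => h1.
    by exists (x, y); split => //=; lra.
  case: (lerP (Psi (x, y) k) (4 * Psi (x + ak, y) k.+1)) => h2.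
    by exists (x + ak, y); split => //=; lra.
  case: (lerP (Psi (x, y) k) (4 * Psi (x, y + bk) k.+1)) => h3.
    by exists (x, y + bk); split => //=; lra.
  by exists (x + ak, y + bk); split => //=; lra.
have [s hs] := choice step.
pose u := fix u k := if k is j.+1 then s (u j, j) else (x0, y0).
have hu k := hs (u k, k).
have PsiS k : Psi (u 0%N) 0%N <= 4 ^+ k * Psi (u k) k.
  elim: k => [|k IH]; first by rewrite expr0 mul1r.
  apply: le_trans IH _; rewrite exprSr -mulrA ler_wpM2l ?exprn_ge0 //.
  by have [_ _ _ _] := hu k.
have lk0 (t : R) k : 0 <= t -> 0 <= t / 2 ^+ k by move=> t0; rewrite divr_ge0 // exprn_ge0.
have [zx hzx] : exists x, forall k, (u k).1 <= x <= (u k).1 + a / 2 ^+ k.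
  by apply: nested_point => k; [have [] := hu k|have [] := hu k|exact: lk0].
have [zy hzy] : exists x, forall k, (u k).2 <= x <= (u k).2 + b / 2 ^+ k.
  by apply: nested_point => k; [have [] := hu k|have [] := hu k|exact: lk0].
pose z := cpt zx zy.
have [q /continuousCP cq hq] := (differentiable_slope h z).1 (dh z).
apply/eqP; rewrite -absC_eq0 eq_le absC_ge0 andbT.
have -> : absC (rect_int h x0 x1 y0 y1) = Psi (u 0%N) 0%N.
  rewrite /Psi /= expr0 !divr1; congr (absC (rect_int _ _ _ _ _)).
    by rewrite /a; ring.
  by rewrite /b; ring.
suff key e : 0 < e -> Psi (u 0%N) 0%N <= e * (4 * (a + b) ^+ 2).
  apply/ler_addgt0Pl => e e0; rewrite addr0.
  have c0 : 0 < 4 * (a + b) ^+ 2 + 1 by have := sqr_ge0 (a + b); lra.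
  have /key : 0 < e / (4 * (a + b) ^+ 2 + 1) by rewrite divr_gt0.
  move/le_trans; apply.
  rewrite mulrAC ler_pdivrMr // ler_pM2l //; lra.
move=> e0; have [d d0 hd] := cq e e0.
have [k hk] := half_pow_small (a + b) d0.
set r := (a + b) / 2 ^+ k in hk.
(* The tangent of [h] at [z], since [q z] is the derivative there. Its boundary integral vanishes,
   and the remainder is (w - z) (q w - q z). *)
pose aff w := (h z - q z * z) + q z * w.
pose err w := h w + (-1) * aff w.
have caff : continuous aff by exact: continuous_affineC.
have cerr : continuous err.
  by move=> w; exact: (cvgD (ch w) (cvgM (cvg_cst _) (caff w))).
have hE : h = (fun w => aff w + err w) by apply/funext => w; rewrite /err; ring.
have r0 : 0 <= r by apply: lk0; lra.
have Pk : Psi (u k) k <= 4 * (e * r) * r.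
  have rE x x' y y' : rect_int h x x' y y' = rect_int err x x' y y'.
    by rewrite {1}hE (rect_intD _ _ _ _ caff cerr) rect_int_affine add0r.
  rewrite /Psi rE.
  have e1 : (u k).1 + a / 2 ^+ k - (u k).1 + ((u k).2 + b / 2 ^+ k - (u k).2) = r.
    by rewrite /r; ring.
  rewrite -[X in _ <= _ * X]e1.
  apply: rect_int_bound => //; rewrite ?lerDl ?lk0 //.
  move=> x y hx hy.
  have -> : err (cpt x y) = (cpt x y - z) * (q (cpt x y) - q z).
    by have := hq (cpt x y); rewrite /err /aff => /(canRL (subrK _)) ->; ring.
  have xyz : absC (cpt x y - z) <= r.
    have -> : cpt x y - z = cpt (x - zx) (y - zy) by rewrite /z /cpt !rmorphB /=; ring.
    apply: le_trans (absCD _ _) _; rewrite absCM absC_i mul1r !absC_real.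
    have /andP[? ?] := hzx k; have /andP[? ?] := hzy k.
    move: hx hy => /andP[? ?] /andP[? ?].
    have -> : r = a / 2 ^+ k + b / 2 ^+ k by rewrite /r mulrDl.
    by apply: lerD; rewrite ler_norml; apply/andP; split; lra.
  rewrite absCM mulrC; apply: ler_pM => //; try exact: absC_ge0.
  by apply/ltW/hd; apply: le_lt_trans hk.
apply: le_trans (PsiS k) _.
have := ler_wpM2l (_ : 0 <= 4 ^+ k) Pk; rewrite exprn_ge0 // => /(_ isT)/le_trans; apply.
rewrite /r.
have -> : (4 : R) ^+ k = 2 ^+ k * 2 ^+ k by rewrite -exprMn; congr (_ ^+ _); ring.
have t0 : (2 : R) ^+ k != 0 by rewrite expf_neq0.
by rewrite le_eqVlt; apply/orP; left; apply/eqP; field.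
Qed.

End Goursat.

(** * The complex exponential *)

Section ComplexExponential.
Variable R : realType.
Local Notation C := R[i].

Lemma differentiable_eps (h : C -> C) (z d : C) :
  (forall e : R, 0 < e -> exists2 r : R, 0 < r & forall w, absC (w - z) < r ->
    absC (h w - h z - d * (w - z)) <= e * absC (w - z)) -> differentiable h z.
Proof.
move=> H; apply/differentiable_slope.
exists (fun w => if w == z then d else (h w - h z) / (w - z)); last first.
  move=> w; case: eqVneq => [->|wz]; first by rewrite !subrr mul0r.
  by field; rewrite subr_eq0.
apply/continuousCP => e e0; have e20 : 0 < e / 2 by rewrite divr_gt0.
have [r r0 hr] := H _ e20; exists r => // w /hr {}hr.
rewrite eqxx; case: eqVneq hr => [_ _|wz]; first by rewrite subrr absC0.
have wz0 : w - z != 0 by rewrite subr_eq0.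
have -> : (h w - h z) / (w - z) - d = (h w - h z - d * (w - z)) / (w - z) by field.
rewrite absCM absCV ltr_pdivrMr ?absC_gt0 // => hr.
by apply: le_lt_trans hr _; rewrite ltr_pM2r ?absC_gt0 //; lra.
Qed.

Lemma is_derive_eps (F : R -> R) (x d e : R) : is_derive x 1 F d -> 0 < e ->
  exists2 r : R, 0 < r & forall s, `|s| < r -> `|F (s + x) - F x - d * s| <= e * `|s|.
Proof.
case=> dF; have : 'D_1 F x = lim (h^-1 *: ((F \o shift x) (h *: 1) - F x) @[h --> 0^']) by [].
move=> -> ll e0; move/cvg_ex: dF => [l hl].
have {}ll : d = l by rewrite -ll; apply: cvg_lim.
have hA : nbhs l [set y : R | `|y - l| < e].
  by apply/nbhs_ballP; exists e => //= y; rewrite -ball_normE /= distrC.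
have /nbhs_ballP[r /= r0 hr] : nbhs (0 : R)
  (fun h => h != 0 -> `|h^-1 *: ((F \o shift x) (h *: 1) - F x) - l| < e) := hl _ hA.
exists r => // s sr; have [->|s0] := eqVneq s 0.
  by rewrite add0r subrr mulr0 subrr normr0 mulr0.
have := hr s; rewrite -ball_normE /= sub0r normrN => /(_ sr s0) hs.
have -> : F (s + x) - F x - d * s = s * (s^-1 * (F (s + x) - F x) - l).
  by rewrite ll; field.
rewrite normrM mulrC ler_wpM2r //; apply: ltW.
by move: hs; rewrite /= [_ *: 1]mulr1.
Qed.

Definition cexp (z : C) : C :=
  (expR (complex.Re z))%:C%C * cpt (cos (complex.Im z)) (sin (complex.Im z)).

Lemma cexpD z w : cexp (z + w) = cexp z * cexp w.
Proof.
rewrite /cexp !raddfD /= expRD cosD sinD /cpt !(rmorphM, rmorphD, rmorphB) /=.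
have := sqr_i R; set j : C := 'i%C => j2.
set a := (expR (complex.Re z))%:C%C; set b := (expR (complex.Re w))%:C%C.
set c := ((cos _)%:C)%C; set d := ((cos _)%:C)%C.
set e := ((sin _)%:C)%C; set f := ((sin _)%:C)%C.
have -> : a * (c + j * e) * (b * (d + j * f)) =
  a * b * (c * d + j ^+ 2 * (e * f) + j * (e * d + c * f)) by ring.
by rewrite j2; ring.
Qed.

Lemma cexp0 : cexp 0 = 1.
Proof. by rewrite /cexp /= expR0 cos0 sin0 /cpt mulr0 addr0 mulr1. Qed.

Lemma cexpN z : cexp (- z) * cexp z = 1.
Proof. by rewrite -cexpD addNr cexp0. Qed.

Lemma cexp_neq0 z : cexp z != 0.
Proof. by apply/eqP => h; have := cexpN z; rewrite h mulr0 => /esym/eqP; rewrite oner_eq0. Qed.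

Lemma cexpNV z : cexp (- z) = (cexp z)^-1.
Proof. by apply: (mulIf (cexp_neq0 z)); rewrite cexpN mulVf // cexp_neq0. Qed.

Lemma cexpM z k : cexp (k%:R * z) = cexp z ^+ k.
Proof.
elim: k => [|k IH]; first by rewrite mul0r cexp0.
by rewrite -addn1 natrD mulrDl mul1r cexpD IH exprD.
Qed.

Lemma absC_cos_sin t : absC (cpt (cos t) (sin t)) = 1 :> R.
Proof.
have -> : cpt (cos t) (sin t) = (cos t +i* sin t)%C by rewrite -(cptE (cos t +i* sin t)%C).
by rewrite absC_normc /= cos2Dsin2 sqrtr1.
Qed.

Lemma absC_cexp z : absC (cexp z) = expR (complex.Re z).
Proof. by rewrite /cexp absCM absC_cos_sin mulr1 absC_real ger0_norm // expR_ge0. Qed.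

Lemma Re_cpt (x y : R) : complex.Re (cpt x y) = x.
Proof. by rewrite /cpt /=; lra. Qed.

Lemma Im_cpt (x y : R) : complex.Im (cpt x y) = y.
Proof. by rewrite /cpt /=; lra. Qed.

Lemma cexp_2pi (x y : R) : cexp (cpt x (y + pi *+ 2)) = cexp (cpt x y).
Proof. by rewrite /cexp !Re_cpt !Im_cpt cosD2pi sinD2pi. Qed.

(** The complex derivative at 0, obtained from the real derivatives of exp, cos and sin at 0;
    [cexpD] carries it to every other point. *)
Lemma cexp_slope0 (e : R) : 0 < e -> exists2 r : R, 0 < r &
  forall w : C, absC w < r -> absC (cexp w - 1 - w) <= e * absC w.
Proof.
(* The remainders below add up to at most 8 c |w|. The condition |w| < c makes the quadratic term
   linear, and c <= 1/2 keeps |1 + a| below 2. *)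
move=> e0; have [c [c0 ce c1]] : exists c : R, [/\ 0 < c, c * 16 <= e & c <= 1 / 2].
  exists (Num.min (e / 16) (1 / 2)); split; first by rewrite lt_min !divr_gt0.
    by rewrite -ler_pdivlMr // ge_min lexx.
  by rewrite ge_min lexx orbT.
have [r1 r10 h1] := is_derive_eps (is_derive_expR 0) c0.
have [r2 r20 h2] := is_derive_eps (is_derive_cos 0) c0.
have [r3 r30 h3] := is_derive_eps (is_derive_sin 0) c0.
exists (Num.min (Num.min r1 r2) (Num.min r3 c)); first by rewrite !lt_min r10 r20 r30 c0.
move=> w; rewrite !lt_min => /andP[/andP[w1 w2] /andP[w3 w4]].
have ha := absC_Re w; have hb := absC_Im w.
have wr := absC_ge0 w.
set a := complex.Re w in ha *; set b := complex.Im w in hb *; set W := absC w in w1 w2 w3 w4 ha hb wr *.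
have {}h1 := h1 a (le_lt_trans ha w1).
have {}h2 := h2 b (le_lt_trans hb w2).
have {}h3 := h3 b (le_lt_trans hb w3).
rewrite !addr0 expR0 mul1r in h1; rewrite !addr0 sin0 cos0 oppr0 mul0r subr0 in h2.
rewrite !addr0 sin0 cos0 mul1r subr0 in h3.
apply: le_trans (absC_ReIm _) _.
have -> : complex.Re (cexp w - 1 - w) = (expR a - 1 - a) * cos b + (1 + a) * (cos b - 1).
  by rewrite !raddfB /= /cexp /cpt /= -/a -/b; ring.
have -> : complex.Im (cexp w - 1 - w) = (expR a - 1) * sin b + (sin b - b).
  by rewrite !raddfB /= /cexp /cpt /= -/a -/b; ring.
have cb : `|cos b| <= 1 by rewrite ler_norml cos_geN1 cos_le1.
have a1 : `|1 + a| <= 2 by apply: le_trans (ler_normD _ _) _; rewrite normr1; lra.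
have hcW : c * `|a| <= c * W by rewrite ler_wpM2l // ltW.
have hcWb : c * `|b| <= c * W by rewrite ler_wpM2l // ltW.
have cW : c * W <= W by rewrite ler_piMl //; lra.
have ea : `|expR a - 1| <= 2 * W.
  have -> : expR a - 1 = (expR a - 1 - a) + a by ring.
  by apply: le_trans (ler_normD _ _) _; lra.
have sb : `|sin b| <= 2 * W.
  have -> : sin b = (sin b - b) + b by ring.
  by apply: le_trans (ler_normD _ _) _; lra.
have t1 : `|(expR a - 1 - a) * cos b| <= c * W.
  rewrite normrM -[leRHS]mulr1; apply: ler_pM => //; lra.
have t2 : `|(1 + a) * (cos b - 1)| <= 2 * (c * W).
  by rewrite normrM; apply: ler_pM => //; lra.
have t3 : `|(expR a - 1) * sin b| <= 4 * (c * W).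
  rewrite normrM; apply: le_trans (ler_pM _ _ ea sb) _ => //.
  have : W * W <= c * W by rewrite ler_wpM2r // ltW.
  lra.
have := ler_normD ((expR a - 1 - a) * cos b) ((1 + a) * (cos b - 1)).
have := ler_normD ((expR a - 1) * sin b) (sin b - b).
have : c * 16 * W <= e * W by rewrite ler_wpM2r.
have : 0 <= c * W by rewrite mulr_ge0 // ltW.
lra.
Qed.

Lemma differentiable_cexp z : differentiable cexp z.
Proof.
apply: (@differentiable_eps _ _ (cexp z)) => e e0.
have z0 : 0 < absC (cexp z) by rewrite absC_gt0 cexp_neq0.
have [|r r0 hr] := @cexp_slope0 (e / absC (cexp z)); first by rewrite divr_gt0.
exists r => // w /hr h.
have -> : cexp w - cexp z - cexp z * (w - z) = cexp z * (cexp (w - z) - 1 - (w - z)).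
  by rewrite -{1}(subrK z w) cexpD; ring.
rewrite absCM; apply: le_trans (ler_wpM2l (ltW z0) h) _.
by rewrite le_eqVlt; apply/orP; left; apply/eqP; field; rewrite gt_eqF.
Qed.

(** Only [t] is confined to the segment: [s] may leave it, as the shifted argument t + pi / k does
    in [riemann_lebesgue]. *)
Lemma continuous_segment_unif (f : R -> C) (a b e : R) : continuous f -> 0 < e ->
  exists2 d : R, 0 < d & forall t s, a <= t <= b -> `|s - t| < d -> absC (f s - f t) < e.
Proof.
move=> cf e0; have e20 : 0 < e / 2 by rewrite divr_gt0.
have := (compact_near_coveringP _).1 (@segment_compact R a b).
move=> /(_ R (0 : R)^'+ (fun d t => forall s, `|s - t| < d -> absC (f s - f t) < e)).
case.
  move=> x _.
  have hA : nbhs (f x) [set w | absC (w - f x) < e / 2] by apply/nbhsCP; exists (e / 2).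
  have /nbhs_ballP[r /= r0 hr] : nbhs x (fun s => absC (f s - f x) < e / 2) := cf x _ hA.
  have r20 : 0 < r / 2 by rewrite divr_gt0.
  exists (ball x (r / 2), [set d | d < r / 2]).
    split; first by apply: nbhsx_ballx.
    exact: nbhs_right_lt.
  move=> [t d] /= [tx dr] s st.
  move: tx; rewrite -ball_normE /= => tx.
  have h1 : absC (f t - f x) < e / 2.
    by apply: hr; rewrite -ball_normE /=; apply: lt_trans tx _; lra.
  have h2 : absC (f s - f x) < e / 2.
    apply: hr; rewrite -ball_normE /=; have := ler_distD t x s; rewrite [`|t - s|]distrC; lra.
  have -> : f s - f t = (f s - f x) - (f t - f x) by ring.
  by apply: le_lt_trans (absCBD _ _) _; lra.
move=> r /= r0 hr; exists (r / 2); first by rewrite divr_gt0.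
move=> t s tab st; have r20 : 0 < r / 2 by rewrite divr_gt0.
have br : ball_ (fun x : R => `|x|) 0 r (r / 2).
  by rewrite /= sub0r normrN ger0_norm; lra.
by apply: (hr _ br r20 t _ s st); rewrite /= in_itv.
Qed.

End ComplexExponential.

(** * Laurent series *)

Section Laurent.
Variable R : realType.
Local Notation C := R[i].

Lemma differentiable_idC (z : C) : differentiable (fun w : C => w) z.
Proof.
apply/differentiable_slope; exists (fun=> 1) => [|w]; last by rewrite mulr1.
exact: cst_continuous.
Qed.

Lemma continuous_cexp : continuous (@cexp R).
Proof. by move=> z; apply: differentiable_continuous; exact: differentiable_cexp. Qed.

Lemma cexpMz (w : C) (k : int) : cexp (k%:~R * w) = cexp w ^ k.
Proof.
case: k => k; first by rewrite -pmulrn cexpM.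
by rewrite NegzE mulrNz mulNr cexpNV -pmulrn cexpM.
Qed.

Lemma absCXz (z : C) (k : int) : absC (z ^ k) = absC z ^ k.
Proof. by case: k => k; rewrite ?NegzE -?exprnN ?absCV absCX. Qed.

Definition mean (f : R -> C) : C := ((pi *+ 2)%:C)%C^-1 * cint f 0 (pi *+ 2).

Lemma twopi_gt0 : 0 < pi *+ 2 :> R.
Proof. by rewrite pmulrn_rgt0 // pi_gt0. Qed.

Lemma meanD (f g : R -> C) : continuous f -> continuous g ->
  mean (fun t => f t + g t) = mean f + mean g.
Proof. by move=> cf cg; rewrite /mean cintD // mulrDr. Qed.

Lemma meanZ (a : C) (f : R -> C) : continuous f -> mean (fun t => a * f t) = a * mean f.
Proof. by move=> cf; rewrite /mean cintZ // mulrCA. Qed.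

Lemma mean_comb (f f1 f2 f3 : R -> C) (a b : C) :
  continuous f1 -> continuous f2 -> continuous f3 ->
  (forall t, f t = f1 t + a * f2 t + b * f3 t) ->
  mean f = mean f1 + a * mean f2 + b * mean f3.
Proof.
move=> c1 c2 c3 fE.
have c2' : continuous (fun t => a * f2 t) by move=> t; exact: (cvgM (cvg_cst _) (c2 t)).
have c3' : continuous (fun t => b * f3 t) by move=> t; exact: (cvgM (cvg_cst _) (c3 t)).
have c12 : continuous (fun t => f1 t + a * f2 t) by move=> t; exact: (cvgD (c1 t) (c2' t)).
rewrite -(meanZ a c2) -(meanZ b c3) -(meanD c1 c2') -(meanD c12 c3').
by congr mean; apply/funext.
Qed.

Lemma mean_bound (f : R -> C) M : continuous f ->
  (forall t, 0 <= t <= pi *+ 2 -> absC (f t) <= M) -> absC (mean f) <= 2 * M.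
Proof.
move=> cf fM; rewrite /mean absCM absCV absC_real (ger0_norm (ltW twopi_gt0)).
rewrite ler_pdivrMl ?twopi_gt0 // mulrC.
by have := cint_bound cf (ltW twopi_gt0) fM; rewrite subr0.
Qed.

(** By periodicity F(t + 2 pi) is again a primitive of [f], so it has the same increment from 0 to
    [a] as F; rearranging gives the claim. *)
Lemma mean_shift (f : R -> C) (a : R) : continuous f ->
  (forall t, f (t + pi *+ 2) = f t) -> mean (fun t => f (t + a)) = mean f.
Proof.
move=> cf pf; congr (_ * _); have [F pF ->] := cint_primitive cf.
have shift_prim b : is_primitive (fun t => F (t + b)) (fun t => f (t + b)).
  move=> t; have [h1 h2] := pF (t + b).
  have hb : is_derive t 1 (fun t : R => t + b) 1.
    by apply: is_derive_eq (is_deriveD (is_derive_id t 1) (is_derive_cst b t 1)) _; rewrite addr0.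
  split.
    by apply: is_derive_eq (@is_derive1_comp _ _ (fun t => t + b) t _ _ h1 hb) _; rewrite mulr1.
  by apply: is_derive_eq (@is_derive1_comp _ _ (fun t => t + b) t _ _ h2 hb) _; rewrite mulr1.
rewrite (cintE _ _ (shift_prim a)).
have := shift_prim (pi *+ 2).
have -> : (fun t => f (t + pi *+ 2)) = f by apply/funext.
move=> /(primitive_unique 0 a pF) e; rewrite !add0r in e.
by rewrite add0r [pi *+ 2 + a]addrC; move/(canRL (subrK _)): e => ->; ring.
Qed.

(** Twice the mean is the mean of (Q(t) - Q(t + pi / k)) e^(ikt), which uniform continuity makes
    small once pi / |k| < d; this determines [K]. *)
Lemma riemann_lebesgue (Q : R -> C) (e : R) : continuous Q ->
  (forall t, Q (t + pi *+ 2) = Q t) -> 0 < e ->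
  exists K : nat, forall k : int, (K <= `|k|)%N ->
    absC (mean (fun t => Q t * cexp (cpt 0 t) ^ k)) <= e.
Proof.
move=> cQ pQ e0.
have [d d0 hd] := continuous_segment_unif 0 (pi *+ 2) cQ e0.
have pi0 := pi_gt0 R.
exists (Num.truncn (pi / d)).+1 => k hk.
have kr : pi / d < `|k%:~R|.
  apply: lt_le_trans (truncnS_gt _) _.
  by rewrite -intr_norm -natr_absz ler_nat.
have k0 : (k%:~R : R) != 0.
  by rewrite -normr_gt0; apply: le_lt_trans kr; rewrite divr_ge0 // ltW.
pose a : R := pi / k%:~R.
have ad : `|a| < d.
  rewrite normrM normfV (ger0_norm (ltW pi0)) ltr_pdivrMr ?normr_gt0 //.
  by rewrite mulrC -ltr_pdivrMr.
pose E (t : R) := cexp (cpt 0 t) ^ k.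
have Ew t : E t = cexp (cpt 0 t) ^ k by [].
have cE : continuous E.
  have -> : E = (fun t : R => cexp (k%:~R * cpt 0 t)) by apply/funext => t; rewrite cexpMz.
  move=> t; apply: (@continuous_comp R C C (fun t : R => k%:~R * cpt 0 t) (@cexp R)); last exact: continuous_cexp.
  by apply: cvgM; [exact: cvg_cst|exact: continuous_cpty].
have pE t : E (t + pi *+ 2) = E t by rewrite /E cexp_2pi.
have aE t : E (t + a) = - E t.
  rewrite /E -!cexpMz.
  have -> : k%:~R * cpt 0 (t + a) = k%:~R * cpt 0 t + cpt 0 pi.
    rewrite /cpt /a !rmorphD rmorphM fmorphV rmorph_int /=; field.
    by rewrite -(rmorph_int (real_complex R)) fmorph_eq0.
  rewrite cexpD; suff -> : cexp (cpt 0 pi) = -1 :> C by rewrite mulrN1.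
  by rewrite /cexp Re_cpt Im_cpt expR0 cospi sinpi /cpt mulr0 addr0 mul1r rmorphN1.
clearbody E.
rewrite (_ : (fun t => Q t * cexp (cpt 0 t) ^ k) = (fun t => Q t * E t)); last first.
  by apply/funext => t; rewrite Ew.
have cQE : continuous (fun t => Q t * E t) by move=> t; exact: (cvgM (cQ t) (cE t)).
have cQa : continuous (fun t => Q (t + a)).
  move=> t; apply: (@continuous_comp _ _ _ (fun t => t + a) Q); last exact: cQ.
  by apply: cvgD; [exact: cvg_id|exact: cvg_cst].
have cQaE : continuous (fun t => Q (t + a) * E t) by move=> t; exact: (cvgM (cQa t) (cE t)).
(* Shifting by pi/k changes the sign of the exponential. *)
have e1 : mean (fun t => Q t * E t) = - mean (fun t => Q (t + a) * E t).
  have pQE t : Q (t + pi *+ 2) * E (t + pi *+ 2) = Q t * E t by rewrite pQ pE.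
  rewrite -(mean_shift a cQE pQE).
  transitivity (mean (fun t => -1 * (Q (t + a) * E t))).
    by congr mean; apply/funext => t; rewrite aE; ring.
  by rewrite (meanZ _ cQaE) mulN1r.
have e2 : mean (fun t => Q t * E t) + mean (fun t => Q t * E t) =
    mean (fun t => Q t * E t + -1 * (Q (t + a) * E t)).
  have cNE : continuous (fun t => -1 * (Q (t + a) * E t)).
    by move=> t; exact: (cvgM (cvg_cst _) (cQaE t)).
  by rewrite {2}e1 (meanD cQE cNE) (meanZ _ cQaE) mulN1r.
have b1 : absC (mean (fun t => Q t * E t + -1 * (Q (t + a) * E t))) <= 2 * e.
  apply: mean_bound.
    by move=> t; exact: (cvgD (cQE t) (cvgM (cvg_cst _) (cQaE t))).
  move=> t ht; have -> : Q t * E t + -1 * (Q (t + a) * E t) = - (Q (t + a) - Q t) * E t by ring.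
  rewrite absCM absCN Ew absCXz absC_cexp Re_cpt expR0 exp1rz mulr1.
  by apply/ltW/hd => //; rewrite addrAC subrr add0r.
have : absC (2%:R * mean (fun t => Q t * E t)) <= 2 * e by rewrite mulr2n mulrDl !mul1r e2.
have -> : (2%:R : C) = ((2%:R : R)%:C)%C by rewrite rmorph_nat.
by rewrite absCM absC_real ger0_norm // ler_pM2l.
Qed.

(** The k-th Laurent coefficient computed on the circle of radius e^s, which [cexp] parametrises by
    a vertical segment. *)
Definition fcoef (q : C -> C) (s : R) (k : int) : C :=
  mean (fun t : R => q (cexp (cpt s t)) * cexp (cpt s t) ^ (- k)).

Lemma continuous_circle (q : C -> C) (s : R) :
  (forall z, z != 0 -> {for z, continuous q}) ->
  continuous (fun t : R => q (cexp (cpt s t))).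
Proof.
move=> cq t; apply: (@continuous_comp R C C (fun t : R => cexp (cpt s t)) q); last first.
  exact/cq/cexp_neq0.
apply: (@continuous_comp R C C (fun t => cpt s t) (@cexp R)); last exact: continuous_cexp.
exact: continuous_cpty.
Qed.

Lemma continuous_circleX (s : R) (k : int) :
  continuous (fun t : R => cexp (cpt s t) ^ k).
Proof.
have -> : (fun t : R => cexp (cpt s t) ^ k) = (fun t : R => cexp (k%:~R * cpt s t)).
  by apply/funext => t; rewrite cexpMz.
move=> t; apply: (@continuous_comp R C C (fun t : R => k%:~R * cpt s t) (@cexp R)); last exact: continuous_cexp.
by apply: cvgM; [exact: cvg_cst|exact: continuous_cpty].
Qed.

(** The function g(e^w) e^(-kw) is entire with period 2 pi i. In Goursat's theorem on [s1, s2] x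
    [0, 2 pi] the horizontal sides cancel and the vertical ones are the two coefficients. *)
Lemma fcoef_radius (g : C -> C) (s1 s2 : R) (k : int) :
  (forall z, z != 0 -> differentiable g z) -> fcoef g s1 k = fcoef g s2 k.
Proof.
move=> dg; wlog s12 : s1 s2 / s1 <= s2.
  by move=> h; case: (leP s1 s2) => [|/ltW] s12; [exact: h|apply/esym/h].
pose h w := g (cexp w) * cexp ((- k)%:~R * w).
have dh w : differentiable h w.
  apply: differentiableM.
    apply: (@differentiable_comp C C C C (@cexp R) g); first exact: differentiable_cexp.
    exact/dg/cexp_neq0.
  apply: (@differentiable_comp C C C C (fun w => (- k)%:~R * w) (@cexp R)); last exact: differentiable_cexp.
  by apply: differentiableM; [exact: differentiable_cst|exact: differentiable_idC].
have hw w : h w = g (cexp w) * cexp w ^ (- k) by rewrite /h cexpMz.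
clearbody h.
have fE s : fcoef g s k = mean (fun t => h (cpt s t)).
  by congr mean; apply/funext => t; rewrite hw.
rewrite !fE; congr (_ * _).
have rowE : cint (fun t => h (cpt t (pi *+ 2))) s1 s2 = cint (fun t => h (cpt t 0)) s1 s2.
  congr cint; apply/funext => t; rewrite !hw.
  by rewrite -[pi *+ 2]add0r cexp_2pi.
have := goursat dh s12 (ltW twopi_gt0).
rewrite /rect_int rowE.
set A := cint _ s1 s2; set B := cint _ _ _; set D := cint _ _ _ => e.
have i0 : ('i%C : C) != 0 by rewrite -absC_gt0 absC_i.
apply: (mulfI i0); apply/eqP; rewrite -subr_eq0; apply/eqP.
have -> : 'i%C * D - 'i%C * B = - (A + 'i%C * B - A - 'i%C * D) by ring.
by rewrite e oppr0.
Qed.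

Lemma cexp_polar (s t : R) : cexp (cpt s t) = (expR s)%:C%C * cexp (cpt 0 t).
Proof. by rewrite /cexp !Re_cpt !Im_cpt expR0 mul1r. Qed.

(** For k <> 0 no integral is computed: the coefficient is proportional to e^(-ks) and yet the same
    for s and s + 1, hence zero. *)
Lemma fcoef1 (s : R) (k : int) : fcoef (fun=> 1) s k = (k == 0)%:R.
Proof.
have cX := continuous_circleX.
case: eqVneq => [->|k0].
  rewrite /fcoef /mean oppr0.
  have -> : (fun t => 1 * cexp (cpt s t) ^ 0) = (fun t => 1 + 0 * (t%:C)%C).
    by apply/funext => t; rewrite mul0r addr0 expr0z mulr1.
  rewrite cint_affine mul0r addr0 mul1r subr0 mulVf //.
  by rewrite fmorph_eq0 gt_eqF // twopi_gt0.
have E s' : fcoef (fun=> 1) s' k = (expR s')%:C%C ^ (- k) * fcoef (fun=> 1) 0 k.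
  rewrite /fcoef -meanZ; last first.
    by move=> t; exact: (cvgM (cvg_cst _) (cX 0 (- k) t)).
  by congr mean; apply/funext => t; rewrite (cexp_polar s' t) expfzMl mulrCA.
have := @fcoef_radius (fun=> 1) s (s + 1) k (fun z _ => differentiable_cst _ _).
rewrite E (E (s + 1)) => /eqP; rewrite -subr_eq0 -mulrBl mulf_eq0 => /orP[|/eqP ->]; last by rewrite mulr0.
rewrite subr_eq0 => /eqP e.
have {e} : expR s ^ (- k) = expR (s + 1) ^ (- k).
  have absE (x : R) : absC ((expR x)%:C%C ^ (- k)) = expR x ^ (- k).
    by rewrite absCXz absC_real (ger0_norm (expR_ge0 x)).
  by rewrite -absE e absE.
rewrite expRD expfzMl => e.
have s0 : expR s ^ (- k) != 0 by rewrite expfz_neq0 // gt_eqF // expR_gt0.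
have {e} : expR 1 ^ (- k) = 1 :> R by apply: (mulfI s0); rewrite mulr1.
have e1 : 1 < expR 1 :> R by rewrite -expR0 ltr_expR.
move/eqP; rewrite pexprz_eq1 ?expR_ge0 //.
by rewrite oppr_eq0 (negPf k0) /= gt_eqF.
Qed.

Definition lsum (c : int -> C) (m : nat) (z : C) : C :=
  c 0 + \sum_(k < m) (c (Posz k.+1) * z ^+ k.+1 + c (Negz k) * (z^-1) ^+ k.+1).

Lemma lsumS c m z : lsum c m.+1 z =
  lsum c m z + (c (Posz m.+1) * z ^+ m.+1 + c (Negz m) * (z^-1) ^+ m.+1).
Proof. by rewrite /lsum big_ord_recr /= addrA. Qed.

(* With g(w) - g(z) = (w - z) q(w), the partial sums of the Laurent series of g at z
   minus g(z) telescope to two Fourier coefficients of q (Chernoff). *)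
Theorem laurent (g : C -> C) : (forall z, z != 0 -> differentiable g z) ->
  exists c : int -> C,
    (forall (r M : R), 0 < r -> (forall z, absC z = r -> absC (g z) <= M) ->
       forall k, absC (c k) * r ^ k <= 2 * M) /\
    (forall z, z != 0 -> forall e : R, 0 < e -> exists K : nat,
       forall m, (K <= m)%N -> absC (lsum c m z - g z) <= e).
Proof.
move=> dg; pose c := fcoef g 0.
have cg z : z != 0 -> {for z, continuous g}.
  by move=> z0; exact/differentiable_continuous/dg.
exists c; split.
  move=> r M r0 hM k; rewrite /c (fcoef_radius 0 (ln r) k dg).
  rewrite -ler_pdivlMr ?exprz_gt0 // -mulrA; apply: mean_bound.
    have h1 := @continuous_circle g (ln r) cg; have h2 := @continuous_circleX (ln r) (- k).
    move=> t; exact: (cvgM (h1 t) (h2 t)).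
  move=> t _; rewrite absCM absCXz absC_cexp Re_cpt lnK ?posrE // -invr_expz.
  rewrite -/(_ / _) ler_wpM2r ?invr_ge0 ?exprz_ge0 ?(ltW r0) //.
  by apply: hM; rewrite absC_cexp Re_cpt lnK.
move=> z z0 e e0; set s := ln (absC z).
have az0 : 0 < absC z by rewrite absC_gt0.
have sz : expR s = absC z by rewrite /s lnK.
have [q cqz hq] := (differentiable_slope g z).1 (dg z z0).
have cq w : w != 0 -> {for w, continuous q}.
  move=> w0; have [->//|wz] := eqVneq w z.
  have : {for w, continuous (fun w => (g w - g z) / (w - z))}.
    have h2 : {for w, continuous (fun x : C => x - z)}.
      rewrite (_ : (fun x => x - z) = (fun x : C => - z + 1 * x)); last first.
        by apply/funext => x; rewrite mul1r addrC.
      exact: continuous_affineC.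
    have wz0 : w - z != 0 by rewrite subr_eq0.
    exact: (cvgM (cvgB (cg w w0) (cvg_cst (g z))) (cvgV wz0 h2)).
  move=> /continuousCP h; apply/continuousCP => e1 /h[d d0 hd].
  have wz1 : 0 < absC (w - z) by rewrite absC_gt0 subr_eq0.
  exists (Num.min d (absC (w - z))); first by rewrite lt_min d0.
  move=> x; rewrite lt_min => /andP[xd xz].
  have xz0 : x != z by apply: contraTneq xz => ->; rewrite absCB ltxx.
  have := hd x xd; rewrite !hq ![_ * q _]mulrC !mulfK ?subr_eq0 //.
pose Q (t : R) := q (cexp (cpt s t)).
have cQ : continuous Q by exact: continuous_circle.
have pQ t : Q (t + pi *+ 2) = Q t by rewrite /Q cexp_2pi.
have cX := continuous_circleX.
have cQX k : continuous (fun t : R => q (cexp (cpt s t)) * cexp (cpt s t) ^ k).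
  by move=> t; exact: (cvgM (cQ t) (cX s k t)).
have tele k : c k - (k == 0)%:R * g z = fcoef q s (k - 1) - z * fcoef q s k.
  rewrite /c (fcoef_radius 0 s k dg) -(fcoef1 s k).
  have -> : fcoef g s k = fcoef q s (k - 1) + (- z) * fcoef q s k + g z * fcoef (fun=> 1) s k.
    have c1 : continuous (fun t => 1 * cexp (cpt s t) ^ (- k)).
      by move=> t; exact: (cvgM (cvg_cst _) (cX s (- k) t)).
    apply: (mean_comb (cQX _) (cQX _) c1) => t; set w := cexp (cpt s t).
    have w0 : w != 0 by exact: cexp_neq0.
    have -> : w ^ (- (k - 1)) = w * w ^ (- k) by rewrite opprB addrC expfzDr // expr1z mulrC.
    by have /(canRL (subrK _)) -> := hq w; ring.
  by ring.
pose T (k : int) := z ^ k * fcoef q s (k - 1).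
have teleT k : z ^ k * c k = T k - T (k + 1) + (k == 0)%:R * g z.
  have -> : c k = fcoef q s (k - 1) - z * fcoef q s k + (k == 0)%:R * g z by rewrite -tele; ring.
  rewrite /T addrK expfzDr // expr1z; move: (fcoef q s (k - 1)) (fcoef q s k) => A B.
  case: eqVneq => [->|_] /=; last by rewrite mulr0n; ring.
  by rewrite expr0z mulr1n; ring.
have sumT m : lsum c m z - g z = T (- m%:Z) - T (m%:Z + 1).
  elim: m => [|m IH].
    have := teleT 0; rewrite eqxx expr0z !mul1r => e1.
    by rewrite /lsum big_ord0 addr0 e1 addrK oppr0.
  rewrite lsumS addrAC IH.
  have -> : c (Posz m.+1) * z ^+ m.+1 = T m.+1%:Z - T (m.+1%:Z + 1).
    by rewrite mulrC -[z ^+ _]/(z ^ (Posz m.+1)) teleT /= mul0r addr0.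
  have -> : c (Negz m) * (z^-1) ^+ m.+1 = T (- m.+1%:Z) - T (- m%:Z).
    rewrite mulrC exprVn -[(z ^+ _)^-1]/(z ^ (Negz m)) teleT /= mul0r addr0 NegzE.
    by congr (_ - T _); rewrite -addn1 PoszD opprD subrK.
  have -> : m.+1%:Z = m%:Z + 1 by rewrite -addn1 PoszD.
  by ring.
(* In T k the mean over the unit circle is multiplied by |z|^k |z|^(1 - k) = |z|; each of the two
   boundary terms may cost e / 2. *)
have e20 : 0 < e / (2 * absC z) by rewrite divr_gt0 // mulr_gt0.
have [K hK] := riemann_lebesgue cQ pQ e20.
have Tb k : (K <= `|1 - k|)%N -> absC (T k) <= e / 2.
  move=> kK; have := hK (1 - k) kK; set W := mean _ => hW.
  rewrite /T; have -> : fcoef q s (k - 1) = (expR s)%:C%C ^ (1 - k) * W.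
    rewrite /fcoef opprB /W -meanZ; last first.
      by move=> t; exact: (cvgM (cQ t) (cX 0 (1 - k) t)).
    have XE t : cexp (cpt s t) ^ (1 - k) = (expR s)%:C%C ^ (1 - k) * cexp (cpt 0 t) ^ (1 - k).
      by rewrite (cexp_polar s t) expfzMl.
    by congr mean; apply/funext => t; rewrite XE mulrCA.
  clearbody W.
  rewrite mulrA !absCM !absCXz absC_real ger0_norm ?expR_ge0 // sz.
  rewrite -expfzDr ?gt_eqF // addrCA subrr addr0 expr1z.
  apply: le_trans (ler_wpM2l (ltW az0) hW) _.
  by rewrite le_eqVlt; apply/orP; left; apply/eqP; field; rewrite gt_eqF.
exists K.+1 => m Km; rewrite sumT; apply: le_trans (absCBD _ _) _.
have h1 : absC (T (- m%:Z)) <= e / 2 by apply: Tb; lia.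
have h2 : absC (T (m%:Z + 1)) <= e / 2 by apply: Tb; lia.
lra.
Qed.

End Laurent.

(** * Taylor series, identity principles and roots of unity *)

Section PowerSeries.
Variable R : realType.
Local Notation C := R[i].

(** The increments are bounded in the telescoped form 2 B (rho^(m+1) - rho^(m+j+1)); the induction
    step is 1 <= 2 (1 - rho). *)
Lemma lsum_tail (c : int -> C) (z l : C) (B rho : R) :
  0 <= rho -> rho <= 1 / 2 ->
  (forall k : nat, absC (c (Posz k.+1) * z ^+ k.+1 + c (Negz k) * (z^-1) ^+ k.+1)
      <= B * rho ^+ k.+1) ->
  (forall e : R, 0 < e -> exists K : nat,
       forall m, (K <= m)%N -> absC (lsum c m z - l) <= e) ->
  forall m, absC (lsum c m z - l) <= 2 * B * rho ^+ m.+1.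
Proof.
move=> r0 r1 tb lim m.
have step j : absC (lsum c (m + j) z - lsum c m z) <=
    2 * B * (rho ^+ m.+1 - rho ^+ (m + j).+1).
  elim: j => [|j IH]; first by rewrite addn0 !subrr absC0 mulr0.
  rewrite addnS lsumS addrAC; apply: le_trans (absCD _ _) _.
  have t := tb (m + j)%N.
  have p0 : 0 <= rho ^+ (m + j).+1 by rewrite exprn_ge0.
  have Bp : 0 <= B * rho ^+ (m + j).+1 by apply: le_trans t; exact: absC_ge0.
  have : 2 * B * (rho ^+ (m + j).+1 - rho ^+ (m + j).+2) =
     2 * (1 - rho) * (B * rho ^+ (m + j).+1) by rewrite [rho ^+ (m + j).+2]exprS; ring.
  have : B * rho ^+ (m + j).+1 <= 2 * (1 - rho) * (B * rho ^+ (m + j).+1).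
    by rewrite ler_peMl //; lra.
  lra.
apply/ler_addgt0Pl => e e0; have [K hK] := lim e e0.
have -> : lsum c m z - l = (lsum c (m + K) z - l) - (lsum c (m + K) z - lsum c m z) by ring.
apply: le_trans (absCBD _ _) _; apply: lerD; first by apply: hK; rewrite leq_addl.
apply: le_trans (step K) _.
have B0 : 0 <= B * rho ^+ (m + K).+1 by apply: le_trans (tb _); exact: absC_ge0.
lra.
Qed.

(** Cauchy's bound on the unit circle with M = 0 kills every Laurent coefficient. *)
Lemma vanish_circle (g : C -> C) : (forall z, z != 0 -> differentiable g z) ->
  (forall z, absC z = 1 -> g z = 0) -> forall z, z != 0 -> g z = 0.
Proof.
move=> dg g1 z z0; have [c [cb cl]] := laurent dg.
have c0 k : c k = 0.
  apply/eqP; rewrite -absC_eq0 eq_le absC_ge0 andbT.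
  have := cb 1 0 ltr01; rewrite mulr0 => h.
  by have := h _ k; rewrite exp1rz mulr1; apply => w /g1 ->; rewrite absC0.
have l0 m : lsum c m z = 0.
  by rewrite /lsum c0 big1 ?addr0 // => k _; rewrite !c0 !mul0r addr0.
apply/eqP; rewrite -absC_eq0 eq_le absC_ge0 andbT; apply/ler_addgt0Pl => e e0.
have [K hK] := cl z z0 e e0; have := hK K (leqnn K).
by rewrite l0 sub0r absCN addr0.
Qed.

Lemma eps_le (x : R) (B : R) : (forall d : R, 0 < d -> d <= 1 -> x <= B * d) -> x <= 0.
Proof.
move=> h; have B0 := normr_ge0 B; apply/ler_addgt0Pl => e e0; rewrite addr0.
pose d := Num.min 1 (e / (`|B| + 1)).
have B1 : 0 < `|B| + 1 by lra.
have d0 : 0 < d by rewrite lt_min ltr01 divr_gt0.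
have d1 : d <= 1 by rewrite ge_min lexx.
apply: le_trans (h d d0 d1) _.
have de : d * (`|B| + 1) <= e by rewrite -ler_pdivlMr // ge_min lexx orbT.
apply: le_trans (ler_wpM2r (ltW d0) (ler_norm B)) _; rewrite mulrC.
by apply: le_trans de; rewrite ler_pM2l //; lra.
Qed.

Lemma norm_small (z : C) (B : R) : (forall d : R, 0 < d -> d <= 1 -> absC z <= B * d) -> z = 0.
Proof.
by move=> h; apply/eqP; rewrite -absC_eq0 eq_le absC_ge0 andbT; exact: eps_le h.
Qed.

(** Cauchy's bound on circles shrinking to 0 removes the negative part of the Laurent series;
    continuity of [g] extends the estimate to z = 0, which [laurent] excludes. *)
Theorem taylor (g : C -> C) : (forall z, differentiable g z) ->
  exists c : nat -> C, (forall (r M : R), 0 < r ->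
    (forall z, absC z = r -> absC (g z) <= M) ->
    forall z, 2 * absC z <= r -> forall m : nat,
      absC (\sum_(k < m.+1) c k * z ^+ k - g z) <= 4 * M * (absC z / r) ^+ m.+1) /\
    (forall z, z != 0 -> forall e : R, 0 < e -> exists m : nat,
      absC (\sum_(k < m.+1) c k * z ^+ k - g z) <= e).
Proof.
move=> dg; have [c [cb cl]] := laurent (fun z _ => dg z).
have /continuousCP cg : {for 0, continuous g} by exact/differentiable_continuous/dg.
have [d d0 hd] := cg 1 ltr01.
pose B := 2 * (absC (g 0) + 1).
have gB z : absC z < d -> absC (g z) <= absC (g 0) + 1.
  move=> zd; have -> : g z = (g z - g 0) + g 0 by ring.
  by apply: le_trans (absCD _ _) _; have := hd z; rewrite subr0 => /(_ zd); lra.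
have cN k : c (Negz k) = 0.
  apply: (@norm_small _ (B * (d / 2))) => t t0 t1.
  have r0 : 0 < d / 2 * t by rewrite mulr_gt0 // divr_gt0.
  have rd : d / 2 * t < d.
    by apply: le_lt_trans (_ : d / 2 < d); [rewrite ler_piMr // divr_ge0 // ltW|lra].
  have tk : 0 <= (t * (d / 2)) ^+ k.
    by rewrite exprn_ge0 // mulr_ge0 ?ltW // divr_gt0.
  (* Chosen so that u <= 1, which gives u^(k+1) <= u, and u <= (d / 2) t, which is below d and
     linear in t. *)
  pose u := d / 2 * Num.min t (Num.min 1 (2 / d)).
  have u0 : 0 < u by rewrite mulr_gt0 ?divr_gt0 // !lt_min t0 ltr01 divr_gt0.
  have u1 : u <= 1.
    have -> : 1 = d / 2 * (2 / d) by field; rewrite gt_eqF.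
    by rewrite ler_wpM2l ?divr_ge0 ?(ltW d0) // !ge_min lexx !orbT.
  have ut : u <= d / 2 * t by rewrite ler_wpM2l ?divr_ge0 ?(ltW d0) // !ge_min lexx.
  have ud : u < d by exact: le_lt_trans rd.
  have gu z : absC z = u -> absC (g z) <= absC (g 0) + 1 by move=> zu; apply: gB; rewrite zu.
  have h : absC (c (Negz k)) * u ^ (Negz k) <= B := cb u _ u0 gu (Negz k).
  have uk : 0 < u ^+ k.+1 by rewrite exprn_gt0.
  have B0 : 0 <= B by rewrite /B; have := absC_ge0 (g 0); lra.
  have {}h : absC (c (Negz k)) <= B * u ^+ k.+1 by rewrite -ler_pdivrMr.
  apply: le_trans h _; rewrite -mulrA ler_wpM2l //; apply: le_trans ut.
  by rewrite exprS ler_piMr ?(ltW u0) // exprn_ile1 // ltW.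
have lE m z : lsum c m z = \sum_(k < m.+1) c (Posz k) * z ^+ k.
  rewrite /lsum big_ord_recl /= expr0 mulr1; congr (_ + _).
  by apply: eq_bigr => k _; rewrite cN mul0r addr0.
exists (fun k => c (Posz k)); split; last first.
  by move=> z z0 e e0; have [K hK] := cl z z0 e e0; exists K; rewrite -lE; exact: hK.
move=> r M r0 gM z zr m; rewrite -lE.
have M0 : 0 <= M.
  apply: le_trans (gM (r%:C)%C _); first exact: absC_ge0.
  by rewrite absC_real ger0_norm // ltW.
have main w k : w != 0 -> 2 * absC w <= r ->
    absC (lsum c k w - g w) <= 4 * M * (absC w / r) ^+ k.+1.
  move=> w0 wr; have -> : 4 * M = 2 * (2 * M) by ring.
  apply: lsum_tail; last exact: cl.
  - by rewrite divr_ge0 ?absC_ge0 // ltW.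
  - by rewrite ler_pdivrMr //; lra.
  move=> j; rewrite cN mul0r addr0 absCM absCX expr_div_n mulrA.
  rewrite ler_pdivlMr ?exprn_gt0 // mulrAC ler_wpM2r ?exprn_ge0 ?absC_ge0 //.
  exact: (cb r M r0 gM (Posz j.+1)).
have [z0|z0] := eqVneq z 0; last exact: main.
have -> : lsum c m z = c 0.
  rewrite /lsum z0 big1 ?addr0 // => k _.
  by rewrite cN mul0r addr0 expr0n /= mulr0.
suff -> : c 0 - g z = 0 by rewrite absC0 z0 absC0 mul0r expr0n /= mulr0.
rewrite z0; apply/eqP; rewrite -absC_eq0 eq_le absC_ge0 andbT.
apply/ler_addgt0Pl => e e0; rewrite addr0.
have e20 : 0 < e / 2 by rewrite divr_gt0.
have [t t0 ht] := cg _ e20.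
(* For m = 0 the estimate at [u] reads |c 0 - g(u)| <= 4 M u / r. The choice makes this and |g(u) -
   g(0)| at most e / 2 each. *)
pose u := Num.min (t / 2) (Num.min (r / 2) (r * (e / 2) / (4 * M + 1))).
have M1 : 0 < 4 * M + 1 by lra.
have u0 : 0 < u by rewrite !lt_min !divr_gt0 // mulr_gt0.
have ut : u <= t / 2 by rewrite ge_min lexx.
have ur : u <= r / 2 by rewrite !ge_min lexx orbT.
have ue : u * (4 * M + 1) <= r * (e / 2).
  by rewrite -ler_pdivlMr // !ge_min lexx !orbT.
have au : absC ((u%:C)%C) = u by rewrite absC_real ger0_norm // ltW.
have uc0 : (u%:C)%C != 0 :> C by rewrite -absC_gt0 au.
have := main _ 0%N uc0; rewrite au => /(_ _) h1.
have {}h1 : absC (lsum c 0 (u%:C)%C - g (u%:C)%C) <= 4 * M * (u / r) ^+ 1 by apply: h1; lra.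
have h2 := ht (u%:C)%C; rewrite subr0 au in h2.
have {}h2 : absC (g (u%:C)%C - g 0) < e / 2 by apply: h2; lra.
rewrite /lsum big_ord0 addr0 expr1 in h1.
have -> : c 0 - g 0 = (c 0 - g (u%:C)%C) + (g (u%:C)%C - g 0) by ring.
apply: le_trans (absCD _ _) _.
suff : 4 * M * (u / r) <= e / 2 by lra.
by rewrite mulrA ler_pdivrMr //; lra.
Qed.

(** If the coefficients below k vanish, the Taylor estimate at small x > 0 reads |c k| x^k <= 4 M (x
    / r)^(k+1), which forces c k = 0 as x tends to 0. Convergence of the series then covers all
    z. *)
Lemma vanish_pos (g : C -> C) : (forall z, differentiable g z) ->
  (forall x : R, 0 < x -> g (x%:C)%C = 0) -> forall z, g z = 0.
Proof.
move=> dg g0; have [c [hc lc]] := taylor dg.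
have /continuousCP cg : {for 0, continuous g} by exact/differentiable_continuous/dg.
have [d d0 hd] := cg 1 ltr01.
have gB z : absC z < d -> absC (g z) <= absC (g 0) + 1.
  move=> zd; have -> : g z = (g z - g 0) + g 0 by ring.
  by apply: le_trans (absCD _ _) _; have := hd z; rewrite subr0 => /(_ zd); lra.
set M := absC (g 0) + 1 in gB; pose r := d / 2.
have r0 : 0 < r by rewrite divr_gt0.
have M0 : 0 <= M by rewrite /M; have := absC_ge0 (g 0); lra.
have rM z : absC z = r -> absC (g z) <= M by move=> zr; apply: gB; rewrite zr /r; lra.
have c0 k : c k = 0.
  elim/ltn_ind: k => k IH.
  apply: (@norm_small _ (4 * M * (1 / 2 / r ^+ k))) => t t0 t1.
  pose x := r * (t / 2).
  have x0 : 0 < x by rewrite mulr_gt0 // divr_gt0.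
  have ax : absC ((x%:C)%C) = x by rewrite absC_real ger0_norm // ltW.
  have := hc r M r0 rM (x%:C)%C; rewrite ax => /(_ _ k) h.
  have {h} : absC (\sum_(i < k.+1) c i * (x%:C)%C ^+ i - g (x%:C)%C) <= 4 * M * (x / r) ^+ k.+1.
    by apply: h; have := ler_wpM2l (ltW r0) t1; rewrite /x; lra.
  rewrite g0 // subr0 big_ord_recr /= big1 ?add0r; last first.
    by move=> i _; rewrite IH // mul0r.
  have xk : 0 < x ^+ k by rewrite exprn_gt0.
  rewrite absCM absCX ax -ler_pdivlMr //; move/le_trans; apply.
  rewrite le_eqVlt; apply/orP; left; apply/eqP.
  rewrite exprSr expr_div_n /x; field.
  by rewrite !mulf_neq0 ?expf_neq0 ?gt_eqF // mulr_gt0.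
have S0 m z : \sum_(k < m.+1) c k * z ^+ k = 0.
  by rewrite big1 // => k _; rewrite c0 mul0r.
move=> z; apply/eqP; rewrite -absC_eq0 eq_le absC_ge0 andbT.
have [->|z0] := eqVneq z 0.
  have := hc r M r0 rM 0; rewrite absC0 mulr0 => /(_ (ltW r0) 0%N).
  by rewrite S0 sub0r absCN mul0r expr1 mulr0.
apply/ler_addgt0Pl => e e0; have [m] := lc z z0 e e0.
by rewrite S0 sub0r absCN addr0.
Qed.

Definition root1 (N : nat) : C := cexp (cpt 0 (pi *+ 2 / N%:R)).

Lemma absC_root1 N : absC (root1 N) = 1.
Proof. by rewrite absC_cexp Re_cpt expR0. Qed.

Lemma root1X N k : root1 N ^+ k = cexp (cpt 0 (k%:R * (pi *+ 2 / N%:R))).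
Proof.
rewrite /root1 -cexpM; congr cexp.
set x := _ / _; rewrite /cpt rmorph0 !add0r.
have -> : (k%:R * x)%:C%C = k%:R * x%:C%C :> C by rewrite rmorphM /= rmorph_nat.
by rewrite mulrCA.
Qed.

Lemma root1N N : (0 < N)%N -> root1 N ^+ N = 1.
Proof.
move=> N0; rewrite root1X mulrCA mulfV ?mulr1 ?pnatr_eq0 -?lt0n //.
by rewrite -[pi *+ 2]add0r cexp_2pi /cpt rmorph0 mulr0 addr0 cexp0.
Qed.

(** Otherwise the angle th has cos th = 1, whereas th / 2 lies strictly between 0 and pi and 1 - cos
    th = 2 sin^2 (th / 2) > 0. *)
Lemma root1_neq1 N k : (0 < k < N)%N -> root1 N ^+ k != 1.
Proof.
move=> /andP[k0 kN]; rewrite root1X; set th := _ * _.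
have N0 : (0 : R) < N%:R by rewrite ltr0n (leq_trans _ kN).
have th0 : 0 < th / 2 < pi.
  have -> : th / 2 = k%:R / N%:R * pi by rewrite /th mulr2n; field; rewrite gt_eqF.
  apply/andP; split; first by rewrite mulr_gt0 ?pi_gt0 // divr_gt0 // ltr0n.
  by rewrite gtr_pMl ?pi_gt0 // ltr_pdivrMr // mul1r ltr_nat.
apply/eqP => e.
have : cos th = 1.
  have := congr1 (@complex.Re R) e; rewrite /cexp Re_cpt Im_cpt expR0 mul1r Re_cpt.
  by [].
have -> : th = th / 2 + th / 2 by field.
rewrite cosD; have := sin_gt0_pi th0; have := cos2Dsin2 (th / 2).
set a := cos _; set b := sin _ => h1 h2 h3.
have : b * b = 0 by lra.
by move/eqP; rewrite mulf_eq0 => /orP[] /eqP b0; rewrite b0 ltxx in h2.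
Qed.

Lemma root1_avg N (l : int) : (`|l| < N)%N ->
  N%:R^-1 * \sum_(j < N) (root1 N ^+ j) ^ l = (l == 0)%:R.
Proof.
move=> lN; have N0 : (0 < N)%N by exact: leq_ltn_trans lN.
have NC : (N%:R : C) != 0 by rewrite pnatr_eq0 -lt0n.
have w0 : root1 N != 0 by rewrite -absC_gt0 absC_root1.
have [->|l0] := eqVneq l 0.
  under eq_bigr do rewrite expr0z.
  by rewrite sumr_const card_ord mulVf.
have -> : \sum_(j < N) (root1 N ^+ j) ^ l = \sum_(j < N) (root1 N ^ l) ^+ j.
  by apply: eq_bigr => j _; rewrite !exprnP !exprz_exp mulrC.
set w := root1 N ^ l.
have wN : w ^+ N = 1 by rewrite /w exprnP exprz_exp mulrC -exprz_exp -exprnP root1N // exp1rz.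
have w1 : w - 1 != 0.
  rewrite subr_eq0 /w; case: (l) l0 lN => k.
    by move=> k0 kN; apply: root1_neq1; rewrite kN lt0n; case: k k0 kN.
  move=> _ kN; rewrite NegzE -exprnN; apply/eqP => /(congr1 GRing.inv).
  by rewrite invrK invr1; apply/eqP/root1_neq1; rewrite kN.
apply/eqP; rewrite mulr0n mulf_eq0 orbC; apply/orP; left.
by rewrite -(mulrI_eq0 _ (mulfI w1)) -subrX1 wN subrr.
Qed.

End PowerSeries.

(** * Interpolation with geometric error bounds *)

Section Interpolation.
Variable R : realType.
Local Notation C := R[i].

(** For u = p / z this truncates z / (z - p), the Cauchy kernel with respect to dz / z. *)
Definition geo (m : nat) (u : C) : C := \sum_(k < m.+1) u ^+ k.

Lemma geo_bound m u : 2 * absC u <= 1 -> absC (geo m u) <= 2.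
Proof.
move=> u1; have u0 := absC_ge0 u.
suff h : absC (geo m u) <= 2 - absC u ^+ m.
  by apply: le_trans h _; rewrite lerBlDr lerDl exprn_ge0.
rewrite /geo; elim: m => [|m IH].
  by rewrite big_ord_recl big_ord0 addr0 !expr0 absC1; lra.
rewrite big_ord_recr /=; apply: le_trans (absCD _ _) _; rewrite absCX.
have : 2 * absC u ^+ m.+1 <= absC u ^+ m.
  by rewrite exprS mulrA ler_piMl // exprn_ge0.
lra.
Qed.

Definition node (r : R) (N j : nat) : C := (r%:C)%C * root1 R N ^+ j.

Lemma absC_node r N j : 0 < r -> absC (node r N j) = r.
Proof.
move=> r0; rewrite /node absCM absCX absC_root1 expr1n mulr1 absC_real.
by rewrite ger0_norm // ltW.
Qed.

(** A discrete circle mean. It is a finite sum of values, and it agrees with the integral mean on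
    z^l for |l| < N. *)
Definition avg (r : R) (N : nat) (f : C -> C) : C :=
  N%:R^-1 * \sum_(j < N) f (node r N j).

Lemma avgD r N f g : avg r N (fun z => f z + g z) = avg r N f + avg r N g.
Proof. by rewrite /avg big_split mulrDr. Qed.

Lemma avgZ r N a f : avg r N (fun z => a * f z) = a * avg r N f.
Proof. by rewrite /avg -mulr_sumr mulrCA. Qed.

Lemma avg_sum r N K (f : nat -> C -> C) :
  avg r N (fun z => \sum_(k < K) f k z) = \sum_(k < K) avg r N (f k).
Proof. by rewrite /avg exchange_big mulr_sumr. Qed.

Lemma eq_avg r N f g : 0 < r -> (forall z, absC z = r -> f z = g z) ->
  avg r N f = avg r N g.
Proof.
by move=> r0 fg; congr (_ * _); apply: eq_bigr => j _; apply: fg; exact: absC_node.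
Qed.

Lemma avg_bound r N f (B : R) : 0 < r -> (0 < N)%N ->
  (forall z, absC z = r -> absC (f z) <= B) -> absC (avg r N f) <= B.
Proof.
move=> r0 N0 fB; rewrite /avg absCM absCV.
have -> : (N%:R : C) = (N%:R : R)%:C%C by rewrite rmorph_nat.
rewrite absC_real ger0_norm ?ler0n // ler_pdivrMl ?ltr0n //.
apply: le_trans (absC_sum _ _ _) _.
apply: le_trans (_ : \sum_(j < N) B <= _).
  by apply: ler_sum => j _; apply: fB; exact: absC_node.
by rewrite sumr_const card_ord mulr_natl.
Qed.

Lemma avg_mono r N (l : int) : 0 < r -> (`|l| < N)%N ->
  avg r N (fun z => z ^ l) = (l == 0)%:R.
Proof.
move=> r0 lN; rewrite /avg /node.
under eq_bigr do rewrite expfzMl.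
rewrite -mulr_sumr mulrCA root1_avg //.
by case: eqVneq => [->|_]; rewrite ?expr0z ?mul1r ?mulr0.
Qed.

(* The part of a Laurent monomial of exponent l that is recovered by [geo]. *)
Definition pospart (p : C) (l : int) : C := if l is Posz k then p ^+ k else 0.

(** The exponents l - k lie between -2m and m, so 2m + 1 nodes exclude aliasing and only k = l
    survives. *)
Lemma avg_geo_mono r m (p : C) (l : int) : 0 < r -> (`|l| <= m)%N ->
  avg r m.*2.+1 (fun z => geo m (p / z) * z ^ l) = pospart p l.
Proof.
move=> r0 lm.
have -> : avg r m.*2.+1 (fun z => geo m (p / z) * z ^ l) =
    avg r m.*2.+1 (fun z => \sum_(k < m.+1) p ^+ k * z ^ (l - k%:Z)).
  apply: eq_avg => // z zr; rewrite /geo mulr_suml; apply: eq_bigr => k _.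
  have z0 : z != 0 by rewrite -absC_gt0 zr.
  by rewrite expr_div_n expfzDr // -mulrA [z ^- k * _]mulrC exprnN.
rewrite (avg_sum _ _ _ (fun k z => p ^+ k * z ^ (l - k%:Z))).
have E (k : 'I_m.+1) : avg r m.*2.+1 (fun z => p ^+ k * z ^ (l - k%:Z)) =
    p ^+ k * (l == k%:Z)%:R.
  rewrite avgZ avg_mono // ?subr_eq0 //; have := ltn_ord k; lia.
under eq_bigr do rewrite E.
case: l lm {E} => [i|i] lm /=; last first.
  by rewrite big1 // => k _; rewrite mulr0.
have im : (i < m.+1)%N by lia.
rewrite (bigD1 (Ordinal im)) //= eqxx mulr1 big1 ?addr0 // => k ki.
have -> : (Posz i == Posz k) = false.
  by apply/negbTE; apply: contra ki => /eqP[ik]; apply/eqP/val_inj.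
by rewrite mulr0.
Qed.

(** The average is exact on the Taylor polynomial of degree m. The bound M on the doubled disc makes
    the remainder at most 2 M / 2^m for |z| <= r; it is counted once at [p] and, with the kernel
    bound 2, twice on the nodes. *)
Lemma taylor_interpolation (g : C -> C) (r M : R) (p : C) : (forall z, differentiable g z) ->
  0 < r -> (forall z, absC z <= 2 * r -> absC (g z) <= M) -> 2 * absC p <= r -> forall m,
  absC (avg r m.*2.+1 (fun z => geo m (p / z) * g z) - g p) <= 6 * M / 2 ^+ m.
Proof.
move=> dg r0 gM pr m; have [c [hc _]] := taylor dg.
have r20 : 0 < 2 * r by rewrite mulr_gt0.
have M0 : 0 <= M by apply: le_trans (absC_ge0 (g 0)) (gM _ _); rewrite absC0 ltW.
pose P (z : C) := \sum_(k < m.+1) c k * z ^+ k.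
have PM z : absC z <= r -> absC (P z - g z) <= 2 * M / 2 ^+ m.
  move=> zr; have := hc (2 * r) M r20 _ z _ m.
  move=> /(_ _ _)/le_trans; apply; [|lra|].
    by move=> w wr; apply: gM; rewrite wr.
  have h : absC z / (2 * r) <= 2^-1 by rewrite ler_pdivrMr //; lra.
  have z0 : 0 <= absC z / (2 * r) by rewrite divr_ge0 ?absC_ge0 // ltW.
  have := @lerXn2r _ m.+1 _ _ z0 _ h; rewrite nnegrE => /(_ _) h2.
  have {}h2 : (absC z / (2 * r)) ^+ m.+1 <= 2^-1 ^+ m.+1 by apply: h2; rewrite invr_ge0.
  have -> : 2 * M / 2 ^+ m = 4 * M * 2^-1 ^+ m.+1.
    by rewrite exprS exprVn; field; rewrite expf_neq0.
  by rewrite ler_wpM2l // mulr_ge0.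
have EP : avg r m.*2.+1 (fun z => geo m (p / z) * P z) = P p.
  transitivity (avg r m.*2.+1 (fun z => \sum_(k < m.+1) c k * (geo m (p / z) * z ^ k%:Z))).
    by apply: eq_avg => // z _; rewrite mulr_sumr; apply: eq_bigr => k _; rewrite mulrCA.
  rewrite (avg_sum _ _ _ (fun k z => c k * (geo m (p / z) * z ^ k%:Z))).
  by apply: eq_bigr => k _; rewrite avgZ avg_geo_mono // absz_nat -ltnS.
have -> : avg r m.*2.+1 (fun z => geo m (p / z) * g z) - g p =
    (P p - g p) - avg r m.*2.+1 (fun z => geo m (p / z) * (P z - g z)).
  have -> : avg r m.*2.+1 (fun z => geo m (p / z) * (P z - g z)) =
      avg r m.*2.+1 (fun z => geo m (p / z) * P z) + (-1) * avg r m.*2.+1 (fun z => geo m (p / z) * g z).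
    by rewrite -avgZ -avgD; apply: eq_avg => // z _; ring.
  by rewrite EP; ring.
apply: le_trans (absCBD _ _) _.
have h1 : absC (P p - g p) <= 2 * M / 2 ^+ m by apply: PM; have := absC_ge0 p; lra.
have h2 : absC (avg r m.*2.+1 (fun z => geo m (p / z) * (P z - g z))) <= 2 * (2 * M / 2 ^+ m).
  apply: avg_bound => // z zr; rewrite absCM; apply: ler_pM; rewrite ?absC_ge0 //.
    by apply: geo_bound; rewrite absCM absCV zr mulrA ler_pdivrMr // mul1r.
  by apply: PM; rewrite zr.
by move: h1 h2; rewrite -!mulrA; lra.
Qed.

(* Interpolation of a function on the curve pq = s at the points (z, s/z) and (s/z, z)
   with |z| = r; it reproduces all Laurent monomials of degree at most m. *)
Definition hyp_interp (r : R) (m : nat) (F : C -> C -> C) (s p q : C) : C :=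
  avg r m.*2.+1 (fun z => geo m (p / z) * F z (s / z)) +
  avg r m.*2.+1 (fun z => (geo m (q / z) - 1) * F (s / z) z).

(** The function g(z) = F(z, s/z) is bounded by M for |s| / (2r) <= |z| <= 2r. Passing to |s| / r <=
    |z| <= r gains a ratio 1/2 in both halves of the Laurent series, so the remainder is at most B =
    4 M / 2^m. The interpolation is exact on the partial sum and its two kernels are bounded by 2
    and 3: the error is at most (1 + 2 + 3) B. *)
Lemma hyp_interpolation_neq0 (F : C -> C -> C) (r M : R) (p q s : C) : s != 0 -> p * q = s ->
  (forall z, z != 0 -> differentiable (fun z => F z (s / z)) z) -> 0 < r ->
  (forall z w, z * w = s -> absC z <= 2 * r -> absC w <= 2 * r -> absC (F z w) <= M) ->
  2 * absC p <= r -> 2 * absC q <= r -> forall m,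
  absC (hyp_interp r m F s p q - F p q) <= 24 * M / 2 ^+ m.
Proof.
move=> s0 pqs dF r0 FM pr qr m.
have p0 : p != 0 by apply: contraNneq s0 => p0; rewrite -pqs p0 mul0r.
have q0 : q != 0 by apply: contraNneq s0 => q0; rewrite -pqs q0 mulr0.
pose g z := F z (s / z).
have [c [hc lc]] := laurent dF.
have as0 : 0 < absC s by rewrite absC_gt0.
have ap0 : 0 < absC p by rewrite absC_gt0.
have aq0 : 0 < absC q by rewrite absC_gt0.
have apq : absC p * absC q = absC s by rewrite -absCM pqs.
have r20 : 0 < 2 * r by rewrite mulr_gt0.
have sr : 4 * absC s <= r * r.
  by rewrite -apq; have := ler_pM (mulr_ge0 (ler0n _ 2) (absC_ge0 p)) (mulr_ge0 (ler0n _ 2) (absC_ge0 q)) pr qr; lra.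
have M0 : 0 <= M.
  by apply: le_trans (absC_ge0 (F p q)) (FM _ _ pqs _ _); lra.
have gM z : absC s / (2 * r) <= absC z -> absC z <= 2 * r -> absC (g z) <= M.
  move=> z1 z2; have z0 : 0 < absC z by apply: lt_le_trans z1; rewrite divr_gt0.
  apply: FM => //; first by field; rewrite -absC_gt0.
  by rewrite absCM absCV ler_pdivrMr // mulrC -ler_pdivrMr.
have PM z : absC s / r <= absC z -> absC z <= r -> absC (lsum c m z - g z) <= 4 * M / 2 ^+ m.
  move=> z1 z2; have z0 : 0 < absC z by apply: lt_le_trans z1; rewrite divr_gt0.
  have -> : 4 * M / 2 ^+ m = 2 * (4 * M) * (1 / 2) ^+ m.+1.
    by rewrite expr_div_n expr1n exprS; field; rewrite expf_neq0.
  apply: lsum_tail; rewrite ?lexx ?divr_ge0 //.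
    move=> k; apply: le_trans (absCD _ _) _; rewrite !absCM !absCX absCV.
    have h1 : absC (c (Posz k.+1)) * absC z ^+ k.+1 <= 2 * M * (1 / 2) ^+ k.+1.
      have h : absC (c (Posz k.+1)) * (2 * r) ^+ k.+1 <= 2 * M.
        apply: (hc (2 * r) M r20 _ (Posz k.+1)) => w wr; apply: gM; rewrite wr //.
        by rewrite ler_pdivrMr //; lra.
      apply: le_trans (_ : absC (c (Posz k.+1)) * ((1 / 2) * (2 * r)) ^+ k.+1 <= _).
        rewrite ler_wpM2l ?absC_ge0 // lerXn2r ?nnegrE ?absC_ge0 //; lra.
      by rewrite exprMn mulrCA mulrC ler_wpM2r // exprn_ge0.
    have h2 : absC (c (Negz k)) * (absC z)^-1 ^+ k.+1 <= 2 * M * (1 / 2) ^+ k.+1.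
      have u0 : 0 < absC s / (2 * r) by rewrite divr_gt0.
      have h : absC (c (Negz k)) * (absC s / (2 * r))^-1 ^+ k.+1 <= 2 * M.
        rewrite exprVn; apply: (hc (absC s / (2 * r)) M u0 _ (Negz k)) => w wr; apply: gM; rewrite wr //.
        by rewrite ler_pdivrMr //; lra.
      apply: le_trans (_ : absC (c (Negz k)) * ((1 / 2) * (absC s / (2 * r))^-1) ^+ k.+1 <= _).
        rewrite ler_wpM2l ?absC_ge0 // lerXn2r ?nnegrE ?invr_ge0 ?absC_ge0 //.
          by rewrite mulr_ge0 // invr_ge0 ltW.
        have -> : 1 / 2 * (absC s / (2 * r))^-1 = (absC s / r)^-1 by field; rewrite !gt_eqF.
        by rewrite lef_pV2 // posrE divr_gt0.
      by rewrite exprMn mulrCA mulrC ler_wpM2r // exprn_ge0.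
    lra.
  by apply: lc; rewrite -absC_gt0.
have gpq : F p q = g p by rewrite /g -pqs [p * q]mulrC mulfK.
pose E (h : C -> C) := avg r m.*2.+1 (fun z => geo m (p / z) * h z) +
  avg r m.*2.+1 (fun z => (geo m (q / z) - 1) * h (s / z)).
have ED h1 h2 : E (fun z => h1 z + h2 z) = E h1 + E h2.
  rewrite [RHS]addrACA; congr (_ + _); rewrite -avgD; apply: eq_avg => // z _; ring.
have EZ a h : E (fun z => a * h z) = a * E h.
  rewrite [RHS]mulrDr; congr (_ + _); rewrite -avgZ; apply: eq_avg => // z _; ring.
have eqE h1 h2 : (forall z, z != 0 -> h1 z = h2 z) -> E h1 = E h2.
  move=> h12; congr (_ + _); apply: eq_avg => // z zr; rewrite h12 //.
    by rewrite -absC_gt0 zr.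
  by rewrite mulf_neq0 // invr_eq0 -absC_gt0 zr.
(* The first average recovers l >= 0, the second l < 0 through (s/z)^l and p q = s; the [- 1] in its
   kernel prevents l = 0 from being counted twice. *)
have EX (l : int) : (`|l| <= m)%N -> E (fun z => z ^ l) = p ^ l.
  move=> lm; rewrite /E avg_geo_mono //.
  have -> : avg r m.*2.+1 (fun z => (geo m (q / z) - 1) * (s / z) ^ l) =
      s ^ l * (avg r m.*2.+1 (fun z => geo m (q / z) * z ^ (- l)) +
               (-1) * avg r m.*2.+1 (fun z => z ^ (- l))).
    rewrite -avgZ -avgD -avgZ; apply: eq_avg => // z _.
    by rewrite expfzMl exprz_inv; ring.
  have lm1 : (`|- l| <= m)%N by rewrite abszN.
  have lm2 : (`|- l| < m.*2.+1)%N by rewrite abszN ltnS (leq_trans lm) // -addnn leq_addr.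
  rewrite (avg_geo_mono _ r0 lm1) (avg_mono r0 lm2).
  rewrite oppr_eq0; case: l lm {lm1 lm2} => [[|k]|k] lm /=.
  - by rewrite !expr0z expr0 mulN1r subrr mulr0 addr0.
  - by rewrite mulr0 addr0 mulr0 addr0.
  rewrite mulr0 addr0 add0r -pqs expfzMl NegzE -!exprnN -mulrA mulVf ?mulr1 //.
  by rewrite expf_neq0.
have EP : E (lsum c m) = lsum c m p.
  have L h0 k : (k <= m)%N -> E (fun z => h0 z + \sum_(j < k) (c (Posz j.+1) * z ^+ j.+1 + c (Negz j) * (z^-1) ^+ j.+1))
     = E h0 + \sum_(j < k) (c (Posz j.+1) * p ^+ j.+1 + c (Negz j) * (p^-1) ^+ j.+1).
    elim: k => [|k IH] km.
      by rewrite big_ord0 addr0; apply: eqE => z _; rewrite big_ord0 addr0.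
    rewrite big_ord_recr /= addrA -IH ?(ltnW km) //.
    rewrite [in RHS]exprVn -[p ^+ k.+1]/(p ^ (Posz k.+1)) -[(p ^+ k.+1)^-1]/(p ^ (Negz k)).
    rewrite -!EX ?absz_nat // -!EZ -!ED; apply: eqE => z z0.
    by rewrite big_ord_recr /= addrA exprVn.
  rewrite /lsum L // ; congr (_ + _).
  have e0 : E (fun z => c 0 * z ^ 0) = c 0 by rewrite EZ EX // expr0z mulr1.
  by rewrite -[RHS]e0; apply: eqE => z _; rewrite expr0z mulr1.
have Eg : hyp_interp r m F s p q = E g.
  rewrite /hyp_interp /E; congr (_ + _); apply: eq_avg => // z zr.
  have z0 : z != 0 by rewrite -absC_gt0 zr.
  by congr (_ * F _ _); field; rewrite s0 z0.
have -> : hyp_interp r m F s p q - F p q = (lsum c m p - g p) - E (fun z => lsum c m z + (-1) * g z).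
  by rewrite Eg gpq ED EZ EP; ring.
set B := 4 * M / 2 ^+ m in PM.
have srr : absC s / r <= r by rewrite ler_pdivrMr //; have := absC_ge0 s; lra.
have hp : absC (lsum c m p - g p) <= B.
  apply: PM; last by lra.
  by rewrite ler_pdivrMr // -apq ler_wpM2l ?absC_ge0 //; lra.
have hg z : absC z = r -> absC (lsum c m z + -1 * g z) <= B.
  by move=> zr; rewrite mulN1r; apply: PM; rewrite zr.
have hg2 z : absC z = r -> absC (lsum c m (s / z) + -1 * g (s / z)) <= B.
  by move=> zr; rewrite mulN1r; apply: PM; rewrite absCM absCV zr.
have B0 : 0 <= B by apply: le_trans hp; exact: absC_ge0.
have geoB u z : absC z = r -> 2 * absC u <= r -> absC (geo m (u / z)) <= 2.
  move=> zr ur; apply: geo_bound; rewrite absCM absCV zr mulrA ler_pdivrMr //; lra.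
have h1 : absC (avg r m.*2.+1 (fun z => geo m (p / z) * (lsum c m z + -1 * g z))) <= 2 * B.
  by apply: avg_bound => // z zr; rewrite absCM; apply: ler_pM; rewrite ?absC_ge0 ?geoB ?hg.
have h2 : absC (avg r m.*2.+1 (fun z => (geo m (q / z) - 1) * (lsum c m (s / z) + -1 * g (s / z)))) <= 3 * B.
  apply: avg_bound => // z zr; rewrite absCM; apply: ler_pM; rewrite ?absC_ge0 ?hg2 //.
  by apply: le_trans (absCBD _ _) _; rewrite absC1; have := geoB q z zr qr; lra.
apply: le_trans (absCBD _ _) _.
have := absCD (avg r m.*2.+1 (fun z => geo m (p / z) * (lsum c m z + -1 * g z)))
  (avg r m.*2.+1 (fun z => (geo m (q / z) - 1) * (lsum c m (s / z) + -1 * g (s / z)))).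
rewrite -/(E _) => h3.
have -> : 24 * M / 2 ^+ m = 6 * B by rewrite /B -!mulrA; lra.
lra.
Qed.

Lemma geo0 m : geo m 0 = 1.
Proof.
rewrite /geo big_ord_recl expr0 big1 ?addr0 // => k _.
by rewrite lift0 expr0n.
Qed.

(** For s = 0 the curve is the union of the two axes, and the formula becomes Taylor interpolation
    on each axis minus the interpolated value at the origin. The three errors of 6 M / 2^m fit into
    the same bound. *)
Theorem hyp_interpolation (F : C -> C -> C) (r M : R) (p q s : C) : p * q = s ->
  (s != 0 -> forall z, z != 0 -> differentiable (fun z => F z (s / z)) z) ->
  (s = 0 -> forall z, differentiable (fun z => F z 0) z) ->
  (s = 0 -> forall z, differentiable (fun z => F 0 z) z) -> 0 < r ->
  (forall z w, z * w = s -> absC z <= 2 * r -> absC w <= 2 * r -> absC (F z w) <= M) ->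
  2 * absC p <= r -> 2 * absC q <= r -> forall m,
  absC (hyp_interp r m F s p q - F p q) <= 24 * M / 2 ^+ m.
Proof.
move=> pqs dF d1 d2 r0 FM pr qr m.
have [s0|s0] := eqVneq s 0; last exact: hyp_interpolation_neq0 (dF s0) _ _ _ _ _.
have {}d1 := d1 s0; have {}d2 := d2 s0; rewrite {dF}s0 in pqs FM *.
have r20 : 0 <= 2 * r by rewrite mulr_ge0 // ltW.
have b1 z : absC z <= 2 * r -> absC (F z 0) <= M by move=> zr; apply: FM; rewrite ?mulr0 // absC0.
have b2 z : absC z <= 2 * r -> absC (F 0 z) <= M by move=> zr; apply: FM; rewrite ?mul0r // absC0.
have t1 u := taylor_interpolation (p := u) d1 r0 b1.
have t2 u := taylor_interpolation (p := u) d2 r0 b2.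
have M0 : 0 <= M by apply: le_trans (absC_ge0 (F 0 0)) (b1 _ _); rewrite absC0.
have Mm : 0 <= M / 2 ^+ m by rewrite divr_ge0 // exprn_ge0.
have -> : hyp_interp r m F 0 p q = avg r m.*2.+1 (fun z => geo m (p / z) * F z 0) +
   (avg r m.*2.+1 (fun z => geo m (q / z) * F 0 z) - avg r m.*2.+1 (fun z => geo m (0 / z) * F 0 z)).
  rewrite /hyp_interp; congr (_ + _).
    by apply: eq_avg => // z _; rewrite mul0r.
  rewrite -[- avg _ _ _]mulN1r -avgZ -avgD; apply: eq_avg => // z _.
  by rewrite !mul0r geo0; ring.
have u0 : 2 * absC (0 : C) <= r by rewrite absC0 mulr0 ltW.
have h1 := t1 0 u0 m; have h2 := t2 0 u0 m; have h3 := t1 p pr m; have h4 := t2 q qr m.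
rewrite -!mulrA in h1 h2 h3 h4 *.
move: h1 h2 h3 h4; set a1 := avg _ _ (fun z => _ (p / z) * _).
set a2 := avg _ _ (fun z => _ (q / z) * _); set a3 := avg _ _ (fun z => _ (0 / z) * F 0 z).
clearbody a1 a2 a3 => h1 h2 h3 h4.
move/eqP: pqs; rewrite mulf_eq0 => /orP[]/eqP e.
  rewrite e in h3 *.
  have -> : a1 + (a2 - a3) - F 0 q = (a1 - F 0 0) + (a2 - F 0 q) - (a3 - F 0 0) by ring.
  have := absCBD ((a1 - F 0 0) + (a2 - F 0 q)) (a3 - F 0 0).
  have := absCD (a1 - F 0 0) (a2 - F 0 q); lra.
rewrite e in h4 *.
have -> : a1 + (a2 - a3) - F p 0 = (a1 - F p 0) + (a2 - F 0 0) - (a3 - F 0 0) by ring.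
have := absCBD ((a1 - F p 0) + (a2 - F 0 0)) (a3 - F 0 0).
have := absCD (a1 - F p 0) (a2 - F 0 0); lra.
Qed.

End Interpolation.

(** * Polynomial approximation on the quadric *)

Section PolynomialApproximation.
Variables (R : realType) (K : finType).
Local Notation C := R[i].
Implicit Types (f g : (K -> C) -> C) (x : K -> C) (S : set (K -> C)).

(** A predicate on functions instead of a polynomial ring, so that boundedness, differentiability
    along curves and closure properties go by induction. *)
Inductive polyfun : ((K -> C) -> C) -> Prop :=
| polyfun_cst c : polyfun (fun=> c)
| polyfun_coord k : polyfun (fun x => x k)
| polyfunD f g : polyfun f -> polyfun g -> polyfun (fun x => f x + g x)
| polyfunM f g : polyfun f -> polyfun g -> polyfun (fun x => f x * g x).

Definition cbounded (B : R) x := forall k, absC (x k) <= B.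

Definition bounded_on S f := forall B : R, exists M : R, forall x, S x ->
  cbounded B x -> absC (f x) <= M.

Lemma polyfun_bounded f : polyfun f -> bounded_on setT f.
Proof.
elim=> [c|k|{}f g _ IHf _ IHg|{}f g _ IHf _ IHg] B.
- by exists (absC c).
- by exists B => x _; apply.
- have [M hM] := IHf B; have [N hN] := IHg B; exists (M + N) => x Sx xB.
  by apply: le_trans (absCD _ _) _; apply: lerD; [exact: hM|exact: hN].
- have [M hM] := IHf B; have [N hN] := IHg B; exists (M * N) => x Sx xB.
  by rewrite absCM; apply: ler_pM; rewrite ?absC_ge0 // ?hM ?hN.
Qed.

Lemma polyfun_sum I (r : seq I) (F : I -> (K -> C) -> C) :
  (forall i, polyfun (F i)) -> polyfun (fun x => \sum_(i <- r) F i x).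
Proof.
move=> pF; elim: r => [|i r IH].
  by under eq_fun do rewrite big_nil; exact: polyfun_cst.
by under eq_fun do rewrite big_cons; exact: polyfunD.
Qed.

Lemma polyfunX f m : polyfun f -> polyfun (fun x => f x ^+ m).
Proof.
move=> pf; elim: m => [|m IH].
  by under eq_fun do rewrite expr0; exact: polyfun_cst.
by under eq_fun do rewrite exprS; exact: polyfunM.
Qed.

Lemma polyfun_curve (V : normedModType C) f (gam : V -> K -> C) z : polyfun f ->
  (forall k, differentiable (fun l => gam l k) z) ->
  differentiable (fun l => f (gam l)) z.
Proof.
move=> pf dg; elim: pf => [c|k|{}f g _ IHf _ IHg|{}f g _ IHf _ IHg].
- exact: differentiable_cst.
- exact: dg.
- exact: (differentiableD IHf IHg).
- exact: (differentiableM IHf IHg).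
Qed.

Definition polyapprox S f := forall B e : R, 0 < e -> exists2 Q, polyfun Q &
  forall x, S x -> cbounded B x -> absC (f x - Q x) <= e.

Lemma polyapprox_polyfun S f : polyfun f -> polyapprox S f.
Proof. by move=> pf B e e0; exists f => // x _ _; rewrite subrr absC0 ltW. Qed.

Lemma polyapprox_sub S f : polyapprox setT f -> polyapprox S f.
Proof. by move=> h B e /(h B)[Q pQ hQ]; exists Q => // x _; exact: hQ. Qed.

Lemma polyapproxD S f g : polyapprox S f -> polyapprox S g ->
  polyapprox S (fun x => f x + g x).
Proof.
move=> hf hg B e e0; have e20 : 0 < e / 2 by rewrite divr_gt0.
have [P pP hP] := hf B _ e20; have [Q pQ hQ] := hg B _ e20.
exists (fun x => P x + Q x) => [|x Sx xB]; first exact: polyfunD.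
have -> : f x + g x - (P x + Q x) = (f x - P x) + (g x - Q x) by ring.
by apply: le_trans (absCD _ _) _; have := hP x Sx xB; have := hQ x Sx xB; lra.
Qed.

Lemma polyapproxM S f g : polyfun f -> polyapprox S g ->
  polyapprox S (fun x => f x * g x).
Proof.
move=> pf hg B e e0; have [M hM] := polyfun_bounded pf B.
have M1 : 0 < `|M| + 1 by have := normr_ge0 M; lra.
have [|Q pQ hQ] := hg B (e / (`|M| + 1)); first by rewrite divr_gt0.
exists (fun x => f x * Q x) => [|x Sx xB]; first exact: polyfunM.
rewrite -mulrBr absCM.
apply: le_trans (_ : (`|M| + 1) * (e / (`|M| + 1)) <= _); last first.
  by rewrite mulrCA mulfV ?mulr1 // gt_eqF.
apply: ler_pM; rewrite ?absC_ge0 ?hQ //; have := hM x I xB; have := ler_norm M; lra.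
Qed.

Lemma polyapprox_sum S I (r : seq I) (F : I -> (K -> C) -> C) :
  (forall i, polyapprox S (F i)) -> polyapprox S (fun x => \sum_(i <- r) F i x).
Proof.
move=> pF; elim: r => [|i r IH].
  by under eq_fun do rewrite big_nil; exact/polyapprox_polyfun/polyfun_cst.
by under eq_fun do rewrite big_cons; exact: polyapproxD.
Qed.

Lemma polyapprox_lim S f : (forall B e : R, 0 < e -> exists2 g, polyapprox S g &
  forall x, S x -> cbounded B x -> absC (f x - g x) <= e) -> polyapprox S f.
Proof.
move=> h B e e0; have e20 : 0 < e / 2 by rewrite divr_gt0.
have [g pg hg] := h B _ e20; have [Q pQ hQ] := pg B _ e20.
exists Q => // x Sx xB; have -> : f x - Q x = (f x - g x) + (g x - Q x) by ring.
by apply: le_trans (absCD _ _) _; have := hg x Sx xB; have := hQ x Sx xB; lra.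
Qed.

Lemma polyfun_geo (m : nat) (z : C) f : polyfun f -> polyfun (fun x => geo m (f x / z)).
Proof.
move=> pf; apply: polyfun_sum => k.
by under eq_fun do rewrite expr_div_n; apply: polyfunM; [exact: polyfunX|exact: polyfun_cst].
Qed.

Lemma polyapprox_avg S (r : R) (N : nat) (F : C -> (K -> C) -> C) : 0 < r ->
  (forall z, absC z = r -> polyapprox S (F z)) ->
  polyapprox S (fun x => avg r N (fun z => F z x)).
Proof.
move=> r0 pF; apply: polyapproxM; first exact: polyfun_cst.
by apply: polyapprox_sum => j; apply: pF; exact: absC_node.
Qed.

Lemma pow2_small (M e : R) : 0 < e -> exists m : nat, M / 2 ^+ m <= e.
Proof. by move=> /(half_pow_small M)[m /ltW]; exists m. Qed.

Definition upd x (k : K) (l : C) : K -> C := fun j => if j == k then l else x j.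

Lemma updE x k : upd x k (x k) = x.
Proof. by apply/funext => j; rewrite /upd; case: eqVneq => [->|]. Qed.

Lemma upd_comm x j k l l' : j != k -> upd (upd x j l) k l' = upd (upd x k l') j l.
Proof.
move=> jk; apply/funext => i; rewrite /upd; case: eqVneq => [->|//].
by rewrite eq_sym (negPf jk).
Qed.

Lemma upd_twice x k l l' : upd (upd x k l) k l' = upd x k l'.
Proof. by apply/funext => i; rewrite /upd; case: eqVneq. Qed.

Lemma cbounded_upd B x k l : cbounded B x -> absC l <= B -> cbounded B (upd x k l).
Proof. by move=> xB lB j; rewrite /upd; case: ifP. Qed.

Lemma differentiable_upd x k z j : differentiable (fun l => upd x k l j) z.
Proof.
rewrite /upd; have [_|_] := eqVneq j k; first exact: differentiable_idC.
exact: differentiable_cst.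
Qed.

Lemma cbounded_le (B B' : R) x : B <= B' -> cbounded B x -> cbounded B' x.
Proof. by move=> BB xB k; apply: le_trans BB. Qed.

(* The coordinates are frozen one after the other by Taylor interpolation. *)
Theorem polyapprox_entire f :
  (forall x k z, differentiable (fun l => f (upd x k l)) z) ->
  bounded_on setT f -> polyapprox setT f.
Proof.
move=> df bf.
(* Here [s] lists the coordinates on which [f] may still depend; each interpolation removes its
   head. *)
suff gen (s : seq K) : forall f, (forall x k z, differentiable (fun l => f (upd x k l)) z) ->
    bounded_on setT f -> (forall x y, (forall k, k \in s -> x k = y k) -> f x = f y) ->
    polyapprox setT f.
  by apply: (gen (enum K)) => // x y xy; congr f; apply/funext => k; apply: xy; rewrite mem_enum.
elim: s => [|k s IH] {}f {}df {}bf dep.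
  have -> : f = (fun=> f (fun=> 0)) by apply/funext => x; exact: dep.
  exact/polyapprox_polyfun/polyfun_cst.
apply: polyapprox_lim => B e e0.
(* Gives 2 |x k| <= r and B <= 2 r, as the interpolation estimate requires, and r > 0 for every real
   B. *)
pose r := 2 * `|B| + 1; have r0 : 0 < r by rewrite /r; have := normr_ge0 B; lra.
have [M hM] := bf (2 * r).
have [m hm] := pow2_small (6 * M) e0.
exists (fun x => avg r m.*2.+1 (fun z => geo m (x k / z) * f (upd x k z))).
  apply: polyapprox_avg => // z zr; apply: polyapproxM.
    by apply: polyfun_geo; exact: polyfun_coord.
  apply: IH.
  - move=> x j w; have [->|jk] := eqVneq j k.
      by under eq_fun do rewrite upd_twice; exact: differentiable_cst.
    by under eq_fun do rewrite (upd_comm _ _ _ jk); exact: df.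
  - move=> B'; have [M' hM'] := bf (Num.max B' r); exists M' => x _ xB.
    apply: hM' => //; apply: cbounded_upd; last by rewrite zr le_max lexx orbT.
    by apply: cbounded_le xB; rewrite le_max lexx.
  - move=> x y xy; apply: dep => j; rewrite inE /upd; case: eqVneq => //= _; exact: xy.
move=> x _ xB; rewrite absCB -{3}(updE x k); apply: le_trans hm.
have xk : absC (x k) <= `|B| by apply: le_trans (xB k) (ler_norm _).
apply: (taylor_interpolation (g := fun l => f (upd x k l))) => //.
  move=> z zr; apply: hM => //; apply: cbounded_upd => //; apply: cbounded_le xB.
  by rewrite /r; have := ler_norm B; have := normr_ge0 B; lra.
by rewrite /r; lra.
Qed.

End PolynomialApproximation.

(** * Approximation on the quadric *)

Section Quadric.
Variables (R : realType) (n : nat).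
Local Notation C := R[i].
Local Notation K := (bool * 'I_n.+1)%type.
Implicit Types (x : K -> C) (f : (K -> C) -> C).

(** Points are functions on a flat index type, [true] for p and [false] for q, so that single
    coordinates can be updated uniformly. *)
Definition pc (i : 'I_n.+1) : K := (true, i).
Definition qc (i : 'I_n.+1) : K := (false, i).

Definition quad x : C := 1 + \sum_(i < n.+1 | i != ord0) x (pc i) * x (qc i).

Definition Zfun : set (K -> C) := [set x | x (pc ord0) * x (qc ord0) = quad x].

Lemma polyfun_quad : polyfun quad.
Proof.
apply: polyfunD; first exact: polyfun_cst.
under eq_fun do rewrite big_mkcond /=.
apply: polyfun_sum => i; have [_|_] := boolP (i != ord0); last exact: polyfun_cst.
by apply: polyfunM; exact: polyfun_coord.
Qed.

Lemma exists_diag x : Zfun x -> exists i, x (pc i) * x (qc i) != 0.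
Proof.
move=> Sx; apply/not_existsP => h; have {}h j : x (pc j) * x (qc j) = 0.
  by apply/eqP; apply: contra_notT (h j).
have := Sx; rewrite /Zfun /quad /= h big1 // addr0 => /esym/eqP.
by rewrite oner_eq0.
Qed.

Definition upd2 x (z w : C) := upd (upd x (pc ord0) z) (qc ord0) w.

Lemma upd2E x : upd2 x (x (pc ord0)) (x (qc ord0)) = x.
Proof. by rewrite /upd2 updE -{2}(updE x (qc ord0)) updE. Qed.

Lemma quad_upd2 x z w : quad (upd2 x z w) = quad x.
Proof.
congr (_ + _); apply: eq_bigr => i i0.
by rewrite /upd2 /upd /pc /qc !xpair_eqE /= (negPf i0).
Qed.

Lemma upd2_Zfun x z w : Zfun (upd2 x z w) <-> z * w = quad x.
Proof. by rewrite /Zfun /= quad_upd2 /upd2 /upd /pc /qc !xpair_eqE /= ?eqxx. Qed.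

(** Holomorphy tested along curves that stay in the quadric near [z]. It applies directly to the
    hyperbolas, torus orbits and lines used below, and it is stable under sums, products and
    [tau]. *)
Definition curve_hol f := forall (gam : C -> K -> C) (z : C),
  (\forall l \near z, Zfun (gam l)) ->
  (forall k, differentiable (fun l => gam l k) z) ->
  differentiable (fun l => f (gam l)) z.

Lemma nearC (z : C) (P : C -> Prop) : (forall l, P l) -> \forall l \near z, P l.
Proof. by move=> Pl; apply/nbhsCP; exists 1. Qed.

Lemma differentiable_upd2 (gam : C -> K -> C) (a b : C -> C) z k :
  (forall j, differentiable (fun l => gam l j) z) ->
  differentiable a z -> differentiable b z ->
  differentiable (fun l => upd2 (gam l) (a l) (b l) k) z.
Proof.
move=> dg da db; rewrite /upd2 /upd; have [_|_] := eqVneq k (qc ord0) => //.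
have [_|_] := eqVneq k (pc ord0) => //; exact: dg.
Qed.

Lemma cbounded_upd2 (B : R) x z w : cbounded B x -> absC z <= B -> absC w <= B ->
  cbounded B (upd2 x z w).
Proof. by move=> xB zB wB; do 2 apply: cbounded_upd => //. Qed.

Lemma differentiable_invC (z : C) : z != 0 -> differentiable (fun l : C => l^-1) z.
Proof. by move=> z0; exact: differentiable_Rinv. Qed.

(* Interpolating in p_0 along the hyperbola p_0 q_0 = quad x leaves f at points whose
   p_0, q_0 are polynomials in the remaining coordinates; there f is entire. *)
Theorem polyapprox_quadric f : curve_hol f -> bounded_on Zfun f -> polyapprox Zfun f.
Proof.
move=> hf bf; apply: polyapprox_lim => B e e0.
pose r := 2 * `|B| + 1; have r0 : 0 < r by rewrite /r; have := normr_ge0 B; lra.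
have [M hM] := bf (2 * r).
have [m hm] := pow2_small (24 * M) e0.
(* Since a x * b x = quad x for every [x], the updated point lies in the quadric even if [x] does
   not: the composite is entire on the whole coordinate space. *)
have sect (z : C) (a b : (K -> C) -> C) : polyfun a -> polyfun b ->
    (forall x, a x * b x = quad x) -> polyapprox Zfun (fun x => f (upd2 x (a x) (b x))).
  move=> pa pb ab; apply: polyapprox_sub; apply: polyapprox_entire.
    move=> x k w; apply: hf.
      by apply: nearC => l; apply/upd2_Zfun.
    have du i : differentiable (fun l => upd x k l i) w by exact: differentiable_upd.
    move=> j; apply: (differentiable_upd2 j du).
      exact: (polyfun_curve pa).
    exact: (polyfun_curve pb).
  move=> B'; have [Ma hMa] := polyfun_bounded pa B'; have [Mb hMb] := polyfun_bounded pb B'.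
  have [M' hM'] := bf (Num.max B' (Num.max Ma Mb)); exists M' => x _ xB.
  apply: hM'; first exact/upd2_Zfun.
  apply: cbounded_upd2; first by apply: cbounded_le xB; rewrite le_max lexx.
    by apply: le_trans (hMa x I xB) _; rewrite !le_max lexx !orbT.
  by apply: le_trans (hMb x I xB) _; rewrite !le_max lexx !orbT.
exists (fun x => hyp_interp r m (fun z w => f (upd2 x z w)) (quad x) (x (pc ord0)) (x (qc ord0))).
  apply: polyapproxD; apply: polyapprox_avg => // z zr; apply: polyapproxM.
  - by apply: polyfun_geo; exact: polyfun_coord.
  - apply: (sect z (fun=> z) (fun x => quad x / z)); first exact: polyfun_cst.
      by apply: polyfunM; [exact: polyfun_quad|exact: polyfun_cst].
    by move=> x; field; rewrite -absC_gt0 zr.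
  - apply: polyfunD; last exact: polyfun_cst.
    by apply: polyfun_geo; exact: polyfun_coord.
  - apply: (sect z (fun x => quad x / z) (fun=> z)); last first.
    + by move=> x; field; rewrite -absC_gt0 zr.
    + exact: polyfun_cst.
    by apply: polyfunM; [exact: polyfun_quad|exact: polyfun_cst].
move=> x Sx xB; rewrite absCB; apply: le_trans hm.
rewrite -[in X in absC (_ - X)](upd2E x).
have xk k : 2 * absC (x k) <= r.
  have : absC (x k) <= `|B| by apply: le_trans (xB k) (ler_norm _).
  by rewrite /r; lra.
have Bb : B <= 2 * r by rewrite /r; have := ler_norm B; have := normr_ge0 B; lra.
apply: (hyp_interpolation (F := fun z w => f (upd2 x z w))) => //.
- move=> s0 z z0; apply: hf.
    have : nbhs z [set l : C | l != 0].
      apply/nbhsCP; exists (absC z) => [|w]; first by rewrite absC_gt0.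
      by apply: contraTneq => ->; rewrite sub0r absCN ltxx.
    by apply: filterS => l l0; apply/upd2_Zfun; field.
  move=> k; apply: (@differentiable_upd2 (fun=> x)) => [j||]; first exact: differentiable_cst.
    exact: differentiable_idC.
  exact: (differentiableM (differentiable_cst _ _) (differentiable_invC z0)).
- move=> s0 z; apply: hf; first by apply: nearC => l; apply/upd2_Zfun; rewrite mulr0.
  by move=> k; apply: (@differentiable_upd2 (fun=> x)) => [j||]; [exact: differentiable_cst|exact: differentiable_idC|exact: differentiable_cst].
- move=> s0 z; apply: hf; first by apply: nearC => l; apply/upd2_Zfun; rewrite mul0r.
  by move=> k; apply: (@differentiable_upd2 (fun=> x)) => [j||]; [exact: differentiable_cst|exact: differentiable_cst|exact: differentiable_idC].
- move=> z w zw zr wr; apply: hM; first exact/upd2_Zfun.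
  by apply: cbounded_upd2 => //; exact: cbounded_le xB.
Qed.

End Quadric.

(** * Invariant polynomials and averaging over roots of unity *)

Section Averaging.
Variables (R : realType) (n : nat).
Local Notation C := R[i].
Local Notation K := (bool * 'I_n.+1)%type.
Implicit Types (x : K -> C) (f Q : (K -> C) -> C).

Inductive invpoly : ((K -> C) -> C) -> Prop :=
| invpoly_cst c : invpoly (fun=> c)
| invpoly_coord i j : invpoly (fun x => x (pc i) * x (qc j))
| invpolyD f g : invpoly f -> invpoly g -> invpoly (fun x => f x + g x)
| invpolyM f g : invpoly f -> invpoly g -> invpoly (fun x => f x * g x).

(** One factor for each index i. For nonzero factors this keeps every p^i q^i, hence the quadric;
    the action defining hat D_n is its diagonal [act]. *)
Definition tor (z : 'I_n.+1 -> C) x : K -> C :=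
  fun k => if k.1 then z k.2 * x k else (z k.2)^-1 * x k.

Definition act (z : C) x : K -> C := tor (fun=> z) x.

Lemma tor_Zfun z x : (forall i, z i != 0) -> Zfun x -> Zfun (tor z x).
Proof.
move=> z0; have E i : tor z x (pc i) * tor z x (qc i) = x (pc i) * x (qc i).
  by rewrite /tor /=; field.
by rewrite /Zfun /= E => ->; congr (_ + _); apply: eq_bigr => i _; rewrite E.
Qed.

Lemma invpoly_polyfun f : invpoly f -> polyfun f.
Proof.
elim=> [c|i j|{}f g _ pf _ pg|{}f g _ pf _ pg].
- exact: polyfun_cst.
- by apply: polyfunM; exact: polyfun_coord.
- exact: polyfunD.
- exact: polyfunM.
Qed.

Lemma invpoly_act f z x : invpoly f -> z != 0 -> f (act z x) = f x.
Proof.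
move=> pf z0; elim: pf => [//|i j|{}f g _ IHf _ IHg|{}f g _ IHf _ IHg].
- by rewrite /act /tor /=; field.
- by rewrite IHf IHg.
- by rewrite IHf IHg.
Qed.

Lemma invpoly_sum I (r : seq I) (F : I -> (K -> C) -> C) :
  (forall i, invpoly (F i)) -> invpoly (fun x => \sum_(i <- r) F i x).
Proof.
move=> pF; elim: r => [|i r IH].
  by under eq_fun do rewrite big_nil; exact: invpoly_cst.
by under eq_fun do rewrite big_cons; exact: invpolyD.
Qed.

(** Encoded by index lists, so that the weight under [act] is the difference of their lengths. *)
Definition mono (I J : seq 'I_n.+1) x : C :=
  (\prod_(i <- I) x (pc i)) * \prod_(j <- J) x (qc j).

Lemma polyfun_mono Q : polyfun Q ->
  exists L : seq (C * (seq 'I_n.+1 * seq 'I_n.+1)),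
    forall x, Q x = \sum_(t <- L) t.1 * mono t.2.1 t.2.2 x.
Proof.
elim=> [c|[[] i]|f g _ [L1 h1] _ [L2 h2]|f g _ [L1 h1] _ [L2 h2]].
- by exists [:: (c, ([::], [::]))] => x; rewrite big_seq1 /mono !big_nil /= !mulr1.
- by exists [:: (1, ([:: i], [::]))] => x; rewrite big_seq1 /mono big_seq1 big_nil mulr1 mul1r.
- by exists [:: (1, ([::], [:: i]))] => x; rewrite big_seq1 /mono big_seq1 big_nil !mul1r.
- by exists (L1 ++ L2) => x; rewrite big_cat h1 h2.
exists [seq (t.1 * u.1, (t.2.1 ++ u.2.1, t.2.2 ++ u.2.2)) | t <- L1, u <- L2] => x.
rewrite h1 h2 big_allpairs_dep mulr_suml; apply: eq_bigr => t _.
by rewrite mulr_sumr; apply: eq_bigr => u _; rewrite /mono /= !big_cat /=; ring.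
Qed.

Lemma mono_act I J z x : mono I J (act z x) = z ^+ size I * z^-1 ^+ size J * mono I J x.
Proof.
rewrite /mono /act /tor /= !big_split /= !big_const_seq !count_predT.
by rewrite !iter_mulr_1; ring.
Qed.

Lemma invpoly_mono I J : size I = size J -> invpoly (mono I J).
Proof.
elim: I J => [|i I IH] [|j J] //= IJ.
  by rewrite (_ : mono _ _ = fun=> 1); [exact: invpoly_cst|apply/funext => x; rewrite /mono !big_nil mulr1].
have -> : mono (i :: I) (j :: J) = (fun x => (x (pc i) * x (qc j)) * mono I J x).
  by apply/funext => x; rewrite /mono !big_cons; ring.
by apply: invpolyM; [exact: invpoly_coord|apply: IH; case: IJ].
Qed.

(** Averaging keeps exactly the monomials of weight 0, which pair up into products p^i q^j. Taking N
    above all total degrees keeps nonzero weights from being multiples of N. *)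
Lemma invpoly_avg Q : polyfun Q -> exists2 N : nat, (0 < N)%N &
  invpoly (fun x => avg 1 N (fun z => Q (act z x))).
Proof.
move=> /polyfun_mono[L hL].
pose N := (\max_(t <- L) (size t.2.1 + size t.2.2)).+1.
exists N => //.
have -> : (fun x => avg 1 N (fun z => Q (act z x))) =
    (fun x => \sum_(t <- L) t.1 * ((size t.2.1 == size t.2.2)%:R * mono t.2.1 t.2.2 x)).
  apply/funext => x.
  transitivity (avg 1 N (fun z => \sum_(t <- L) (t.1 * mono t.2.1 t.2.2 x) *
      z ^ ((size t.2.1)%:Z - (size t.2.2)%:Z))).
    apply: eq_avg => // z z1; rewrite hL; apply: eq_bigr => t _.
    have z0 : z != 0 by rewrite -absC_gt0 z1.
    by rewrite mono_act expfzDr // -exprnN -exprnP exprVn; ring.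
  rewrite /avg exchange_big mulr_sumr big_seq [RHS]big_seq; apply: eq_bigr => t tL.
  rewrite -mulr_sumr mulrCA -/(avg 1 N (fun z => z ^ _)) avg_mono //.
    by rewrite subr_eq0 eqz_nat; ring.
  have tN : (size t.2.1 + size t.2.2 < N)%N.
    by rewrite ltnS; exact: (leq_bigmax_seq t tL isT).
  by apply: leq_ltn_trans tN; clear; move: (size _) (size _) => a b; lia.
apply: invpoly_sum => t; apply: invpolyM; first exact: invpoly_cst.
have [e|_] := eqVneq (size t.2.1) (size t.2.2).
  by apply: invpolyM; [exact: invpoly_cst|exact: invpoly_mono].
by under eq_fun do rewrite mul0r; exact: invpoly_cst.
Qed.

(** Averaging fixes the invariant [f], and the nodes have modulus 1, so orbit points obey the same
    coordinate bounds and the error does not grow. *)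
Theorem invpoly_approx f : polyapprox (@Zfun R n) f ->
  (forall z x, z != 0 -> Zfun x -> f (act z x) = f x) ->
  forall B e : R, 0 < e -> exists2 P, invpoly P &
    forall x, Zfun x -> cbounded B x -> absC (f x - P x) <= e.
Proof.
move=> paf invf B e e0; have [Q pQ hQ] := paf B e e0.
have [N N0 pN] := invpoly_avg pQ.
exists (fun x => avg 1 N (fun z => Q (act z x))) => // x Sx xB.
have NC : (N%:R : C) != 0 by rewrite pnatr_eq0 -lt0n.
have -> : f x - avg 1 N (fun z => Q (act z x)) =
    avg 1 N (fun z => f (act z x) + (-1) * Q (act z x)).
  rewrite avgD avgZ mulN1r; congr (_ - _).
  transitivity (avg 1 N (fun=> f x)).
    by rewrite /avg sumr_const card_ord -[f x *+ N]mulr_natl mulKf.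
  by apply: eq_avg => // z z1; rewrite invf // -absC_gt0 z1.
apply: avg_bound => // z z1; rewrite mulN1r.
have z0 : z != 0 by rewrite -absC_gt0 z1.
apply: hQ; first exact: tor_Zfun.
by move=> k; rewrite /act /tor; case: ifP => _; rewrite absCM ?absCV z1 ?invr1 mul1r.
Qed.

End Averaging.

(** * Holomorphic functions are determined by their real points *)

Section Uniqueness.
Variables (R : realType) (n : nat).
Local Notation C := R[i].
Local Notation K := (bool * 'I_n.+1)%type.
Implicit Types (x : K -> C) (f : (K -> C) -> C) (z w s : 'I_n.+1 -> C).

Definition Zreal x : Prop := Zfun x /\ forall i, x (qc i) = (x (pc i))^*.

Definition updI z (i : 'I_n.+1) (l : C) : 'I_n.+1 -> C := fun j => if j == i then l else z j.

Lemma updIE z i : updI z i (z i) = z.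
Proof. by apply/funext => j; rewrite /updI; case: eqVneq => [->|]. Qed.

Lemma differentiable_updI z i l0 j : differentiable (fun l => updI z i l j) l0.
Proof.
rewrite /updI; have [_|_] := eqVneq j i; first exact: differentiable_idC.
exact: differentiable_cst.
Qed.

Lemma near_neq0 (z : C) : z != 0 -> \forall l \near z, l != 0.
Proof.
move=> z0; apply/nbhsCP; exists (absC z) => [|w]; first by rewrite absC_gt0.
by apply: contraTneq => ->; rewrite sub0r absCN ltxx.
Qed.

Lemma tor_unit_Zreal z x : Zreal x -> (forall i, absC (z i) = 1) -> Zreal (tor z x).
Proof.
move=> [Sx rx] z1; have z0 i : z i != 0 by rewrite -absC_gt0 z1.
split => [|i]; first exact: tor_Zfun.
rewrite /tor /= rx rmorphM /=; congr (_ * _).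
apply: (mulIf (z0 i)); rewrite mulVf // mulrC -normCK normr_absC z1.
by rewrite expr1n.
Qed.

(* Zreal is stable under the compact torus, so each l |-> f(.., l p_i, q_i / l, ..) vanishes
   on the unit circle. *)
Lemma vanish_torus f x z : curve_hol f -> (forall y, Zreal y -> f y = 0) -> Zreal x ->
  (forall i, z i != 0) -> f (tor z x) = 0.
Proof.
move=> hf f0 rx z0.
(* Here [l] lists the indices whose factor need not have modulus 1. *)
suff gen (l : seq 'I_n.+1) : forall z, (forall i, z i != 0) ->
    (forall i, i \notin l -> absC (z i) = 1) -> f (tor z x) = 0.
  by apply: (gen (enum 'I_n.+1)) => // i; rewrite mem_enum.
elim: l => [|i l IH] {}z {}z0 z1.
  by apply: f0; apply: tor_unit_Zreal => // i; exact: z1.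
have u0 u j : u != 0 -> updI z i u j != 0 by rewrite /updI; case: ifP.
rewrite -(updIE z i).
apply: (@vanish_circle _ (fun u => f (tor (updI z i u) x))) => // [u un0|u u1].
  apply: hf.
    apply: filterS (near_neq0 un0) => v v0; apply: tor_Zfun; last by case: rx.
    by move=> j; exact: u0.
  case=> -[] j; rewrite /tor /=.
    by apply: differentiableM; [exact: differentiable_updI|exact: differentiable_cst].
  have d1 : differentiable (fun l => (updI z i l j)^-1) u.
    apply: differentiableV; last exact: u0.
    exact: differentiable_updI.
  exact: (differentiableM d1 (differentiable_cst _ _)).
apply: IH => [j|j jl]; first by apply: u0; rewrite -absC_gt0 u1.
rewrite /updI; case: eqVneq => // ji; apply: z1.
by rewrite inE (negPf ji).
Qed.

(** Inverse chart of the open set where all p^i are nonzero: [w] is p, and [s] gives the products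
    p^i q^i for i <> 0. The entry of [s] at [ord0] is ignored, because the quadric determines p^0
    q^0. *)
Definition section_pt w s : K -> C :=
  fun k => if k.1 then w k.2 else
    (if k.2 == ord0 then 1 + \sum_(i < n.+1 | i != ord0) s i else s k.2) / w k.2.

Lemma section_pt_Zfun w s : (forall i, w i != 0) -> Zfun (section_pt w s).
Proof.
move=> w0; rewrite /Zfun /quad /section_pt /= mulrCA mulfV // mulr1; congr (_ + _).
by apply: eq_bigr => i /negPf ->; rewrite mulrCA mulfV // mulr1.
Qed.

Lemma section_ptE x : Zfun x -> (forall i, x (pc i) != 0) ->
  x = section_pt (fun i => x (pc i)) (fun i => x (pc i) * x (qc i)).
Proof.
move=> Sx p0; apply/funext => -[[] i]; rewrite /section_pt //=.
by case: eqVneq => [->|_]; rewrite -?[1 + _]Sx mulrAC mulfV ?mul1r.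
Qed.

(** Positive products are realised by the real point with p^i = q^i = sqrt(t i), and the given point
    is its torus translate by the factors w i / r i. *)
Lemma vanish_section_pos f w s : curve_hol f -> (forall y, Zreal y -> f y = 0) ->
  (forall i, w i != 0) -> (forall i, i != ord0 -> exists2 t : R, 0 < t & s i = t%:C%C) ->
  f (section_pt w s) = 0.
Proof.
move=> hf f0 w0 spos.
pose t i := if i == ord0 then 1 + \sum_(j < n.+1 | j != ord0) complex.Re (s j) else complex.Re (s i).
have tp i : i != ord0 -> s i = (complex.Re (s i))%:C%C /\ 0 < complex.Re (s i).
  by move=> /spos[u u0 ->].
have t0 i : 0 < t i.
  rewrite /t; case: eqVneq => [_|/tp[]//].
  by rewrite ltr_pwDl // sumr_ge0 // => j /tp[_ /ltW].
pose r i : C := (Num.sqrt (t i))%:C%C.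
have r0 i : r i != 0 by rewrite -absC_gt0 absC_real normr_gt0 gt_eqF // sqrtr_gt0.
have rr i : r i * r i = (t i)%:C%C by rewrite -rmorphM -expr2 sqr_sqrtr // ltW.
have tE i : (t i)%:C%C = if i == ord0 then 1 + \sum_(j < n.+1 | j != ord0) s j else s i.
  rewrite /t; case: eqVneq => [_|/tp[<- //]].
  rewrite rmorphD rmorph1 rmorph_sum; congr (_ + _).
  by apply: eq_bigr => j /tp[e _]; rewrite [RHS]e.
pose x : K -> C := fun k => r k.2.
have rx : Zreal x.
  split => [|i]; last by rewrite /x /= /r conj_Creal // complex_real.
  rewrite /Zfun /quad /x /= rr tE eqxx; congr (_ + _); apply: eq_bigr => i i0.
  by rewrite rr tE (negPf i0).
have -> : section_pt w s = tor (fun i => w i / r i) x.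
  apply/funext => -[[] i]; rewrite /section_pt /tor /x /=; first by rewrite divfK.
  by rewrite -tE -rr; field; rewrite w0 r0.
by apply: vanish_torus => // i; rewrite mulf_neq0 // invr_eq0.
Qed.

(* f o section_pt w is entire in s and vanishes when all s_i are positive. *)
Lemma vanish_section f w s : curve_hol f -> (forall y, Zreal y -> f y = 0) ->
  (forall i, w i != 0) -> f (section_pt w s) = 0.
Proof.
move=> hf f0 w0.
suff gen (l : seq 'I_n.+1) : forall s, (forall i, i \notin l -> i != ord0 ->
    exists2 t : R, 0 < t & s i = t%:C%C) -> f (section_pt w s) = 0.
  by apply: (gen (enum 'I_n.+1)) => // i; rewrite mem_enum.
elim: l => [|i l IH] {}s spos; first by apply: vanish_section_pos => // i; exact: spos.
rewrite -(updIE s i).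
apply: (@vanish_pos _ (fun u => f (section_pt w (updI s i u)))) => [u|t t0].
  apply: hf; first by apply: nearC => v; exact: section_pt_Zfun.
  case=> -[] j; rewrite /section_pt /=; first exact: differentiable_cst.
  suff d : differentiable (fun l => if j == ord0 then 1 + \sum_(k < n.+1 | k != ord0) updI s i l k
      else updI s i l j) u by exact: (differentiableM d (differentiable_cst _ _)).
  have [_|_] := eqVneq j ord0; last exact: differentiable_updI.
  apply: (differentiableD (differentiable_cst _ _)).
  under eq_fun do rewrite big_mkcond /=.
  have -> : (fun l => \sum_(k < n.+1) (if k != ord0 then updI s i l k else 0)) =
     \sum_(k < n.+1) (fun l => if k != ord0 then updI s i l k else 0).
    by apply/funext => v; rewrite fct_sumE.
  apply: differentiable_sum => k; have [_|_] := boolP (k != ord0); last exact: differentiable_cst.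
  exact: differentiable_updI.
apply: IH => j jl j0; rewrite /updI; case: eqVneq => [_|ji]; first by exists t.
by apply: spos => //; rewrite inE (negPf ji).
Qed.

Theorem uniqueness f : curve_hol f -> (forall y, Zreal y -> f y = 0) ->
  forall x, Zfun x -> f x = 0.
Proof.
move=> hf f0 x Sx.
have gen y : Zfun y -> (forall i, y (pc i) != 0) -> f y = 0.
  by move=> Sy y0; rewrite (section_ptE Sy y0); exact: vanish_section.
have [j pqj] := exists_diag Sx.
have [pj qj] : x (pc j) != 0 /\ x (qc j) != 0.
  by move: pqj; rewrite mulf_eq0 negb_or => /andP[].
pose eps (i : 'I_n.+1) : C := if i == ord0 then 1 else -1.
have eps0 i : eps i != 0 by rewrite /eps; case: ifP; rewrite ?oppr_eq0 oner_eq0.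
have SE y : Zfun y <-> \sum_i eps i * (y (pc i) * y (qc i)) = 1.
  rewrite (bigD1 ord0) //= {1}/eps eqxx mul1r /Zfun /quad /=.
  have -> : \sum_(i < n.+1 | i != ord0) eps i * (y (pc i) * y (qc i)) =
      - \sum_(i < n.+1 | i != ord0) y (pc i) * y (qc i).
    rewrite -sumrN; apply: eq_bigr => i /negPf i0; by rewrite /eps i0 mulN1r.
  by split=> [->|h]; [rewrite addrK|apply/eqP; rewrite -subr_eq; apply/eqP].
(* For fixed q the quadric is affine in p, so a direction [u] with zero sum of eps_i u_i q^i stays
   in it. Such a [u] is 1 where p^i vanishes, and its entry at [j] is solved from this equation, as
   q^j <> 0. *)
pose v i : C := (x (pc i) == 0)%:R.
pose A := \sum_(i < n.+1 | i != j) eps i * (v i * x (qc i)).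
pose u i := if i == j then - A / (eps j * x (qc j)) else v i.
have uq : \sum_i eps i * (u i * x (qc i)) = 0.
  rewrite (bigD1 j) //= {1}/u eqxx.
  have -> : \sum_(i < n.+1 | i != j) eps i * (u i * x (qc i)) = A.
    by apply: eq_bigr => i /negPf ij; rewrite /u ij.
  by field; rewrite eps0 qj.
(* A line in the quadric through x on which all p_i become nonzero. *)
pose gam (l : C) : K -> C := fun k => if k.1 then x k + l * u k.2 else x k.
have Sg l : Zfun (gam l).
  apply/SE; have {}Sx := (SE x).1 Sx.
  have -> : \sum_i eps i * (gam l (pc i) * gam l (qc i)) =
     \sum_i eps i * (x (pc i) * x (qc i)) + l * \sum_i eps i * (u i * x (qc i)).
    by rewrite mulr_sumr -big_split; apply: eq_bigr => i _; rewrite /gam /=; ring.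
  by rewrite uq mulr0 addr0.
have dg : differentiable (fun l => f (gam l)) 0.
  apply: hf; first by apply: nearC.
  case=> -[] i; rewrite /gam /=; last exact: differentiable_cst.
  apply: (differentiableD (differentiable_cst _ _)).
  exact: (differentiableM (differentiable_idC _) (differentiable_cst _ _)).
have near0 : \forall l \near (0 : C), l != 0 -> f (gam l) = 0.
  have : \forall l \near (0 : C), forall i, l != 0 -> gam l (pc i) != 0.
    apply: (@filter_forall _ _ (fun i l => l != 0 -> gam l (pc i) != 0) _ (nbhs_filter (0 : C))) => i.
    rewrite /gam /=.
    have [pi0|pi0] := eqVneq (x (pc i)) 0.
      have ij : i != j by apply: contraNneq pj => <-; apply/eqP.
      apply: nearC => l l0.
      by rewrite /u (negPf ij) /v pi0 eqxx add0r mulr1.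
    have a0 : 0 < absC (x (pc i)) by rewrite absC_gt0.
    have u1 : 0 < absC (u i) + 1 by have := absC_ge0 (u i); lra.
    apply/nbhsCP; exists (absC (x (pc i)) / (absC (u i) + 1)); first by rewrite divr_gt0.
    move=> l; rewrite subr0 ltr_pdivlMr // => h _; rewrite addr_eq0.
    apply: contraTneq h => ->; rewrite absCN absCM -leNgt ler_wpM2l ?absC_ge0 //.
    by have := absC_ge0 (u i); lra.
  by apply: filterS => l h l0; apply: gen => // i; exact: h.
have -> : x = gam 0 by apply/funext => -[[] i]; rewrite /gam //= mul0r addr0.
have /continuousCP c0 := differentiable_continuous dg.
have /nbhsCP[d d0 hd] := near0.
apply/eqP; rewrite -absC_eq0 eq_le absC_ge0 andbT; apply/ler_addgt0Pl => e e0; rewrite addr0.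
have [t t0 ht] := c0 e e0.
pose l : R := Num.min d t / 2.
have l0 : 0 < l by rewrite divr_gt0 // lt_min d0.
have al : absC ((l%:C)%C - 0) = l by rewrite subr0 absC_real ger0_norm // ltW.
have ld : l < d.
  have : Num.min d t <= d by rewrite ge_min lexx.
  rewrite /l in l0 *; lra.
have lt : l < t.
  have : Num.min d t <= t by rewrite ge_min lexx orbT.
  rewrite /l in l0 *; lra.
have f1 : f (gam (l%:C)%C) = 0.
  by apply: hd; rewrite ?al // -absC_gt0 -[_%:C%C]subr0 al.
by have := ht (l%:C)%C; rewrite al f1 sub0r absCN => /(_ lt)/ltW.
Qed.

End Uniqueness.

(** * Holomorphic functions on the quotient *)

Section Link.
Local Open Scope quotient_scope.
Variables (R : realType) (n : nat).
Local Notation C := R[i].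
Local Notation K := (bool * 'I_n.+1)%type.
Local Notation V := 'rV[C]_(n.+1).
Local Notation W := (V * V)%type.
Local Notation Zh := (set_type (@Zhat R n)).
Local Notation Dh := (Dhat R n).
Implicit Types (x : K -> C) (w : W) (a b : Dh -> C).

Definition coW w : K -> C := fun k => if k.1 then w.1 0 k.2 else w.2 0 k.2.
Definition mkW x : W := (\row_i x (pc i), \row_i x (qc i)).

Lemma coWK w : mkW (coW w) = w.
Proof. by case: w => p q; congr (_, _); apply/rowP => i; rewrite mxE. Qed.

Lemma mkWK x : coW (mkW x) = x.
Proof. by apply/funext => -[[] i]; rewrite /coW /= mxE. Qed.

Lemma Zhat_coW w : Zhat w <-> Zfun (coW w).
Proof.
rewrite /Zhat /Zfun /quad /bil /coW /=.
set S := \sum_(_ < _ | _) _; set u := _ * _.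
split=> h; first by rewrite -[1]opprK -h opprD opprK addrNK.
by rewrite h opprD addrNK.
Qed.

Lemma Zhat_mkW x : Zfun x -> Zhat (mkW x).
Proof. by move=> h; apply/Zhat_coW; rewrite mkWK. Qed.

Definition mkZ x (Sx : Zfun x) : Zh := SigSub (mem_set (Zhat_mkW Sx)).

Lemma val_mkZ x (Sx : Zfun x) : val (mkZ Sx) = mkW x.
Proof. by []. Qed.

Lemma Zfun_val (z : Zh) : Zfun (coW (val z)).
Proof. exact/Zhat_coW/set_valP. Qed.

Lemma mkZE (z : Zh) : z = mkZ (Zfun_val z).
Proof. by apply: val_inj; rewrite val_mkZ coWK. Qed.

Lemma eq_mkZ x y (Sx : Zfun x) (Sy : Zfun y) : x = y -> mkZ Sx = mkZ Sy.
Proof. by move=> xy; apply: val_inj; rewrite !val_mkZ xy. Qed.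

Lemma piDhatP (y z : Zh) : piDhat y = piDhat z <->
  exists2 l : C, l != 0 & coW (val z) = act l (coW (val y)).
Proof.
have -> : piDhat y = piDhat z <-> relDhat y z.
  split; first by move/eqquotP.
  by move=> h; apply/eqquotP.
split.
  move=> /asboolP[l [l0 [e1 e2]]]; exists l => //.
  by apply/funext => -[[] i]; rewrite /coW /act /tor /= ?e1 ?e2 mxE.
move=> [l l0 e]; apply/asboolP; exists l; split => //; split; apply/rowP => i; rewrite mxE.
  by have := congr1 (@^~ (pc i)) e.
by have := congr1 (@^~ (qc i)) e.
Qed.

Lemma Dhat_surj (d : Dh) : exists x, exists Sx : Zfun x, d = piDhat (mkZ Sx).
Proof.
exists (coW (val (repr d))), (Zfun_val _); rewrite -mkZE.
by rewrite /piDhat reprK.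
Qed.

(** The default 0 off the quadric is invisible to [curve_hol], and to [bounded_on] and [polyapprox]
    over [Zfun]. *)
Definition lift a x : C :=
  match pselect (Zfun x) with left Sx => a (piDhat (mkZ Sx)) | right _ => 0 end.

Lemma liftE a x (Sx : Zfun x) : lift a x = a (piDhat (mkZ Sx)).
Proof.
by rewrite /lift; case: pselect => [Sx'|//]; congr (a (piDhat _)); exact: eq_mkZ.
Qed.

Lemma lift_act a z x : z != 0 -> Zfun x -> lift a (act z x) = lift a x.
Proof.
move=> z0 Sx; have Sz : Zfun (act z x) by exact: tor_Zfun.
rewrite (liftE _ Sz) (liftE _ Sx); congr a; apply/esym/piDhatP.
by exists z => //; rewrite !val_mkZ !mkWK.
Qed.

Lemma differentiable_coW w k : differentiable (fun v : W => coW v k) w.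
Proof.
case: k => -[] i; rewrite /coW /=.
  apply: (@differentiable_comp C W V C (fst : W -> V) (fun v : V => v 0 i)).
    apply: (@linear_differentiable C W V (fst : {linear W -> V})).
    by move=> v; exact: cvg_fst.
  exact: differentiable_coord.
apply: (@differentiable_comp C W V C (snd : W -> V) (fun v : V => v 0 i)).
  apply: (@linear_differentiable C W V (snd : {linear W -> V})).
  by move=> v; exact: cvg_snd.
exact: differentiable_coord.
Qed.

Lemma differentiable_row (g : C -> 'I_n.+1 -> C) z :
  (forall i, differentiable (fun l => g l i) z) ->
  differentiable (fun l => \row_i g l i : V) z.
Proof.
move=> dg.
have -> : (fun l => \row_i g l i) = \sum_(i < n.+1) (fun l => g l i *: (delta_mx 0 i : V)).
  apply/funext => l; rewrite fct_sumE; apply/rowP => j.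
  rewrite mxE summxE (bigD1 j) //= !mxE !eqxx mulr1 big1 ?addr0 // => i ij.
  by rewrite !mxE eq_sym (negPf ij) andbF mulr0.
by apply: differentiable_sum => i; apply: differentiableZl; exact: dg.
Qed.

Lemma differentiable_mkW (gam : C -> K -> C) z :
  (forall k, differentiable (fun l => gam l k) z) ->
  differentiable (fun l => mkW (gam l)) z.
Proof.
move=> dg; have d1 := @differentiable_row (fun l i => gam l (pc i)) z (fun i => dg (pc i)).
have d2 := @differentiable_row (fun l i => gam l (qc i)) z (fun i => dg (qc i)).
exact: differentiable_pair d1 d2.
Qed.

Lemma holomorphic_curve a : holomorphic_Dhat a -> curve_hol (lift a).
Proof.
move=> ha gam z Sgam dgam.
have S0 : Zfun (gam z) := nbhs_singleton Sgam.
have [U [oU Uz [g [dg gE]]]] := ha (mkZ S0).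
have dW := differentiable_mkW dgam.
have near_U : \forall l \near z, U (mkW (gam l)).
  by apply: (differentiable_continuous dW); exact: open_nbhs_nbhs.
have dcomp : differentiable (g \o (fun l => mkW (gam l))) z.
  by apply: differentiable_comp => //; exact: dg.
apply/derivable1_diffP; move/derivable1_diffP: dcomp.
apply: near_eq_derivable; apply: filterS2 Sgam near_U => l Sl Ul.
by rewrite (liftE _ Sl) -gE.
Qed.

Lemma holomorphic_continuous a : holomorphic_Dhat a -> continuous a.
Proof.
move=> ha; apply/(@quotient_continuous _ {eq_quot (@relDhat_equiv R n)} _) => z.
have [U [oU Uz [g [dg gE]]]] := ha z.
move=> A hA.
have hA' : nbhs (g (val z)) A by rewrite gE.
have h : nbhs (val z) (U `&` g @^-1` A).
  apply: filterI; first exact: open_nbhs_nbhs.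
  exact: (differentiable_continuous (dg _ Uz) hA').
have : nbhs z (val @^-1` (U `&` g @^-1` A)) := @initial_continuous _ _ (@set_val _ _) z _ h.
by apply: filterS => y /= [Uy gy]; rewrite /preimage /= -[\pi y]/(piDhat y) -gE.
Qed.

(** Squares instead of discs: they are images of products of real segments, hence compact, and
    contain the points with [cbounded B]. *)
Definition boxW (B : R) : set W :=
  let A := [set z : C | exists s t : R, [/\ -B <= s <= B, -B <= t <= B & z = cpt s t]] in
  [set v : V | forall i, A (v ord0 i)] `*` [set v : V | forall i, A (v ord0 i)].

Lemma compact_boxW B : compact (boxW B).
Proof.
have cA : compact [set z : C | exists s t : R,
    [/\ -B <= s <= B, -B <= t <= B & z = cpt s t]].
  have -> : [set z : C | exists s t : R, [/\ -B <= s <= B, -B <= t <= B & z = cpt s t]] =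
      (fun st : R * R => cpt st.1 st.2) @` (`[-B, B] `*` `[-B, B]).
    apply/seteqP; split => z /=.
      move=> [s [t [hs ht ->]]]; exists (s, t) => //=.
    by move=> [[s t] /=]; rewrite ?in_itv /= => -[hs ht] <-; exists s, t.
  have cs : compact (`[-B, B] `*` `[-B, B] : set (R * R)).
    exact: compact_setX (@segment_compact R _ _) (@segment_compact R _ _).
  apply: continuous_compact cs; apply: continuous_subspaceT.
  apply: (@continuous_ReIm R (R * R)%type (fun st => cpt st.1 st.2)).
    rewrite (_ : (fun t : R * R => _) = fst); last by apply/funext => t; rewrite Re_cpt.
    by move=> st; exact: cvg_fst.
  rewrite (_ : (fun t : R * R => _) = snd); last by apply/funext => t; rewrite Im_cpt.
  by move=> st; exact: cvg_snd.
have cV := @rV_compact C _ (fun=> _) (fun _ : 'I_n.+1 => cA).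
exact: (compact_setX cV cV).
Qed.

Lemma cbounded_boxW B x : cbounded B x -> boxW B (mkW x).
Proof.
move=> xB; split=> i /=; rewrite mxE.
  exists (complex.Re (x (pc i))), (complex.Im (x (pc i))); rewrite -!ler_norml -cptE; split => //.
    exact: le_trans (absC_Re _) (xB _).
  exact: le_trans (absC_Im _) (xB _).
exists (complex.Re (x (qc i))), (complex.Im (x (qc i))); rewrite -!ler_norml -cptE; split => //.
  exact: le_trans (absC_Re _) (xB _).
exact: le_trans (absC_Im _) (xB _).
Qed.

Lemma continuous_polyfun_coW (Q : (K -> C) -> C) : polyfun Q -> continuous (fun w => Q (coW w)).
Proof.
move=> pQ w; apply: differentiable_continuous; apply: (polyfun_curve pQ) => k.
exact: differentiable_coW.
Qed.

(** Near a point of the quadric the local extension bounds [lift a]; near any other point the claim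
    is vacuous, as the quadric is closed. Compactness of the box, with M tending to infinity, yields
    one bound. *)
Lemma holomorphic_bounded a : holomorphic_Dhat a -> bounded_on (@Zfun R n) (lift a).
Proof.
move=> ha B.
have /compact_near_coveringP := @compact_boxW B.
move=> /(_ R (+oo)%R (fun M w => Zfun (coW w) -> absC (lift a (coW w)) <= M)).
case.
  move=> w _; have [Sw|Sw] := pselect (Zfun (coW w)); last first.
    pose D (v : W) := coW v (pc ord0) * coW v (qc ord0) + (-1) * quad (coW v).
    have cD : continuous D.
      apply: (@continuous_polyfun_coW (fun x => x (pc ord0) * x (qc ord0) + (-1) * quad x)).
      apply: polyfunD; first by apply: polyfunM; exact: polyfun_coord.
      by apply: polyfunM; [exact: polyfun_cst|exact: polyfun_quad].
    have Dw : D w != 0.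
      by rewrite /D mulN1r subr_eq0; apply/eqP.
    have nD : nbhs w [set v | D v != 0] := cD w _ (near_neq0 Dw).
    exists ([set v | D v != 0], setT) => /=; first by split => //; exact: filterT.
    by move=> [v M] /= [Dv _] Sv; move: Dv; rewrite /D Sv mulN1r subrr eqxx.
  have [U [oU Uz [g [dg gE]]]] := ha (mkZ Sw).
  rewrite val_mkZ coWK in Uz.
  have cg := differentiable_continuous (dg _ Uz).
  have hA : nbhs (g w) [set y | absC (y - g w) < 1] by apply/nbhsCP; exists 1.
  have nU : nbhs w (U `&` [set v | absC (g v - g w) < 1]).
    by apply: filterI; [exact: open_nbhs_nbhs|exact: (cg _ hA)].
  exists (U `&` [set v | absC (g v - g w) < 1], [set M | absC (g w) + 1 < M]) => /=.
    by split => //; apply: nbhs_pinfty_gt; exact: num_real.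
  move=> [v M] /= [[Uv gv] hM] Sv; rewrite (liftE _ Sv) -gE ?val_mkZ coWK //.
  by have := absC_sub (g v) (g w); lra.
move=> M0 [_ hM]; exists (M0 + 1) => x Sx xB.
have := hM (M0 + 1) _ (mkW x) (cbounded_boxW xB); rewrite mkWK; apply => //.
by rewrite ltrDl.
Qed.

Definition inv_fun (P : (K -> C) -> C) : Dh -> C := fun d => P (coW (val (repr d))).

Lemma inv_funE P (z : Zh) : invpoly P -> inv_fun P (piDhat z) = P (coW (val z)).
Proof.
move=> pP; rewrite /inv_fun.
have /piDhatP[l l0 ->] : piDhat z = piDhat (repr (piDhat z)) by rewrite /piDhat reprK.
by rewrite invpoly_act.
Qed.

Lemma holomorphic_inv_fun P : invpoly P -> holomorphic_Dhat (inv_fun P).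
Proof.
move=> pP z; exists setT; split => //; first exact: openT.
exists (fun w => P (coW w)); split=> [w _|z' _]; last by rewrite inv_funE.
by apply: (polyfun_curve (invpoly_polyfun pP)) => k; exact: differentiable_coW.
Qed.

Lemma holomorphicB a b : holomorphic_Dhat a -> holomorphic_Dhat b ->
  holomorphic_Dhat (fun d => a d - b d).
Proof.
move=> ha hb z; have [U [oU Uz [f [df fE]]]] := ha z; have [U' [oU' Uz' [g [dg gE]]]] := hb z.
exists (U `&` U'); split => //; first exact: openI.
exists (fun w => f w - g w); split=> [w [Uw Uw']|z' [Uz1 Uz2]]; last by rewrite fE ?gE.
exact: (differentiableB (df _ Uw) (dg _ Uw')).
Qed.

End Link.

(** * Characters *)

Section Spectrum.
Local Open Scope quotient_scope.
Variables (R : realType) (n : nat).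
Local Notation C := R[i].
Local Notation K := (bool * 'I_n.+1)%type.
Local Notation Zh := (set_type (@Zhat R n)).
Local Notation Zt := (set_type (@Zset R n)).
Local Notation Dh := (Dhat R n).
Local Notation AD := (AD R n).
Implicit Types (x : K -> C) (F : Dh -> C) (a b c : AD) (phi : AD -> C).

Lemma curve_hol_ext (f g : (K -> C) -> C) :
  (forall x, Zfun x -> f x = g x) -> curve_hol f -> curve_hol g.
Proof.
move=> fg hf gam z Sgam dgam.
apply/derivable1_diffP; move/derivable1_diffP: (hf gam z Sgam dgam).
by apply: near_eq_derivable; apply: filterS Sgam => l Sl; exact: fg.
Qed.

Lemma curve_hol_lift F (f : (K -> C) -> C) :
  (forall x (Sx : Zfun x), F (piDhat (mkZ Sx)) = f x) -> curve_hol f -> curve_hol (lift F).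
Proof. by move=> Ff; apply: curve_hol_ext => x Sx; rewrite (liftE _ Sx) Ff. Qed.

Lemma hatA_holomorphic a : holomorphic_Dhat (hatA a).
Proof. by rewrite /hatA; case: cid => f []. Qed.

Lemma hatA_Delta a y : val a y = hatA a (DeltaD y).
Proof. by rewrite /hatA; case: cid => f [_ /= h]; exact: (congr1 (@^~ y) h). Qed.

Lemma hatA_curve a : curve_hol (lift (hatA a)).
Proof. exact/holomorphic_curve/hatA_holomorphic. Qed.

Lemma coW_DeltaZ (r : Zt) : exists Sx : Zfun (coW (val r, conjV (val r))),
  DeltaZ r = piDhat (mkZ Sx).
Proof.
have Sx : Zfun (coW (val r, conjV (val r))) by exact/Zhat_coW/Zset_Zhat/set_valP.
exists Sx; congr piDhat; apply: val_inj; rewrite val_mkZ coWK; reflexivity.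
Qed.

(** [DeltaD] evaluates at a chosen representative, which differs from p by a unit [u]; as conj u =
    u^-1, the two points of the quadric lie in one orbit. *)
Lemma Zreal_Delta x (Sx : Zfun x) : Zreal x -> exists y, piDhat (mkZ Sx) = DeltaD y.
Proof.
move=> [_ rx]; pose r : 'rV[C]_n.+1 := \row_i x (pc i).
have xr : mkW x = (r, conjV r).
  by congr (_, _); apply/rowP => i; rewrite !mxE rx.
have Sr : Zset r.
  have := Zhat_mkW Sx; rewrite xr /Zhat /Zset /bil /= => <-.
  by congr (- _ + _); [|apply: eq_bigr => i _]; rewrite ![in RHS]mxE normCK !mxE.
pose rz : Zt := SigSub (mem_set Sr).
exists (\pi_(Dn R n) rz); rewrite /DeltaD.
have /eqquotP/asboolP[u [u1 e]] : rz = repr (\pi_(Dn R n) rz) %[mod Dn R n] by rewrite reprK.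
have [Sy ->] := coW_DeltaZ (repr (\pi_(Dn R n) rz)).
have u0 : u != 0 by apply/eqP => u0; move: u1; rewrite u0 normr0 => /esym/eqP; rewrite oner_eq0.
apply/piDhatP; exists u => //; rewrite !val_mkZ !mkWK e.
apply/funext => -[[] i]; rewrite /coW /act /tor /=; first by rewrite !mxE.
rewrite !mxE rx rmorphM /=; congr (_ * _).
by apply: (mulIf u0); rewrite mulVf // mulrC -normCK u1 expr1n.
Qed.

(** The tool by which pointwise identities on D_n pass to hat functions. Asking for holomorphy of
    [F] along curves only lets sums, products and conjugates through [tau] be inserted directly. *)
Lemma hatA_ext a F : curve_hol (lift F) -> (forall y, val a y = F (DeltaD y)) ->
  forall d, hatA a d = F d.
Proof.
move=> hF aF d; have [x [Sx ->]] := Dhat_surj d.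
rewrite -!liftE; apply/eqP; rewrite -subr_eq0; apply/eqP.
apply: (@uniqueness _ _ (fun x => lift (hatA a) x - lift F x)) => // [gam z Sg dg|y ry].
  exact: (differentiableB (@hatA_curve a gam z Sg dg) (hF gam z Sg dg)).
have [Sy _] := ry; rewrite !(liftE _ Sy).
have [t ->] := Zreal_Delta Sy ry.
by rewrite -hatA_Delta aF subrr.
Qed.

Lemma holomorphic_mem F : holomorphic_Dhat F -> @Aset R n (F \o @DeltaD R n).
Proof. by move=> hF; exists F. Qed.

Definition mkA F (hF : holomorphic_Dhat F) : AD := SigSub (mem_set (holomorphic_mem hF)).

Lemma val_mkA F (hF : holomorphic_Dhat F) y : val (mkA hF) y = F (DeltaD y).
Proof. by []. Qed.

Lemma hatA_mkA F (hF : holomorphic_Dhat F) d : hatA (mkA hF) d = F d.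
Proof. by apply: hatA_ext => //; exact: holomorphic_curve. Qed.

Lemma val_funP (a : AD) (f : Dn R n -> C) : val a = f -> forall y, val a y = f y.
Proof. by move=> ->. Qed.

Lemma delta_Spec d : @SpecSet R n (delta d).
Proof.
rewrite /delta; have hc := hatA_curve; split.
- move=> a b c /val_funP e; apply: (@hatA_ext c (fun d => hatA a d + hatA b d)); last first.
    by move=> y; rewrite e !hatA_Delta.
  apply: (curve_hol_lift (f := fun x => lift (hatA a) x + lift (hatA b) x)).
    by move=> x Sx; rewrite !(liftE _ Sx).
  by move=> gam z Sg dg; exact: (differentiableD (hc a _ _ Sg dg) (hc b _ _ Sg dg)).
- move=> l a b /val_funP e; apply: (@hatA_ext b (fun d => l * hatA a d)); last first.
    by move=> y; rewrite e !hatA_Delta.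
  apply: (curve_hol_lift (f := fun x => l * lift (hatA a) x)).
    by move=> x Sx; rewrite !(liftE _ Sx).
  by move=> gam z Sg dg; exact: (differentiableM (differentiable_cst _ _) (hc a _ _ Sg dg)).
- move=> a b c /val_funP e; apply: (@hatA_ext c (fun d => hatA a d * hatA b d)); last first.
    by move=> y; rewrite e !hatA_Delta.
  apply: (curve_hol_lift (f := fun x => lift (hatA a) x * lift (hatA b) x)).
    by move=> x Sx; rewrite !(liftE _ Sx).
  by move=> gam z Sg dg; exact: (differentiableM (hc a _ _ Sg dg) (hc b _ _ Sg dg)).
- move=> a /val_funP e; apply: (@hatA_ext a (fun d => 1)); last by move=> y; rewrite e.
  by apply: (curve_hol_lift (f := fun x => 1)).
move=> a e e0; exists 1%N, (fun=> [set d]); split; first by move=> _; exact: compact_set1.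
exists e; split => // b c /val_funP cE /(_ ord0).
rewrite /seminorm image_set1 sup1.
suff -> : hatA c d = hatA b d - hatA a d by [].
apply: (@hatA_ext c (fun d => hatA b d - hatA a d)); last by move=> y; rewrite cE !hatA_Delta.
apply/holomorphic_curve/holomorphicB; exact: hatA_holomorphic.
Qed.

Definition pcoord (i j : 'I_n.+1) x : C := x (pc i) * x (qc j).

(** At an index a with p^a q^a <> 0, column a determines p up to a factor and row a determines q up
    to the inverse factor. *)
Lemma pcoord_separate x y : Zfun x -> (forall i j, pcoord i j x = pcoord i j y) ->
  exists2 l : C, l != 0 & y = act l x.
Proof.
move=> Sx xy; have [a] := exists_diag Sx; rewrite -/(pcoord a a x) => aa.
have aay : pcoord a a y != 0 by rewrite -xy.
move: aa aay; rewrite /pcoord !mulf_eq0 !negb_or => /andP[xp xq] /andP[yp yq].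
exists (y (pc a) / x (pc a)); first by rewrite mulf_neq0 // invr_eq0.
apply/funext => -[[] i]; rewrite /act /tor /=.
  have /= e1 := xy i a; have /= e2 := xy a a; rewrite /pcoord in e1 e2.
  have h : x (pc a) * y (qc a) != 0 by rewrite mulf_neq0.
  apply: (mulIf h); transitivity (x (pc i) * (x (pc a) * x (qc a))).
    by rewrite mulrCA -e1; ring.
  by rewrite e2; field.
have /= e3 := xy a i; rewrite /pcoord in e3.
by apply: (mulfI yp); rewrite -e3; field; rewrite xp yp.
Qed.

Lemma invpoly_pcoord i j : invpoly (pcoord i j).
Proof. exact: invpoly_coord. Qed.

Definition Pij i j : AD := mkA (holomorphic_inv_fun (invpoly_pcoord i j)).

Lemma hatA_Pij i j x (Sx : Zfun x) : hatA (Pij i j) (piDhat (mkZ Sx)) = pcoord i j x.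
Proof.
by rewrite hatA_mkA inv_funE ?val_mkZ ?mkWK //; exact: invpoly_pcoord.
Qed.

Lemma Dhat_eq d1 d2 : (forall i j, hatA (Pij i j) d1 = hatA (Pij i j) d2) -> d1 = d2.
Proof.
have [x [Sx ->]] := Dhat_surj d1; have [y [Sy ->]] := Dhat_surj d2 => h.
have [i j|l l0 yx] := @pcoord_separate x y Sx.
  by have := h i j; rewrite !hatA_Pij.
by apply/piDhatP; exists l => //; rewrite !val_mkZ !mkWK.
Qed.

Lemma delta_inj : injective (@delta R n).
Proof.
move=> d1 d2 h; apply: Dhat_eq => i j.
exact: (congr1 (fun g : AD -> C => g (Pij i j)) h).
Qed.

(** The minor M_ia M_aj = M_ij M_aa factors M into its column and its normalised row through [a];
    the trace condition puts the resulting point on the quadric. *)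
Lemma rank_one (M : 'I_n.+1 -> 'I_n.+1 -> C) (a : 'I_n.+1) :
  (forall i j k l, M i j * M k l = M i l * M k j) ->
  M ord0 ord0 = 1 + \sum_(i < n.+1 | i != ord0) M i i -> M a a != 0 ->
  let x : K -> C := fun k => if k.1 then M k.2 a else M a k.2 / M a a in
  Zfun x /\ forall i j, pcoord i j x = M i j.
Proof.
move=> minor tr Maa x.
have xM i j : pcoord i j x = M i j.
  by rewrite /pcoord /x /= mulrA minor mulfK.
split => //; rewrite /Zfun /quad /= -/(pcoord _ _ x) xM tr; congr (_ + _).
by apply: eq_bigr => i _; rewrite -/(pcoord _ _ x) xM.
Qed.

Section Character.
Variable phi : AD -> C.
Hypothesis hphi : @SpecSet R n phi.

Let phiD a b c : val c = (fun y => val a y + val b y) -> phi c = phi a + phi b.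
Proof. by case: hphi => h _ _ _ _; exact: h. Qed.

Let phiZ (l : C) a b : val b = (fun y => l * val a y) -> phi b = l * phi a.
Proof. by case: hphi => _ h _ _ _; exact: h. Qed.

Let phiM a b c : val c = (fun y => val a y * val b y) -> phi c = phi a * phi b.
Proof. by case: hphi => _ _ h _ _; exact: h. Qed.

Let phi1 a : val a = (fun=> 1) -> phi a = 1.
Proof. by case: hphi => _ _ _ h _; exact: h. Qed.

Definition charmx i j := phi (Pij i j).

Lemma val_eq a b : (forall y, val a y = val b y) -> a = b.
Proof. by move=> h; apply: val_inj; apply/funext. Qed.

Lemma phi_inv (P : (K -> C) -> C) (pP : invpoly P) x a :
  (forall i j, charmx i j = pcoord i j x) ->
  (forall y, val a y = inv_fun P (DeltaD y)) -> phi a = P x.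
Proof.
move=> hx; elim: pP a => [c|i j|f g pf IHf pg IHg|f g pf IHf pg IHg] a ha.
- pose u := mkA (holomorphic_inv_fun (invpoly_cst n 1%R)).
  have hu : phi u = 1 by apply: phi1; apply/funext => y; rewrite val_mkA.
  rewrite -[RHS]mulr1 -hu; apply: phiZ; apply/funext => y.
  by rewrite ha val_mkA /inv_fun mulr1.
- have -> : a = Pij i j by apply: val_eq => y; rewrite ha.
  exact: hx.
- rewrite -(IHf (mkA (holomorphic_inv_fun pf))) // -(IHg (mkA (holomorphic_inv_fun pg))) //.
  by apply: phiD; apply/funext => y; rewrite ha.
rewrite -(IHf (mkA (holomorphic_inv_fun pf))) // -(IHg (mkA (holomorphic_inv_fun pg))) //.
by apply: phiM; apply/funext => y; rewrite ha.
Qed.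

Lemma charmx_minor i j k l : charmx i j * charmx k l = charmx i l * charmx k j.
Proof.
have p1 := invpolyM (invpoly_pcoord i j) (invpoly_pcoord k l).
pose a := mkA (holomorphic_inv_fun p1).
rewrite -(phiM (c := a)) -?(phiM (c := a)) //; apply/funext => y.
by rewrite !val_mkA /inv_fun /pcoord; ring.
Qed.

Lemma charmx_trace : charmx ord0 ord0 = 1 + \sum_(i < n.+1 | i != ord0) charmx i i.
Proof.
rewrite big_mkcond /=.
(* Additivity of [phi] is available for two summands only, so the sum is built along a list,
   starting from the unit. *)
have gen (r : seq 'I_n.+1) a :
  (forall y, val a y = inv_fun (fun x => 1 + \sum_(i <- r) (if i != ord0 then pcoord i i x else 0)) (DeltaD y)) ->
  phi a = 1 + \sum_(i <- r) (if i != ord0 then charmx i i else 0).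
  elim: r a => [|i r IH] a ha.
    rewrite big_nil addr0; apply: phi1; apply/funext => y; rewrite ha /inv_fun.
    by rewrite big_nil addr0.
  rewrite big_cons.
  have pr : invpoly (fun x : K -> C => 1 + \sum_(i <- r) (if i != ord0 then pcoord i i x else 0)).
    apply: invpolyD; first exact: invpoly_cst.
    apply: invpoly_sum => k; have [_|_] := boolP (k != ord0); first exact: invpoly_pcoord.
    exact: invpoly_cst.
  case: (boolP (i != ord0)) => [i0|/negPf i0].
    rewrite addrCA -(IH (mkA (holomorphic_inv_fun pr))) //.
    apply: phiD; apply/funext => y; rewrite ha !val_mkA /inv_fun big_cons i0.
    by ring.
  rewrite add0r; apply: IH => y; rewrite ha /inv_fun big_cons i0.
  by rewrite add0r.
rewrite /charmx; apply: gen => y; rewrite val_mkA /inv_fun.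
have := Zfun_val (repr (DeltaD y)); rewrite /Zfun /quad /= /pcoord => ->.
by congr (_ + _); rewrite big_mkcond.
Qed.

Lemma phi_point : exists x, Zfun x /\ forall i j, charmx i j = pcoord i j x.
Proof.
have [k Maa] : exists k, charmx k k != 0.
  apply/not_existsP => h; have {}h j : charmx j j = 0.
    by apply/eqP; apply: contra_notT (h j).
  have := charmx_trace; rewrite h big1 // addr0 => /esym/eqP.
  by rewrite oner_eq0.
have [Sx hx] := rank_one charmx_minor charmx_trace Maa.
by eexists; split; [exact: Sx|move=> i j; rewrite hx].
Qed.

Lemma compact_bounded_Dh (L : set Dh) F : compact L -> continuous F ->
  exists B : R, forall d, L d -> absC (F d) <= B.
Proof.
move=> /compact_near_coveringP cL cF.
have := cL R (+oo)%R (fun M d => absC (F d) <= M) _.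
case.
  move=> d _.
  have hA : nbhs (F d) [set y | absC (y - F d) < 1] by apply/nbhsCP; exists 1.
  exists ([set e | absC (F e - F d) < 1], [set M | absC (F d) + 1 < M]) => /=.
    split; first exact: cF _ hA.
    by apply: nbhs_pinfty_gt; exact: num_real.
  by move=> [e M] /= [h1 h2]; have := absC_sub (F e) (F d); lra.
move=> M0 [_ hM]; exists (M0 + 1) => d Ld.
by apply: (hM (M0 + 1)) => //; rewrite ltrDl.
Qed.

(** Dividing p by its entry p^i of largest modulus gives entries bounded by 1 and turns each q^j
    into p^i q^j, which is bounded by [B]. *)
Lemma bounded_rep (B : R) x : Zfun x -> (forall i j, absC (pcoord i j x) <= B) ->
  exists2 z : C, z != 0 & cbounded (Num.max 1 B) (act z x).
Proof.
move=> Sx hB; have [a pqa] := exists_diag Sx.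
have [i _ hi] := @Order.TotalTheory.arg_maxP _ _ 'I_n.+1 a xpredT (fun i => absC (x (pc i))) isT.
have pi0 : x (pc i) != 0.
  rewrite -absC_gt0; apply: lt_le_trans (hi a isT); rewrite absC_gt0.
  by move: pqa; rewrite mulf_eq0 negb_or => /andP[].
exists (x (pc i))^-1; first by rewrite invr_eq0.
move=> -[[] j]; rewrite /act /tor /= absCM absCV ?absCV ?invrK le_max.
  by rewrite ler_pdivrMl ?absC_gt0 // mulr1; apply/orP; left; exact: (hi j isT).
by rewrite -absCM hB orbT.
Qed.

(** Continuity at [a] involves finitely many compact sets. The approximating polynomial must be
    close to hat a on all of them, to control [phi], and at the point [x], to control [delta]. *)
Theorem phi_delta : exists d, phi = delta d.
Proof.
have [x [Sx hx]] := phi_point; exists (piDhat (mkZ Sx)).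
apply/funext => a; rewrite /delta.
apply/eqP; rewrite -subr_eq0 -absC_eq0 eq_le absC_ge0 andbT.
apply/ler_addgt0Pl => e e0; rewrite addr0.
have e20 : 0 < e / 2 by rewrite divr_gt0.
case: hphi => _ _ _ _ /(_ a (e / 2) e20)[k [Ks [cK [d [d0 hd]]]]].
have [B hB] : exists B : R, forall (s : 'I_k) i j y, Ks s y -> absC (hatA (Pij i j) y) <= B.
  have h s i j : exists B : R, forall y, Ks s y -> absC (hatA (Pij i j) y) <= B.
    apply: compact_bounded_Dh (cK s) _.
    exact/holomorphic_continuous/hatA_holomorphic.
  have {}h (t : 'I_k * ('I_n.+1 * 'I_n.+1)) : exists B : R, forall y, Ks t.1 y -> absC (hatA (Pij t.2.1 t.2.2) y) <= B.
    exact: h.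
  have [Bf hBf] := choice h.
  exists (\sum_t `|Bf t|) => s i j y Ky.
  apply: le_trans (hBf (s, (i, j)) y Ky) _; apply: le_trans (ler_norm _) _.
  by rewrite (bigD1 (s, (i, j))) //= lerDl sumr_ge0.
(* Bounds every P_ij both on the compact sets and at [x], so one polynomial serves both
   estimates. *)
pose B1 := Num.max B (\sum_i \sum_j absC (pcoord i j x)).
have PA : polyapprox (@Zfun R n) (lift (hatA a)).
  apply: polyapprox_quadric; first exact: hatA_curve.
  exact/holomorphic_bounded/hatA_holomorphic.
have m0 : 0 < Num.min (d / 2) (e / 2) by rewrite lt_min e20 divr_gt0.
have [P pP hP] := invpoly_approx PA (@lift_act R n (hatA a)) (Num.max 1 B1) m0.
have near_P y (Sy : Zfun y) : (forall i j, absC (pcoord i j y) <= B1) ->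
    absC (hatA a (piDhat (mkZ Sy)) - P y) <= Num.min (d / 2) (e / 2).
  move=> yB; have [z z0 zB] := bounded_rep Sy yB.
  have Sz : Zfun (act z y) by exact: tor_Zfun.
  have := hP _ Sz zB; rewrite lift_act // invpoly_act //.
  by rewrite (liftE _ Sy).
pose b := mkA (holomorphic_inv_fun pP).
pose c := mkA (holomorphicB (holomorphic_inv_fun pP) (hatA_holomorphic a)).
have cE : val c = (fun y => val b y - val a y).
  by apply/funext => y; rewrite !val_mkA hatA_Delta.
have := hd b c cE.
have phib : phi b = P x by apply: (phi_inv pP hx) => y; rewrite val_mkA.
rewrite phib => hPe.
have {}hPe : absC (P x - phi a) < e / 2.
  apply: hPe => s; apply: le_lt_trans (_ : d / 2 < d); last by lra.
  (* On an empty compact set the seminorm is [sup set0], which is 0 by convention. *)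
  rewrite /seminorm; have [->|/set0P[y0 Ky0]] := eqVneq (Ks s) set0.
    by rewrite image_set0 sup0 divr_ge0 // ltW.
  apply: sup_le_ub; first by exists (absC (hatA c y0)), y0.
  move=> _ [y Ky <-]; rewrite hatA_mkA absCB.
  have [w [Sw yw]] := Dhat_surj y; rewrite yw inv_funE // val_mkZ mkWK.
  apply: le_trans (near_P w Sw _) _; last by rewrite ge_min lexx.
  move=> i j; rewrite le_max -(hatA_Pij i j Sw) -yw.
  by apply/orP; left; exact: hB Ky.
have := near_P x Sx _; move=> /(_ _) h.
have {}h : absC (hatA a (piDhat (mkZ Sx)) - P x) <= e / 2.
  apply: le_trans (h _) _; last by rewrite ge_min lexx orbT.
  move=> i j; rewrite le_max; apply/orP; right.
  rewrite (bigD1 i) //= (bigD1 j) //= -addrA lerDl addr_ge0 // sumr_ge0 // => u _.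
    exact: absC_ge0.
  by rewrite sumr_ge0 // => v _; exact: absC_ge0.
rewrite absCB; set h1 := hatA a _ in h *.
have -> : h1 - phi a = (h1 - P x) + (P x - phi a) by ring.
by apply: le_trans (absCD _ _) _; lra.
Qed.

End Character.

End Spectrum.

(** * Restricting homeomorphisms to subspaces *)

Section Homeomorphisms.

(** The inverse is the given one after the inclusion of B' into B; it lands in A because A is the
    preimage of B'. *)
Lemma homeo_between_restrict (X Y : topologicalType) (A : set X) (B B' : set Y) (f : X -> Y) :
  B' `<=` B -> homeo_onto B f -> (forall x, A x <-> B' (f x)) -> homeo_between A B' f.
Proof.
move=> B'B [H [cf [g [cg fg gf]]]] AB.
exists (fun x => (AB (val x)).1 (set_valP x)).
pose incl (y : set_type B') : set_type B := SigSub (mem_set (B'B _ (set_valP y))).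
have fE x (h : x \in B) : f (g (SigSub h)) = x by have := congr1 val (gf (SigSub h)).
have Ag y : A (g (incl y)).
  by apply/AB; rewrite /incl fE; exact: set_valP.
split.
  apply: continuous_comp_initial.
  have c1 : continuous (fun x : X => f x).
    move=> x; apply: (@continuous_comp _ _ _ _ (@set_val Y B) x (cf x)).
    exact: initial_continuous.
  move=> x; apply: (@continuous_comp _ _ _ (@set_val X A) f x); last exact: c1.
  exact: initial_continuous.
exists (fun y => SigSub (mem_set (Ag y))); split.
- apply: continuous_comp_initial.
  have cincl : continuous incl.
    apply: continuous_comp_initial; exact: initial_continuous.
  by move=> y; apply: (@continuous_comp _ _ _ incl g y (cincl y)); exact: cg.
- move=> x; apply: val_inj => /=; rewrite -[RHS]fg; congr g; exact: val_inj.
by move=> y; apply: val_inj => /=; rewrite fE.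
Qed.

End Homeomorphisms.

(** * Continuity of [delta] and of its inverse; the involution [tau] *)

Section Main.
Variables (R : realType) (n : nat).
Local Notation C := R[i].
Local Notation K := (bool * 'I_n.+1)%type.
Local Notation Zh := (set_type (@Zhat R n)).
Local Notation Dh := (Dhat R n).
Local Notation AD := (AD R n).
Implicit Types (x : K -> C).

Lemma eval_continuous (a : AD) : continuous (fun phi : {ptws AD -> C} => phi a).
Proof. exact: (@proj_continuous AD (fun=> C) a). Qed.

Lemma delta_continuous : continuous (@delta R n).
Proof.
move=> d; have F : Filter (nbhs d) := nbhs_filter d.
apply/cvg_sup => a.
apply: (@continuous_comp_initial _ _ _ (fun phi : AD -> C => phi a) (@delta R n)).
exact/holomorphic_continuous/hatA_holomorphic.
Qed.

(* For M = (phi(P_ij)) this is p = M_{.a}, q = M_{a.}/M_aa: where M_aa <> 0 it depends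
   continuously on phi, which gives continuity of the inverse of delta. *)
Definition section_of (a : 'I_n.+1) (phi : AD -> C) : K -> C :=
  fun k => if k.1 then phi (Pij R k.2 a) else phi (Pij R a k.2) / phi (Pij R a a).

Lemma section_of_delta a (d : Dh) : delta d (Pij R a a) != 0 ->
  exists Sx : Zfun (section_of a (delta d)), piDhat (mkZ Sx) = d.
Proof.
move=> da; have hd := delta_Spec d.
have [Sx hx] := rank_one (charmx_minor hd) (charmx_trace hd) da.
exists Sx; apply: Dhat_eq => i j; rewrite hatA_Pij; exact: hx.
Qed.

Lemma nbhs_mkW x (U : set ('rV[C]_n.+1 * 'rV[C]_n.+1)%type) : nbhs (mkW x) U ->
  exists2 e : R, 0 < e & forall y, (forall k, absC (y k - x k) < e) -> U (mkW y).
Proof.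
move=> /nbhs_ballP[e /= e0 he].
have eR : e = (complex.Re e)%:C%C by rewrite RRe_real // gtr0_real.
have e1 : 0 < complex.Re e by move: e0; rewrite eR ltcR.
exists (complex.Re e) => // y hy; apply: he.
have yk k : ball (x k) e (y k).
  by rewrite -ball_normE /= eR normr_absC ltcR absCB.
by split; split => // i j; rewrite !mxE; exact: yk.
Qed.

Lemma delta_homeo : homeo_onto (@SpecSet R n) (@delta R n).
Proof.
exists (@delta_Spec R n); split.
  by apply: continuous_comp_initial; exact: delta_continuous.
have inv (phi : set_type (@SpecSet R n)) : exists d, val phi = delta d.
  exact: phi_delta (set_valP phi).
have [g hg] := choice inv.
exists g; split; last first.
- by move=> phi; apply: val_inj => /=; rewrite -hg.
- by move=> d; apply: delta_inj; rewrite -hg.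
move=> phi A hA.
have [x [Sx gx]] := Dhat_surj (g phi).
have [a xa] := exists_diag Sx.
pose M i j (psi : set_type (@SpecSet R n)) : C := val psi (Pij R i j).
have cM i j : continuous (M i j).
  move=> psi; apply: (@continuous_comp _ _ _ (@set_val _ (@SpecSet R n))
    (fun f : {ptws AD -> C} => f (Pij R i j)) psi); last exact: eval_continuous.
  exact: initial_continuous.
have Ma : M a a phi != 0 by rewrite /M hg gx /delta hatA_Pij.
have gS psi : M a a psi != 0 -> exists Sy : Zfun (section_of a (val psi)), piDhat (mkZ Sy) = g psi.
  by move=> h; rewrite /M (hg psi) in h *; exact: section_of_delta.
have [S0 pS0] := gS phi Ma.
have hA' : nbhs (piDhat (mkZ S0)) A by rewrite pS0.
(* The neighbourhood is pulled back to hat Z and then described by an open set [U] of the ambient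
   space, where closeness can be checked coordinatewise. *)
have : nbhs (mkZ S0) (@piDhat R n @^-1` A) := @pi_continuous _ _ (mkZ S0) A hA'.
case=> _ [[U oU <-] /= US UA].
have nU : nbhs (mkW (section_of a (val phi))) U by exact: open_nbhs_nbhs.
have [e e0 he] := nbhs_mkW nU.
have csec k : \forall psi \near phi, absC (section_of a (val psi) k - section_of a (val phi) k) < e.
  have cs : {for phi, continuous (fun psi : set_type (@SpecSet R n) => section_of a (val psi) k)}.
    case: k => -[] i; rewrite /section_of /=; first exact: cM.
    apply: (cvgM (cM a i phi)); apply: (cvgV Ma); exact: cM.
  have hB : nbhs (section_of a (val phi) k)
      [set y | absC (y - section_of a (val phi) k) < e] by apply/nbhsCP; exists e.
  exact: (cs _ hB).
have nMa : \forall psi \near phi, M a a psi != 0 := cM a a phi _ (near_neq0 Ma).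
have near_all : \forall psi \near phi, forall k, absC (section_of a (val psi) k - section_of a (val phi) k) < e.
  exact: (filter_forall (nbhs_filter phi) csec).
apply: filterS2 nMa near_all => psi psia hpsi.
have [Sy e1] := gS psi psia.
suff : A (g psi) by []; rewrite -e1.
by apply: (UA (mkZ Sy)); apply: he.
Qed.

Definition taufun x : K -> C := fun k => (x (~~ k.1, k.2))^*.

Lemma taufun_Zfun x : Zfun x -> Zfun (taufun x).
Proof.
move=> Sx; have := congr1 Num.conj Sx; rewrite /Zfun /quad /taufun /= rmorphD rmorph1 rmorph_sum rmorphM /= mulrC => ->.
by congr (_ + _); apply: eq_bigr => i _; rewrite rmorphM mulrC.
Qed.

Lemma tau_piDhat x (Sx : Zfun x) (St : Zfun (taufun x)) :
  tau (piDhat (mkZ Sx)) = piDhat (mkZ St).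
Proof.
apply: Dhat_eq => i j; rewrite hatA_Pij.
rewrite /tau hatA_mkA inv_funE; last exact: invpoly_pcoord.
have /piDhatP[l l0] : piDhat (mkZ Sx) = piDhat (repr (piDhat (mkZ Sx))).
  by rewrite /piDhat reprK.
rewrite val_mkZ mkWK => e.
have -> : pcoord i j (taufun x) = (pcoord j i x)^*.
  by rewrite /pcoord /taufun /= rmorphM mulrC.
rewrite -(invpoly_act x (invpoly_pcoord R j i) l0) -e.
by rewrite /pcoord /coW /= !mxE rmorphM mulrC.
Qed.

(** Conjugating source and target conjugates the slope function, which remains continuous. *)
Lemma differentiable_conj (h : C -> C) z : differentiable h z^* ->
  differentiable (fun l => (h l^*)^*) z.
Proof.
move=> /differentiable_slope[q /continuousCP cq hq]; apply/differentiable_slope.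
exists (fun l => (q l^*)^*) => [|w]; last by rewrite -rmorphB hq rmorphM rmorphB /= !conjCK.
apply/continuousCP => e /cq[d d0 hd]; exists d => // w wz.
rewrite -rmorphB absC_conj; apply: hd.
by rewrite -rmorphB absC_conj.
Qed.

(** [taufun] makes a holomorphic curve antiholomorphic; reparametrising it by conjugation gives a
    holomorphic curve [gam'], to which the hypothesis on [f] applies. *)
Lemma curve_hol_tau (f : (K -> C) -> C) : curve_hol f -> curve_hol (fun x => (f (taufun x))^*).
Proof.
move=> hf gam z Sg dg.
pose gam' m := taufun (gam m^*).
have -> : (fun l => (f (taufun (gam l)))^*) = (fun l => (f (gam' l^*))^*).
  by apply/funext => l; rewrite /gam' conjCK.
apply: (@differentiable_conj (fun m => f (gam' m))).
apply: hf.
  move/nbhsCP: Sg => [d d0 hd]; apply/nbhsCP; exists d => // w wz.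
  apply: taufun_Zfun; apply: hd.
  by rewrite -{1}[z]conjCK -rmorphB absC_conj.
move=> k; apply: (@differentiable_conj (fun l => gam l (~~ k.1, k.2))).
by rewrite conjCK; exact: dg.
Qed.

Lemma tau_DeltaD (y : Dn R n) : tau (DeltaD y) = DeltaD y.
Proof.
have [Sx e] := coW_DeltaZ (repr y); rewrite /DeltaD e.
rewrite (tau_piDhat Sx (taufun_Zfun Sx)); congr piDhat; apply: eq_mkZ.
by apply/funext => -[[] i]; rewrite /taufun /coW /= /conjV !mxE ?conjCK.
Qed.

(** If [d] is fixed by [tau], the claim is that the hat function of conj a is conj of hat a after
    [tau], by uniqueness. Conversely, on D_n the conjugate of P_ji is P_ij, so a character takes
    equal values of P_ij at [d] and [tau d], and the P_ij separate points. *)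
Lemma delta_star (d : Dh) : Dext d <-> @SpecStarSet R n (delta d).
Proof.
split=> [td|[_ star]]; last first.
  apply: Dhat_eq => i j.
  have [x [Sx dx]] := Dhat_surj d; rewrite dx (tau_piDhat Sx (taufun_Zfun Sx)) !hatA_Pij.
  have h : hatA (Pij R i j) d = (hatA (Pij R j i) d)^*.
    apply: star; apply/funext => y; rewrite !val_mkA.
    have [Sy e] := coW_DeltaZ (repr y); rewrite /DeltaD e.
    rewrite !inv_funE; [|exact: invpoly_pcoord..].
    by rewrite val_mkZ mkWK /pcoord /coW /= /conjV !mxE rmorphM /= conjCK mulrC.
  by rewrite dx !hatA_Pij in h; rewrite h /pcoord /taufun /= rmorphM mulrC.
split; first exact: delta_Spec.
move=> a b ab; rewrite /delta.
rewrite (@hatA_ext _ _ b (fun d => (hatA a (tau d))^*)) ?td //.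
  apply: (curve_hol_lift (f := fun x => (lift (hatA a) (taufun x))^*)).
    by move=> x Sx; rewrite (tau_piDhat Sx (taufun_Zfun Sx)) (liftE _ (taufun_Zfun Sx)).
  exact/curve_hol_tau/hatA_curve.
by move=> y; rewrite ab tau_DeltaD hatA_Delta.
Qed.

End Main.

Theorem theorem4p9 (R : realType) (n : nat) (hn : (1 <= n)%N) :
  homeo_onto (@SpecSet R n) (@delta R n) /\
  homeo_between (@Dext R n) (@SpecStarSet R n) (@delta R n).
Proof.
split; first exact: delta_homeo.
apply: homeo_between_restrict (@delta_homeo R n) (@delta_star R n).
by move=> phi [].
Qed.
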